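(* Let $G$ be a graph on $n$ vertices. (1) There is an algorithm that takes an instance $(G,C',I')$ of Monopolar Extension as input, runs in $\mathcal{O}^{\star}(1.3734^{n})$ time, and correctly decides whether $G$ admits a monopolar partition that is an extension of $(C',I')$. If such a monopolar extension exists then this algorithm also outputs one such monopolar partition of $G$. (2) There is an algorithm that takes an instance $(G,L)$ of List Monopolar Partition as input, runs in $\mathcal{O}^{\star}(1.3734^{n})$ time, and correctly decides whether $G$ admits a monopolar partition that respects the list function $L$. If $G$ does admit such a monopolar partition, then this algorithm also outputs one such monopolar partition of $G$.
   Context: All graphs are finite, simple and undirected. A graph is a cluster graph if each connected component is a complete graph. A partition $V=C\uplus I$ of the vertex set of $G=(V,E)$ is a monopolar partition if $G[C]$ is a cluster graph and $I$ is an independent set of $G$. For disjoint subsets $C',I'\subseteq V$, a monopolar partition $V=C\uplus I$ with $C'\subseteq C$ and $I'\subseteq I$ is a monopolar extension of $(C',I')$. Monopolar Extension: given a graph $G$ and subsets $C',I'\subseteq V$, decide whether there is a monopolar extension of $(C',I')$. List Monopolar Partition: given $G$ and a list function $L$ with $\emptyset\neq L(v)\subseteq\{\hat C,\hat I\}$ for all $v\in V$, decide whether there is a map $f:V\to\{\hat C,\hat I\}$ with $f(v)\in L(v)$ for all $v$, $f^{-1}(\hat I)$ an independent set of $G$, and $f^{-1}(\hat C)$ inducing a cluster graph (a monopolar partition respecting $L$). $\mathcal{O}^{\star}$ hides polynomial factors in $n$. *)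

(* Defs.v *)
From HB Require Import structures.
From mathcomp Require Import all_boot all_order all_algebra.

Set Implicit Arguments.
Unset Strict Implicit.
Unset Printing Implicit Defensive.

Record sgraph (V : finType) := SGraph {
  adj :> rel V;
  adj_sym : symmetric adj;
  adj_irr : irreflexive adj }.

Definition component (V : finType) (G : sgraph V) (x : V) : {set V} :=
  [set y | connect G x y].

Definition complete_on (V : finType) (G : sgraph V) (A : {set V}) : Prop :=
  {in A &, forall x y, x != y -> G x y}.

Definition cluster_graph (V : finType) (G : sgraph V) : Prop :=
  forall x : V, complete_on G (component G x).

Section Induced.
Variables (V : finType) (G : sgraph V) (A : {set V}).

Definition induced_adj : rel {x : V | x \in A} :=
  fun x y => G (val x) (val y).

Lemma induced_adj_sym : symmetric induced_adj.
Proof. by move=> x y; apply: adj_sym. Qed.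

Lemma induced_adj_irr : irreflexive induced_adj.
Proof. by move=> x; apply: adj_irr. Qed.

Definition induced : sgraph {x : V | x \in A} :=
  SGraph induced_adj_sym induced_adj_irr.

End Induced.

Definition independent (V : finType) (G : sgraph V) (A : {set V}) : Prop :=
  {in A &, forall x y, ~~ G x y}.

(* Either part may be empty. *)
Definition monopolar_partition (V : finType) (G : sgraph V)
    (C I : {set V}) : Prop :=
  [/\ C :|: I = [set: V], [disjoint C & I],
      cluster_graph (induced G C) & independent G I].

Definition monopolar_extension (V : finType) (G : sgraph V)
    (C' I' : {set V}) (CI : {set V} * {set V}) : Prop :=
  [/\ monopolar_partition G CI.1 CI.2, C' \subset CI.1 & I' \subset CI.2].

Inductive label := hatC | hatI.

Definition bool_of_label (l : label) : bool := if l is hatC then true else false.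
Definition label_of_bool (b : bool) : label := if b then hatC else hatI.
Lemma bool_of_labelK : cancel bool_of_label label_of_bool.
Proof. by case. Qed.
HB.instance Definition _ := Finite.copy label (can_type bool_of_labelK).

Definition respecting_partition (V : finType) (G : sgraph V)
    (L : V -> {set label}) (f : V -> label) : Prop :=
  [/\ forall v, f v \in L v,
      independent G [set v | f v == hatI]
    & cluster_graph (induced G [set v | f v == hatC])].

(* Random access machine with logarithmic cost.  Registers and memory cells
   hold natural numbers of any size, and an instruction is charged the total
   bit length of the numbers it handles; up to polynomial factors in n, a
   time bound c ^ n therefore means the same here as on a word RAM with
   words of polynomially many (in n) bits. *)
Inductive instr :=
  | Const of nat & nat         (* Const d k : R[d] := k              *)
  | Add of nat & nat & nat     (* Add d i j : R[d] := R[i] + R[j]    *)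
  | Sub of nat & nat & nat     (* Sub d i j : R[d] := R[i] - R[j], truncated *)
  | Read of nat & nat          (* Read d i  : R[d] := M[R[i]]        *)
  | Write of nat & nat         (* Write i j : M[R[i]] := R[j]        *)
  | Jump of nat                (* Jump l    : go to l                *)
  | Jumpz of nat & nat.        (* Jumpz i l : go to l if R[i] = 0    *)

Definition program := seq instr.

Record state := State { pc : nat; reg : nat -> nat; mem : nat -> nat }.

Definition upd (f : nat -> nat) (a x : nat) : nat -> nat :=
  fun b => if b == a then x else f b.

Definition exec (c : instr) (s : state) : state :=
  let: State p r m := s in
  match c with
  | Const d k => State p.+1 (upd r d k) m
  | Add d i j => State p.+1 (upd r d (r i + r j)) m
  | Sub d i j => State p.+1 (upd r d (r i - r j)) m
  | Read d i => State p.+1 (upd r d (m (r i))) m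
  | Write i j => State p.+1 r (upd m (r i) (r j))
  | Jump l => State l r m
  | Jumpz i l => State (if r i == 0 then l else p.+1) r m
  end.

Definition bitlen (x : nat) : nat := (trunc_log 2 x).+1.

Definition cost (c : instr) (s : state) : nat :=
  let: State _ r m := s in
  match c with
  | Const _ k => bitlen k
  | Add _ i j | Sub _ i j | Write i j => bitlen (r i) + bitlen (r j)
  | Read _ i => bitlen (r i) + bitlen (m (r i))
  | Jump _ => 1
  | Jumpz i _ => bitlen (r i)
  end.

(* runs P s t s': from s, P halts in s' at total cost t.  The machine halts
   when the program counter leaves the program. *)
Inductive runs (P : program) : state -> nat -> state -> Prop :=
  | runs_halt s : onth P (pc s) = None -> runs P s 0 s
  | runs_step s c t s' : onth P (pc s) = Some c ->
      runs P (exec c s) t s' -> runs P s (cost c s + t) s'.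

Definition init (w : seq nat) : state := State 0 (fun _ => 0) (nth 0 w).

Definition holds_output (s : state) (w : seq nat) : Prop :=
  forall i, i < size w -> mem s i = nth 0 w i.

(* On the input w, P halts within time T; it answers 1 followed by the code of
   a solution if there is one, and 0 otherwise. *)
Definition solves (P : program) (T : nat) (w : seq nat)
    (S : Type) (sol : S -> Prop) (code : S -> seq nat) : Prop :=
  exists t s, [/\ runs P (init w) t s, t <= T
    & (exists2 x, sol x & holds_output s (1 :: code x))
      \/ ((forall x, ~ sol x) /\ holds_output s [:: 0])].

Definition bits (n : nat) (p : pred 'I_n) : seq nat :=
  [seq nat_of_bool (p v) | v <- enum 'I_n].

(* The number of vertices, then the adjacency matrix row by row. *)
Definition graph_code (n : nat) (G : sgraph 'I_n) : seq nat :=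
  n :: flatten [seq bits (G u) | u <- enum 'I_n].

Definition partition_code (n : nat) (CI : {set 'I_n} * {set 'I_n}) : seq nat :=
  bits (fun v => v \in CI.1) ++ bits (fun v => v \in CI.2).

Definition extension_code (n : nat) (G : sgraph 'I_n) (C' I' : {set 'I_n}) :
    seq nat :=
  graph_code G ++ partition_code (C', I').

Definition list_code (n : nat) (G : sgraph 'I_n) (L : 'I_n -> {set label}) :
    seq nat :=
  graph_code G ++ bits (fun v => hatC \in L v) ++ bits (fun v => hatI \in L v).

Definition labelling_code (n : nat) (f : 'I_n -> label) : seq nat :=
  bits (fun v => f v == hatC).

(* T(n) = O*(b ^ n) *)
Definition Ostar_exp (b : rat) (T : nat -> nat) : Prop :=
  exists (p : {poly rat}) (n0 : nat), forall n, n0 <= n ->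
    ((T n)%:R <= p.[n%:R] * b ^+ n)%R.

(* Main.v *)
Require Import Defs.
From HB Require Import structures.
From mathcomp Require Import all_boot all_order all_algebra.
From mathcomp Require Import zify lra.

Set Implicit Arguments.
Unset Strict Implicit.
Unset Printing Implicit Defensive.

Import GRing.Theory Num.Theory.

(** Keep a partial labelling in which every neighbour of a vertex forced into
    the independent part is forced into the cluster part, and branch on an
    undecided vertex [v] of maximum degree in the graph of undecided vertices:
    [v] joins the cluster part, or it joins the independent part and its
    neighbours join the cluster part.

    Once all undecided degrees are at most 2, the problem is 2-SAT.  Every
    induced path on three vertices that meets the forced cluster part gives a
    binary clause.  For the others take a solution of these clauses that
    prefers the independent part.  In it an undecided cluster vertex has a
    neighbour in the independent part, since otherwise it could be moved; so
    the middle vertex of a path of undecided cluster vertices would have three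
    undecided neighbours.

    An undecided vertex of degree 0, 1, 2 or at least 3 weighs 0, 2, 4 or 5.
    Each branching satisfies [y ^ m1 + y ^ m2 <= y ^ m] for the total weights
    and [y = 49 / 46], whence at most [y ^ (5 * n)] leaves, and [y ^ 5 < 1.3734].

    The random access machine program is compiled from a language with bounded
    loops.  The bounds are read-only registers of value at most [2 * n], so the
    number of steps of one round is polynomial and values grow by a polynomial
    amount per round; after exponentially many rounds their bit length is still
    polynomial. *)

(** * A structured language for the random access machine *)

(** Counting undecided vertices is not enough: branching at degree 3 removes one vertex or four, and
    the positive root of [x ^ 4 = x ^ 3 + 1] is 1.3803. What this count misses in the branch that
    removes [v] alone is the drop in the degrees of its neighbours. The weights record it: a
    neighbour of degree 1 or 2 loses 2 and one of degree 3 loses 1. A neighbour of degree above 3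
    may lose nothing, but then [v] has degree at least 4 and the other branch removes enough weight.

    The tightest case is a star with three leaves, where both branches save exactly 11. So [y] must
    be at least [2 ^ (1/11)], about 1.06504, and 49/46 is a rational just above it.

    Propagation supplies the third undecided neighbour at a leaf: a neighbour in the independent
    part cannot be a forced one, because it would have forced the middle vertex.

    The recursion becomes a single loop. Each stack frame is a complete partial labelling in memory,
    and a round handles one node of the branching tree. *)

Inductive expr :=
  | Lit of nat
  | Var of nat
  | Plus of expr & expr
  | Minus of expr & expr
  | Fetch of expr
  | Times of expr & nat.

(** Increment is a command of its own because it is meant to be the only one that can raise the
    largest stored value. *)
Inductive cmd :=
  | Assign of nat & expr
  | Store of expr & expr
  | Incr of nat
  | Seq of cmd & cmd
  | Cond of expr & cmd & cmd
  | For of nat & nat & cmd.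

Definition store := ((nat -> nat) * (nat -> nat))%type.

Definition setr (s : store) (x v : nat) : store := (upd s.1 x v, s.2).

Fixpoint eval (e : expr) (s : store) : nat :=
  match e with
  | Lit k => k
  | Var x => s.1 x
  | Plus a b => eval a s + eval b s
  | Minus a b => eval a s - eval b s
  | Fetch a => s.2 (eval a s)
  | Times a x => eval a s * s.1 x
  end.

Fixpoint run (c : cmd) (s : store) : store :=
  match c with
  | Assign x e => setr s x (eval e s)
  | Store a e => (s.1, upd s.2 (eval a s) (eval e s))
  | Incr x => setr s x (s.1 x).+1
  | Seq c1 c2 => run c2 (run c1 s)
  | Cond e c1 c2 => if eval e s == 0 then run c2 s else run c1 s
  | For x y c =>
      iter (s.1 y) (fun s' => let s'' := run c s' in setr s'' x (s''.1 x).+1)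
        (setr s x 0)
  end.

(* Registers below [NV] hold the variables, the others are scratch space. *)
Definition NV := 12.

(** Jumps are absolute, hence the position [p]. The value ends up in register [t], and only
    registers from [t] on are written. The machine can neither copy nor multiply registers: a copy
    is an addition to a zeroed register, a product a loop of additions. *)
Fixpoint cexpr (p t : nat) (e : expr) : seq instr :=
  match e with
  | Lit k => [:: Const t k]
  | Var x => [:: Const t 0; Add t x t]
  | Plus a b =>
      let ca := cexpr p t a in
      ca ++ cexpr (p + size ca) t.+1 b ++ [:: Add t t t.+1]
  | Minus a b =>
      let ca := cexpr p t a in
      ca ++ cexpr (p + size ca) t.+1 b ++ [:: Defs.Sub t t t.+1]
  | Fetch a => cexpr p t a ++ [:: Read t t]
  | Times a x =>
      let ca := cexpr p t.+1 a in
      let q := p + size ca in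
      ca ++ [:: Const t 0; Const t.+2 1; Const t.+3 0; Add t.+3 x t.+3;
                Jumpz t.+3 (q + 8); Add t t t.+1; Defs.Sub t.+3 t.+3 t.+2;
                Jump (q + 4)]
  end.

(** The compiled loop compares counter and bound anew in each round, whereas [run] fixes the number
    of rounds at the start. The two agree because [wfc] forbids the body to write [x] or [y]. *)
Fixpoint ccmd (p : nat) (c : cmd) : seq instr :=
  match c with
  | Assign x e => cexpr p NV e ++ [:: Const NV.+1 0; Add x NV NV.+1]
  | Store a e =>
      let ca := cexpr p NV a in
      ca ++ cexpr (p + size ca) NV.+1 e ++ [:: Write NV NV.+1]
  | Incr x => [:: Const NV 1; Add x x NV]
  | Seq c1 c2 => let k1 := ccmd p c1 in k1 ++ ccmd (p + size k1) c2
  | Cond e c1 c2 =>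
      let ce := cexpr p NV e in
      let k1 := ccmd (p + size ce).+1 c1 in
      let q := ((p + size ce).+1 + size k1).+1 in
      let k2 := ccmd q c2 in
      ce ++ Jumpz NV q :: k1 ++ Jump (q + size k2) :: k2
  | For x y c =>
      let k := ccmd p.+3 c in
      [:: Const x 0; Defs.Sub NV y x; Jumpz NV (p.+3 + size k + 3)] ++ k ++
      [:: Const NV 1; Add x x NV; Jump p.+1]
  end.

(** * Placement of code and composition of executions *)

Definition code_at (P : program) (p : nat) (c : seq instr) :=
  forall i, i < size c -> onth P (p + i) = onth c i.

Lemma code_at_cat P p c1 c2 :
  code_at P p (c1 ++ c2) <-> code_at P p c1 /\ code_at P (p + size c1) c2.
Proof.
split=> [H|[H1 H2] i].
  split=> i Hi.
    by rewrite H ?size_cat ?ltn_addr // onth_cat Hi.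
  by rewrite -addnA H ?size_cat ?ltn_add2l // onth_cat ltnNge leq_addr /= addKn.
rewrite size_cat onth_cat => Hi; case: ltnP => Hi1; first exact: H1.
by rewrite -H2 ?ltn_subLR // -?addnA ?subnKC.
Qed.

Lemma code_at_cons P p i c :
  code_at P p (i :: c) <-> onth P p = Some i /\ code_at P p.+1 c.
Proof.
split=> [H|[H1 H2] [|j] Hj].
- split; first by rewrite -[p]addn0 H.
  by move=> j Hj; rewrite addSnnS H.
- by rewrite addn0 H1.
- by rewrite -addSnnS H2.
Qed.

(** In contrast to [runs], the last state need not be a halting one, so executions of pieces of code
    can be joined. *)
Inductive exe (P : program) : state -> nat -> state -> Prop :=
  | exe_refl s : exe P s 0 s
  | exe_step s c t s' : onth P (pc s) = Some c -> exe P (exec c s) t s' ->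
      exe P s (cost c s + t) s'.

Lemma exe_trans P s1 t1 s2 t2 s3 :
  exe P s1 t1 s2 -> exe P s2 t2 s3 -> exe P s1 (t1 + t2) s3.
Proof.
elim=> // {s1 t1 s2} s c t s' Hc _ IH /IH H.
by rewrite -addnA; apply: exe_step.
Qed.

Lemma exe_runs P s1 t1 s2 t2 s3 :
  exe P s1 t1 s2 -> runs P s2 t2 s3 -> runs P s1 (t1 + t2) s3.
Proof.
elim=> // {s1 t1 s2} s c t s' Hc _ IH /IH H.
by rewrite -addnA; apply: runs_step.
Qed.

Definition exe_le P s k s' := exists2 t, exe P s t s' & t <= k.

Lemma exe_le_refl P s k : exe_le P s k s.
Proof. by exists 0 => //; apply: exe_refl. Qed.

Lemma exe_le_trans P s1 k1 s2 k2 s3 :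
  exe_le P s1 k1 s2 -> exe_le P s2 k2 s3 -> exe_le P s1 (k1 + k2) s3.
Proof.
move=> [t1 H1 L1] [t2 H2 L2]; exists (t1 + t2); last exact: leq_add.
exact: exe_trans H1 H2.
Qed.

Lemma exe_le_weak P s k k' s' : k <= k' -> exe_le P s k s' -> exe_le P s k' s'.
Proof. by move=> L [t H1 L1]; exists t => //; apply: leq_trans L1 L. Qed.

Lemma exe_le_step P p r m c s' k w :
  onth P p = Some c -> cost c (State p r m) <= w ->
  exe_le P (exec c (State p r m)) k s' -> exe_le P (State p r m) (w + k) s'.
Proof.
move=> Hc Hw [t H1 L1]; exists (cost c (State p r m) + t); last exact: leq_add.
exact: exe_step.
Qed.

Lemma bitlen_le x b : x <= 2 ^ b -> bitlen x <= b.+1.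
Proof.
move=> H; rewrite /bitlen ltnS.
case: x H => [|x] H; first by rewrite trunc_log0.
rewrite -(@leq_exp2l 2) //; apply: leq_trans H.
exact: trunc_logP.
Qed.

(** * Values and cost of expressions *)

Fixpoint esize (e : expr) : nat :=
  match e with
  | Lit _ | Var _ => 1
  | Plus a b | Minus a b => esize a + esize b
  | Fetch a => esize a
  | Times a _ => (esize a).+1
  end.

Fixpoint esteps (e : expr) (S : nat) : nat :=
  match e with
  | Lit _ => 1
  | Var _ => 2
  | Plus a b | Minus a b => esteps a S + (esteps b S + 1)
  | Fetch a => esteps a S + 1
  | Times a _ => esteps a S + (5 + 4 * S)
  end.

Definition Kmax := 3.

Fixpoint wfe (Sz : seq nat) (e : expr) : bool :=
  match e with
  | Lit k => k <= Kmax
  | Var x => x < NV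
  | Plus a b | Minus a b => wfe Sz a && wfe Sz b
  | Fetch a => wfe Sz a
  | Times a x => [&& wfe Sz a, x < NV & x \in Sz]
  end.

Definition agree (r r' : nat -> nat) := forall x, x < NV -> r x = r' x.

Lemma esize_gt0 e : 0 < esize e.
Proof. by elim: e => //= a Ha b Hb; rewrite addn_gt0 Ha. Qed.

Lemma eval_agree Sz e r r' m : wfe Sz e -> agree r r' -> eval e (r, m) = eval e (r', m).
Proof.
move=> W A; elim: e W => //=.
- by move=> a IHa b IHb /andP[/IHa -> /IHb ->].
- by move=> a IHa b IHb /andP[/IHa -> /IHb ->].
- by move=> a IHa /IHa ->.
- by move=> a IHa x /and3P[/IHa -> /A ->].
Qed.

Definition bounded (r m : nat -> nat) V := (forall x, x < NV -> r x <= V) /\ (forall a, m a <= V).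

(** Both powers are at least 2, so their sum is at most their product. *)
Lemma leq_add_exp2 x y i j : 0 < i -> 0 < j -> x <= 2 ^ i -> y <= 2 ^ j -> x + y <= 2 ^ (i + j).
Proof.
move=> Hi Hj Hx Hy; rewrite expnD.
have A : 2 <= 2 ^ i by rewrite -[X in X <= _](expn1 2) leq_exp2l.
have B : 2 <= 2 ^ j by rewrite -[X in X <= _](expn1 2) leq_exp2l.
apply: leq_trans (leq_add Hx Hy) _; nia.
Qed.

(** Sums and products at most add bit lengths, and a fetch yields a stored value again. The
    condition [1 < b] makes room for the literals, which are at most 3. *)
Lemma eval_bound Sz e r m S b :
  wfe Sz e -> 1 < b -> bounded r m (2 ^ b) -> S <= 2 ^ b ->
  (forall x, x \in Sz -> r x <= S) -> eval e (r, m) <= 2 ^ (esize e * b).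
Proof.
move=> W b2 [Br Bm] HS BS; have b0 : 0 < b by apply: ltnW.
have sz0 a : 0 < esize a * b by rewrite muln_gt0 esize_gt0.
elim: e W => //=.
- move=> k Hk; rewrite mul1n; apply: leq_trans Hk _.
  by apply: leq_trans (_ : 2 ^ 2 <= _) => //; rewrite leq_exp2l.
- by move=> x Hx; rewrite mul1n Br.
- by move=> a IHa c IHc /andP[/IHa Ha /IHc Hc]; rewrite mulnDl leq_add_exp2.
- move=> a IHa c IHc /andP[/IHa Ha /IHc Hc]; rewrite mulnDl.
  apply: leq_trans (leq_subr _ _) _; apply: leq_trans Ha _.
  by rewrite leq_exp2l // leq_addr.
- move=> a IHa /IHa Ha; apply: leq_trans (Bm _) _.
  by rewrite leq_exp2l // leq_pmull // esize_gt0.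
- move=> a IHa x /and3P[/IHa Ha _ /BS Hx]; rewrite mulSn addnC expnD leq_mul //.
  exact: leq_trans Hx HS.
Qed.

(* [Z * b] bounds the bit lengths of all intermediate results, so [w] bounds the cost of an instruction. *)
Section Exec.
Variables (P : program) (S b Z : nat).
Hypotheses (b2 : 1 < b) (Sb : S <= 2 ^ b).

Let w := 2 * (Z * b + 1).

Let bit1 x i : x <= 2 ^ (i * b) -> i <= Z -> bitlen x <= Z * b + 1.
Proof. by move=> H Hi; rewrite addn1; apply: bitlen_le; apply: leq_trans H _; rewrite leq_exp2l // leq_mul2r Hi orbT. Qed.

Let bit2 x y i j : x <= 2 ^ (i * b) -> i <= Z -> y <= 2 ^ (j * b) -> j <= Z ->
  bitlen x + bitlen y <= w.
Proof. by move=> Hx Hi Hy Hj; rewrite /w mul2n -addnn leq_add // (bit1 Hx, bit1 Hy). Qed.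

Let bitw x i : x <= 2 ^ (i * b) -> i <= Z -> bitlen x <= w.
Proof. by move=> H Hi; apply: leq_trans (bit1 H Hi) _; rewrite /w mul2n -addnn leq_addr. Qed.

Let le3 k i : k <= 3 -> 0 < i -> k <= 2 ^ (i * b).
Proof.
move=> Hk Hi; apply: leq_trans Hk _; apply: leq_trans (_ : 2 ^ 2 <= _) => //.
by rewrite leq_exp2l //; nia.
Qed.

(** The partial sums increase towards [acc + j * a], so a single exponent [i] bounds the cost of
    every addition. *)
Lemma times_loop q t r m j acc a :
  code_at P q [:: Jumpz t.+3 (q + 4); Add t t t.+1; Defs.Sub t.+3 t.+3 t.+2; Jump q] ->
  r t.+1 = a -> r t.+2 = 1 -> r t.+3 = j -> r t = acc ->
  (exists2 i, acc + j * a <= 2 ^ (i * b) /\ a <= 2 ^ (i * b) & i <= Z) -> j <= 2 ^ b -> 0 < Z ->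
  exists r', [/\ exe_le P (State q r m) ((1 + 4 * j) * w) (State (q + 4) r' m),
    forall x, x < t -> r' x = r x & r' t = acc + j * a].
Proof.
move=> C; elim: j r acc => [|j IH] r acc Ha H1 Hj Hacc [i [Hi1 Hi2] iZ] jb Z0.
  exists r; split=> //; last by rewrite Hacc mul0n addn0.
  rewrite muln0 addn0 mul1n -[w]addn0.
  move: C => /code_at_cons[C1 _].
  apply: (exe_le_step C1) => /=; last by rewrite Hj eqxx; apply: exe_le_refl.
  by rewrite Hj; apply: (@bitw _ 1) => //; apply: le3.
have C' := C; move: C' => /code_at_cons[C1 /code_at_cons[C2 /code_at_cons[C3 /code_at_cons[C4 _]]]].
set r1 := upd (upd r t (acc + a)) t.+3 j.
have [|||||r' [E1 E2 E3]] := IH r1 (acc + a) _ _ _ _ _ (ltnW jb) Z0.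
- by rewrite /r1 /upd; do 2?[rewrite ifF; last lia].
- by rewrite /r1 /upd; do 2?[rewrite ifF; last lia].
- by rewrite /r1 /upd eqxx.
- by rewrite /r1 /upd ifF ?eqxx //; lia.
- by exists i => //; split=> //; rewrite -addnA -mulSn.
exists r'; split.
- rewrite [_ * w](_ : _ = w + (w + (w + (w + (1 + 4 * j) * w)))); last by lia.
  apply: (exe_le_step C1) => /=.
    by rewrite Hj; apply: (@bitw _ 1) => //; rewrite mul1n.
  rewrite Hj /=; apply: (exe_le_step C2) => /=.
    rewrite Hacc Ha; apply: (@bit2 _ _ i i) => //.
    by apply: leq_trans Hi1; rewrite leq_addr.
  apply: (exe_le_step C3) => /=.
    rewrite /upd; do 2![rewrite ifF; last lia]; rewrite Hj H1.
    by apply: (@bit2 _ _ 1 1) => //; rewrite ?mul1n // -[b]mul1n le3.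
  apply: (exe_le_step C4) => /=; first by rewrite /w; lia.
  rewrite [State _ _ _](_ : _ = State q r1 m) //.
  congr State; rewrite /r1 Hacc Ha /upd; do 2![rewrite ifF; last lia].
  by rewrite Hj H1 subn1.
- by move=> x Hx; rewrite E2 // /r1 /upd; do 2![rewrite ifF; last lia].
- by rewrite E3; lia.
Qed.

(** Preserving all registers below [t] protects the first operand of a binary operation: it waits in
    its register while the second one is computed with the next register as target. *)
Lemma exe_expr Sz e p t r m :
  (forall x, x \in Sz -> x < NV) -> code_at P p (cexpr p t e) -> wfe Sz e -> NV <= t -> esize e <= Z ->
  bounded r m (2 ^ b) -> (forall x, x \in Sz -> r x <= S) ->
  exists r', [/\ exe_le P (State p r m) (esteps e S * w)
                   (State (p + size (cexpr p t e)) r' m),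
    forall x, x < t -> r' x = r x & r' t = eval e (r, m)].
Proof.
move=> SzNV.
(* Since [t] lies above the variables, evaluating one operand leaves a register file that meets the
   hypotheses for the next one. *)
have sub1 : forall a p t r E, bounded r m (2 ^ b) -> (forall x, x \in Sz -> r x <= S) -> NV <= t ->
    (exists r', [/\ exe_le P (State p r m) E (State (p + size (cexpr p t a)) r' m),
      forall x, x < t -> r' x = r x & r' t = eval a (r, m)]) ->
    exists r', [/\ exe_le P (State p r m) E (State (p + size (cexpr p t a)) r' m),
      forall x, x < t -> r' x = r x, r' t = eval a (r, m), agree r' r &
      bounded r' m (2 ^ b) /\ forall x, x \in Sz -> r' x <= S].
  move=> a {}p {}t {}r E Br BS Ht [r' [E1 A1 V1]].
  have G1 : agree r' r by move=> x Hx; apply: A1; apply: leq_trans Hx Ht.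
  exists r'; split=> //; split; first by split=> [x Hx|]; [rewrite G1 //|]; apply Br.
  by move=> x Hx; rewrite G1 ?BS // SzNV.
move=> + + + + Br BS; elim: e p t r Br BS => /=.
- move=> k p t r Br BS /code_at_cons[C _] Hk Ht HZ; exists (upd r t k); split.
  + rewrite mul1n -[w]addn0; apply: (exe_le_step C) => /=; last by rewrite addn1; apply: exe_le_refl.
    by apply: (@bitw _ 1) => //; apply: le3.
  + by move=> x Hx; rewrite /upd ifF //; lia.
  + by rewrite /upd eqxx.
- move=> x p t r Br BS /code_at_cons[C1 /code_at_cons[C2 _]] Hx Ht HZ.
  exists (upd (upd r t 0) t (r x)); split.
  + rewrite mulSn mul1n -[X in _ + X]addn0; apply: (exe_le_step C1) => /=.
      by apply: (@bitw _ 1).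
    apply: (exe_le_step C2) => /=.
      rewrite /upd eqxx ifF; last lia.
      by apply: (@bit2 _ _ 1 1) => //; rewrite mul1n; apply Br.
    rewrite /upd eqxx ifF; last lia.
    by rewrite addn0 addn2; apply: exe_le_refl.
  + by move=> y Hy; rewrite /upd ifF ?ifF //; lia.
  + by rewrite /upd eqxx.
- move=> a IHa c IHc p t r Br BS /code_at_cat[Ca /code_at_cat[Cc /code_at_cons[C _]]].
  move=> /andP[Wa Wc] Ht HZ.
  have [r1 [E1 A1 V1 G1 [Br1 BS1]]] := sub1 _ _ _ _ _ Br BS Ht (IHa p t r Br BS Ca Wa Ht (leq_trans (leq_addr _ _) HZ)).
  have [r2 [E2 A2 V2]] := IHc _ t.+1 r1 Br1 BS1 Cc Wc (leqW Ht) (leq_trans (leq_addl _ _) HZ).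
  have Hb1 := eval_bound Wa b2 Br Sb BS; have Hb2 := eval_bound Wc b2 Br1 Sb BS1.
  rewrite (eval_agree m Wc G1) in V2 Hb2.
  exists (upd r2 t (eval a (r, m) + eval c (r, m))); split; last by rewrite /upd eqxx.
    rewrite !mulnDl; apply: exe_le_trans E1 _; rewrite !size_cat addnA; apply: exe_le_trans E2 _.
    rewrite mul1n -[w]addn0; apply: (exe_le_step C) => /=.
      rewrite A2 // V1 V2; apply: (bit2 Hb1 _ Hb2); lia.
    by rewrite A2 // V1 V2 addnA addn1; apply: exe_le_refl.
  by move=> x Hx; rewrite /upd ifF ?A2 ?A1 //; lia.
- move=> a IHa c IHc p t r Br BS /code_at_cat[Ca /code_at_cat[Cc /code_at_cons[C _]]].
  move=> /andP[Wa Wc] Ht HZ.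
  have [r1 [E1 A1 V1 G1 [Br1 BS1]]] := sub1 _ _ _ _ _ Br BS Ht (IHa p t r Br BS Ca Wa Ht (leq_trans (leq_addr _ _) HZ)).
  have [r2 [E2 A2 V2]] := IHc _ t.+1 r1 Br1 BS1 Cc Wc (leqW Ht) (leq_trans (leq_addl _ _) HZ).
  have Hb1 := eval_bound Wa b2 Br Sb BS; have Hb2 := eval_bound Wc b2 Br1 Sb BS1.
  rewrite (eval_agree m Wc G1) in V2 Hb2.
  exists (upd r2 t (eval a (r, m) - eval c (r, m))); split; last by rewrite /upd eqxx.
    rewrite !mulnDl; apply: exe_le_trans E1 _; rewrite !size_cat addnA; apply: exe_le_trans E2 _.
    rewrite mul1n -[w]addn0; apply: (exe_le_step C) => /=.
      rewrite A2 // V1 V2; apply: (bit2 Hb1 _ Hb2); lia.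
    by rewrite A2 // V1 V2 addnA addn1; apply: exe_le_refl.
  by move=> x Hx; rewrite /upd ifF ?A2 ?A1 //; lia.
- move=> a IHa p t r Br BS /code_at_cat[Ca /code_at_cons[C _]] Wa Ht HZ.
  have [r1 [E1 A1 V1]] := IHa p t r Br BS Ca Wa Ht HZ.
  have Hb1 := eval_bound Wa b2 Br Sb BS.
  exists (upd r1 t (m (eval a (r, m)))); split; last by rewrite /upd eqxx.
    rewrite !mulnDl; apply: exe_le_trans E1 _; rewrite size_cat.
    rewrite mul1n -[w]addn0; apply: (exe_le_step C) => /=.
      rewrite V1; apply: (@bit2 _ _ (esize a) 1) => //; first by rewrite mul1n; apply Br.
      by apply: leq_trans HZ; rewrite esize_gt0.
    by rewrite V1 addnA addn1; apply: exe_le_refl.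
  by move=> x Hx; rewrite /upd ifF ?A1 //; lia.
- move=> a IHa x p t r Br BS /code_at_cat[Ca C] /and3P[Wa Hx HxS] Ht HZ.
  have [r1 [E1 A1 V1]] := IHa p t.+1 r Br BS Ca Wa (leqW Ht) (ltnW HZ).
  have Hb1 := eval_bound Wa b2 Br Sb BS.
  have Hb2 : eval (Times a x) (r, m) <= 2 ^ ((esize a).+1 * b).
    by apply: (eval_bound _ b2 Br Sb BS); rewrite /= Wa Hx.
  set q := p + size (cexpr p t.+1 a) in C *.
  move: C => /code_at_cons[C1 /code_at_cons[C2 /code_at_cons[C3 /code_at_cons[C4 C5]]]].
  have xb : r x <= 2 ^ b by apply: leq_trans Sb; apply: BS.
  set r2 := upd (upd (upd (upd r1 t 0) t.+2 1) t.+3 0) t.+3 (r x).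
  have Z0 : 0 < Z by apply: leq_trans HZ; rewrite ltnS.
  have [||||||r3 [E3 A3 V3]] := @times_loop (q + 4) t r2 m (r x) 0 (eval a (r, m)) _ _ _ _ _ _ xb Z0.
  + by rewrite -[q + 4 + 4]addnA; move: C5; rewrite -{1}[q.+4]addn4.
  + by rewrite /r2 /upd; do 4?[rewrite ifF; last lia].
  + by rewrite /r2 /upd; do 2![rewrite ifF; last lia]; rewrite eqxx.
  + by rewrite /r2 /upd eqxx.
  + by rewrite /r2 /upd; do 3![rewrite ifF; last lia]; rewrite eqxx.
  + exists (esize a).+1 => //; split; first by rewrite add0n mulnC.
    by apply: leq_trans Hb1 _; rewrite leq_exp2l // leq_mul2r leqnSn orbT.
  exists r3; split; last by rewrite V3 add0n mulnC.
    rewrite mulnDl size_cat addnA -/q; apply: exe_le_trans E1 _.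
    apply: (@exe_le_weak _ _ (w + (w + (w + (w + (1 + 4 * r x) * w))))).
      rewrite (_ : w + _ = (5 + 4 * r x) * w); last by lia.
      by rewrite leq_mul2r leq_add2l leq_mul2l BS // !orbT.
    apply: (exe_le_step C1) => /=; first by apply: (@bitw _ 1) => //; apply: le3.
    apply: (exe_le_step C2) => /=; first by apply: (@bitw _ 1) => //; apply: le3.
    apply: (exe_le_step C3) => /=; first by apply: (@bitw _ 1) => //; apply: le3.
    have rx : r1 x = r x by apply: A1; lia.
    apply: (exe_le_step C4) => /=.
      rewrite /upd eqxx; do 3![rewrite ifF; last lia]; rewrite rx.
      by apply: (@bit2 _ _ 1 1) => //; rewrite mul1n.
    rewrite [State _ _ _](_ : _ = State (q + 4) r2 m); first by rewrite (_ : _ + 8 = q + 4 + 4) // -addnA.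
    congr State; first by lia.
    by rewrite /r2 /upd eqxx; do 3![rewrite ifF; last lia]; rewrite rx addn0.
  move=> y Hy; rewrite A3 // /r2 /upd; do 4![rewrite ifF; last lia].
  by rewrite A1 //; lia.
Qed.

End Exec.

(** * Cost of commands and growth of values *)

Fixpoint csize (c : cmd) : nat :=
  match c with
  | Assign _ e => esize e
  | Store a e => esize a + esize e
  | Incr _ => 1
  | Seq c1 c2 => csize c1 + csize c2
  | Cond e c1 c2 => esize e + (csize c1 + csize c2)
  | For _ _ c => (csize c).+1
  end.

Fixpoint csteps (c : cmd) (S : nat) : nat :=
  match c with
  | Assign _ e => esteps e S + 2
  | Store a e => esteps a S + (esteps e S + 1)
  | Incr _ => 2
  | Seq c1 c2 => csteps c1 S + csteps c2 S
  | Cond e c1 c2 => esteps e S + (csteps c1 S + csteps c2 S + 2)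
  | For _ _ c => 3 + S * (csteps c S + 5)
  end.

Fixpoint grow (c : cmd) (S : nat) : nat :=
  match c with
  | Assign _ _ | Store _ _ => 0
  | Incr _ => 1
  | Seq c1 c2 | Cond _ c1 c2 => grow c1 S + grow c2 S
  | For _ _ c => S * grow c S
  end.

(** Only such expressions may be assigned or stored: their value exceeds neither [Kmax] nor the
    largest stored value. Storing sums could double the values in every round and make the numbers
    exponentially long. Addresses and conditions are not restricted in this way. *)
Fixpoint flat (e : expr) : bool :=
  match e with
  | Lit _ | Var _ | Fetch _ => true
  | Minus a _ => flat a
  | _ => false
  end.

(* The registers in [Sz] are read-only and are the only ones that may bound a
   loop, so that the running time and the growth of values can be read off the
   syntax. *)
Fixpoint wfc (Sz : seq nat) (c : cmd) : bool :=
  match c with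
  | Assign x e => [&& x < NV, x \notin Sz, wfe Sz e & flat e]
  | Store a e => [&& wfe Sz a, wfe Sz e & flat e]
  | Incr x => (x < NV) && (x \notin Sz)
  | Seq c1 c2 => wfc Sz c1 && wfc Sz c2
  | Cond e c1 c2 => [&& wfe Sz e, wfc Sz c1 & wfc Sz c2]
  | For x y c => [&& x < NV, x \notin Sz, y < NV, y \in Sz & wfc (x :: Sz) c]
  end.

Fixpoint writes (c : cmd) : seq nat :=
  match c with
  | Assign x _ | Incr x => [:: x]
  | Store _ _ => [::]
  | Seq c1 c2 | Cond _ c1 c2 => writes c1 ++ writes c2
  | For x _ c => x :: writes c
  end.

Lemma upd_eq f a v : upd f a v a = v.
Proof. by rewrite /upd eqxx. Qed.

Lemma upd_neq f a v b : b != a -> upd f a v b = f b.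
Proof. by rewrite /upd => /negbTE ->. Qed.

Lemma run_frame c s x : x \notin writes c -> (run c s).1 x = s.1 x.
Proof.
elim: c s => /=.
- by move=> y e s; rewrite inE => Hx; rewrite upd_neq.
- by [].
- by move=> y s; rewrite inE => Hx; rewrite upd_neq.
- by move=> c1 IH1 c2 IH2 s; rewrite mem_cat => /norP[H1 H2]; rewrite IH2 ?IH1.
- by move=> e c1 IH1 c2 IH2 s; rewrite mem_cat => /norP[H1 H2]; case: ifP; rewrite ?IH2 ?IH1.
- move=> y z c IH s; rewrite inE => /norP[Hy Hc].
  elim: (s.1 z) => [|k IHk] /=; first by rewrite upd_neq.
  by rewrite upd_neq // IH.
Qed.

Lemma wfc_writes Sz c x : wfc Sz c -> x \in Sz -> x \notin writes c.
Proof.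
elim: c Sz => /=.
- move=> y e Sz /and4P[_ Hy _ _] Hx; rewrite inE.
  by apply: contraNneq Hy => <-.
- by [].
- by move=> y Sz /andP[_ Hy] Hx; rewrite inE; apply: contraNneq Hy => <-.
- by move=> c1 IH1 c2 IH2 Sz /andP[H1 H2] Hx; rewrite mem_cat negb_or (IH1 Sz) // (IH2 Sz).
- by move=> e c1 IH1 c2 IH2 Sz /and3P[_ H1 H2] Hx; rewrite mem_cat negb_or (IH1 Sz) // (IH2 Sz).
- move=> y z c IH Sz /and5P[_ Hy _ _ Hc] Hx; rewrite inE negb_or (IH (y :: Sz)) ?inE ?Hx ?orbT // andbT.
  by apply: contraNneq Hy => <-.
Qed.

Lemma bounded_upd r m V x v : bounded r m V -> v <= V -> bounded (upd r x v) m V.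
Proof. by move=> [Hr Hm] Hv; split=> // y Hy; rewrite /upd; case: ifP => // _; apply: Hr. Qed.

Lemma bounded_weak r m V V' : V <= V' -> bounded r m V -> bounded r m V'.
Proof. by move=> H [Hr Hm]; split=> [x Hx|a]; apply: leq_trans H; [apply: Hr|]. Qed.

Lemma flat_bound Sz e r m V : wfe Sz e -> flat e -> Kmax <= V -> bounded r m V -> eval e (r, m) <= V.
Proof.
move=> W F HV [Hr Hm]; elim: e W F => //=.
- by move=> k Hk _; apply: leq_trans Hk HV.
- by move=> x Hx _; apply: Hr.
- move=> a IHa c _ /andP[/IHa H _] /H H1.
  exact: leq_trans (leq_subr _ _) H1.
Qed.

Definition for_step c x (s : store) : store := setr (run c s) x ((run c s).1 x).+1.

Lemma for_index Sz c x s k : wfc (x :: Sz) c ->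
  (iter k (for_step c x) (setr s x 0)).1 x = k.
Proof.
move=> W; elim: k => [|k IH] /=; first by rewrite upd_eq.
by rewrite upd_eq run_frame ?IH // (wfc_writes W) // inE eqxx.
Qed.

Lemma for_frame Sz c x s k y : wfc (x :: Sz) c -> y \in Sz -> x \notin Sz ->
  (iter k (for_step c x) (setr s x 0)).1 y = s.1 y.
Proof.
move=> W Hy Hx; have yx : y != x by apply: contraNneq Hx => <-.
elim: k => [|k IH] /=; first by rewrite upd_neq.
by rewrite upd_neq // run_frame // (wfc_writes W) // inE Hy orbT.
Qed.

Lemma run_bounded Sz c s S V : wfc Sz c -> (forall x, x \in Sz -> s.1 x <= S) ->
  Kmax <= V -> bounded s.1 s.2 V -> bounded (run c s).1 (run c s).2 (V + grow c S).
Proof.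
elim: c Sz s V => /=.
- move=> x e Sz [r m] V /and4P[_ _ We Fe] BS HV B; rewrite addn0.
  by apply: bounded_upd => //; apply: flat_bound We Fe HV B.
- move=> a e Sz [r m] V /and3P[Wa We Fe] BS HV B; rewrite addn0.
  have H := flat_bound We Fe HV B; case: B => Hr Hm; split=> // z.
  by rewrite /upd; case: ifP.
- move=> x Sz [r m] V /andP[Hx _] BS HV B; rewrite addn1.
  by apply: bounded_upd; [apply: bounded_weak B|rewrite ltnS; apply B].
- move=> c1 IH1 c2 IH2 Sz s V /andP[W1 W2] BS HV B; rewrite addnA.
  apply: (IH2 Sz) => //.
  + by move=> x Hx; rewrite run_frame ?BS // (wfc_writes W1).
  + by apply: leq_trans HV _; rewrite leq_addr.
  + exact: IH1 W1 BS HV B.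
- move=> e c1 IH1 c2 IH2 Sz s V /and3P[We W1 W2] BS HV B; case: ifP => _.
  + by apply: bounded_weak (IH2 _ _ _ W2 BS HV B); lia.
  + by apply: bounded_weak (IH1 _ _ _ W1 BS HV B); lia.
- move=> x y c IH Sz s V /and5P[Hx xS Hy yS Wc] BS HV B.
  rewrite -/(for_step c x).
  suff H k : k <= s.1 y -> bounded (iter k (for_step c x) (setr s x 0)).1
      (iter k (for_step c x) (setr s x 0)).2 (V + k * grow c S).
    by apply: bounded_weak (H _ (leqnn _)); rewrite leq_add2l leq_mul2r BS ?orbT.
  elim: k => [|k IHk] kS /=; first by apply: bounded_upd; [apply: bounded_weak B; lia|].
  apply: bounded_upd.
    rewrite mulSn [grow c S + _]addnC addnA; apply: (IH (x :: Sz)) => //.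
    + move=> z; rewrite inE => /orP[/eqP ->|Hz].
        rewrite (for_index _ _ Wc); apply: leq_trans (ltnW kS) _; exact: BS.
      by rewrite (for_frame _ _ Wc) ?BS.
    + by apply: leq_trans HV _; rewrite leq_addr.
    + by apply: IHk; apply: ltnW.
  rewrite run_frame ?(wfc_writes Wc) ?inE ?eqxx // (for_index _ _ Wc).
  by apply: leq_trans kS _; apply: leq_trans (_ : V <= _); [apply B|lia].
Qed.

Section ExecCmd.
Variables (P : program) (S b Z : nat).
Hypotheses (b2 : 1 < b) (Sb : S <= 2 ^ b) (Z0 : 0 < Z).

Let w := 2 * (Z * b + 1).

Let bitZ x : x <= 2 ^ (Z * b) -> bitlen x <= w.
Proof. by move=> H; apply: leq_trans (bitlen_le H) _; rewrite /w; lia. Qed.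

Let bitZ2 x y : x <= 2 ^ (Z * b) -> y <= 2 ^ (Z * b) -> bitlen x + bitlen y <= w.
Proof.
move=> H H'; rewrite /w mul2n -addnn leq_add //.
  by apply: leq_trans (bitlen_le H) _; lia.
by apply: leq_trans (bitlen_le H') _; lia.
Qed.

Let leZ x : x <= 2 ^ b -> x <= 2 ^ (Z * b).
Proof. by move=> H; apply: leq_trans H _; rewrite leq_exp2l // leq_pmull. Qed.

Let le1Z : 1 <= 2 ^ (Z * b).
Proof. by rewrite expn_gt0. Qed.

(** [r] is the register file of the machine and [rl] that of the structured program. They agree on
    the variables only, as scratch registers have no counterpart there. The last premise keeps all
    stored values below [2 ^ b] throughout. *)
Lemma exe_cmd Sz c p r rl m V :
  wfc Sz c -> (forall x, x \in Sz -> x < NV) -> csize c <= Z ->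
  code_at P p (ccmd p c) -> agree r rl ->
  (forall x, x \in Sz -> rl x <= S) -> Kmax <= V -> bounded rl m V ->
  V + grow c S <= 2 ^ b ->
  exists2 r', exe_le P (State p r m) (csteps c S * w)
      (State (p + size (ccmd p c)) r' (run c (rl, m)).2)
    & agree r' (run c (rl, m)).1.
Proof.
move=> + + + + + + + + +; elim: c Sz p r rl m V.
- move=> x e Sz p r rl m V /=.
  move=> /and4P[Hx xS We Fe] SzNV HZ /code_at_cat[Ce /code_at_cons[C1 /code_at_cons[C2 _]]] A BS HV B.
  rewrite addn0 => Vb; have Ar : agree rl r by move=> y Hy; rewrite A.
  have Be := leq_trans (flat_bound We Fe HV B) Vb; rewrite (eval_agree m We Ar) in Be *.
  have Br : bounded r m (2 ^ b) by apply: bounded_weak Vb _; split=> [y Hy|]; [rewrite A //|]; apply B.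
  have BSr y : y \in Sz -> r y <= S by move=> Hy; rewrite A ?BS // SzNV.
  have [r1 [E1 A1 V1]] := exe_expr b2 Sb SzNV Ce We (leqnn _) HZ Br BSr.
  exists (upd (upd r1 NV.+1 0) x (eval e (r, m))).
    rewrite mulnDl size_cat addnA; apply: exe_le_trans E1 _.
    rewrite (_ : 2 * w = w + (w + 0)); last by lia.
    apply: (exe_le_step C1) => /=; first exact: bitZ.
    apply: (exe_le_step C2) => /=.
      by rewrite upd_eq upd_neq // V1; apply: bitZ2 => //; apply: leZ.
    by rewrite upd_eq upd_neq // V1 addn0 addn2; apply: exe_le_refl.
  move=> y Hy; rewrite /upd; case: (y =P x) => // _; rewrite ifF; last by lia.
  by rewrite A1 // A.
- move=> a e Sz p r rl m V /=.
  move=> /and3P[Wa We Fe] SzNV HZ /code_at_cat[Ca /code_at_cat[Ce /code_at_cons[C1 _]]] A BS HV B.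
  rewrite addn0 => Vb; have Ar : agree rl r by move=> y Hy; rewrite A.
  have Be := leq_trans (flat_bound We Fe HV B) Vb; rewrite (eval_agree m We Ar) in Be *.
  have Br : bounded r m (2 ^ b) by apply: bounded_weak Vb _; split=> [y Hy|]; [rewrite A //|]; apply B.
  have BSr y : y \in Sz -> r y <= S by move=> Hy; rewrite A ?BS // SzNV.
  rewrite (eval_agree m Wa Ar); have Ba := eval_bound Wa b2 Br Sb BSr.
  have [r1 [E1 A1 V1]] := exe_expr b2 Sb SzNV Ca Wa (leqnn _) (leq_trans (leq_addr _ _) HZ) Br BSr.
  have Ar1 : agree r1 r by move=> y Hy; rewrite A1.
  have Br1 : bounded r1 m (2 ^ b) by split=> [y Hy|]; [rewrite Ar1 //|]; apply Br.
  have BSr1 y : y \in Sz -> r1 y <= S by move=> Hy; rewrite Ar1 ?BSr // SzNV.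
  have [r2 [E2 A2 V2]] := exe_expr b2 Sb SzNV Ce We (leqnSn _) (leq_trans (leq_addl _ _) HZ) Br1 BSr1.
  rewrite (eval_agree m We Ar1) in V2.
  exists r2; last by move=> y Hy; rewrite A2 ?A1 ?A // (leq_trans Hy).
  apply: (@exe_le_weak _ _ (esteps a S * w + (esteps e S * w + (w + 0)))); first by lia.
  rewrite (_ : p + size _ = p + size (cexpr p NV a) +
    size (cexpr (p + size (cexpr p NV a)) NV.+1 e) + 1); last by rewrite !size_cat !addnA.
  apply: exe_le_trans E1 _; apply: exe_le_trans E2 _.
  apply: (exe_le_step C1) => /=; last first.
    by rewrite A2 // V1 V2 addn1; apply: exe_le_refl.
  rewrite A2 // V1 V2; apply: bitZ2; last exact: leZ.
  by apply: leq_trans Ba _; rewrite leq_exp2l // leq_mul2r; lia.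
- move=> x Sz p r rl m V /= /andP[Hx _] SzNV HZ /code_at_cons[C1 /code_at_cons[C2 _]] A BS HV B Vb.
  have rx : r x <= 2 ^ b by rewrite A //; apply: leq_trans (leq_trans (leq_addr _ _) Vb); apply B.
  exists (upd (upd r NV 1) x (r x).+1); last first.
    move=> y Hy; rewrite /upd; case: (y =P x) => [_|_]; first by rewrite A.
    by rewrite ifF ?A //; lia.
  rewrite (_ : 2 * w = w + (w + 0)); last by lia.
    apply: (exe_le_step C1) => /=; first exact: bitZ.
  have xNV : x != NV by lia.
  apply: (exe_le_step C2) => /=; rewrite upd_eq upd_neq //.
    by apply: bitZ2 => //; apply: leZ.
  by rewrite addn1 addn2; apply: exe_le_refl.
- move=> c1 IH1 c2 IH2 Sz p r rl m V /= /andP[W1 W2] SzNV HZ /code_at_cat[C1 C2] A BS HV B Vb.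
  have [||r1 E1 A1] := IH1 Sz p r rl m V W1 SzNV _ C1 A BS HV B; [lia|lia|].
  have B1 := @run_bounded Sz c1 (rl, m) S V W1 BS HV B; move: E1 A1 B1.
  have F1 y : y \in Sz -> (run c1 (rl, m)).1 y <= S.
    by move=> Hy; rewrite run_frame ?BS // (wfc_writes W1).
  case: (run c1 (rl, m)) F1 => rl1 m1 /= F1 E1 A1 B1.
  have [|||r2 E2 A2] := IH2 Sz _ r1 rl1 m1 (V + grow c1 S) W2 SzNV _ C2 A1 F1 _ B1; [lia|lia|lia|].
  exists r2 => //; rewrite mulnDl size_cat addnA; exact: exe_le_trans E1 E2.
- move=> e c1 IH1 c2 IH2 Sz p r rl m V /= /and3P[We W1 W2] SzNV HZ.
  move=> /code_at_cat[Ce /code_at_cons[Cj /code_at_cat[C1 /code_at_cons[Cj' C2]]]] A BS HV B Vb.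
  have Ar : agree rl r by move=> y Hy; rewrite A.
  have Br : bounded r m (2 ^ b).
    apply: bounded_weak (leq_trans (leq_addr _ _) Vb) _.
    by split=> [y Hy|]; [rewrite A //|]; apply B.
  have BSr y : y \in Sz -> r y <= S by move=> Hy; rewrite A ?BS // SzNV.
  have Be := eval_bound We b2 Br Sb BSr.
  have [r1 [E1 A1 V1]] := exe_expr b2 Sb SzNV Ce We (leqnn _) (leq_trans (leq_addr _ _) HZ) Br BSr.
  have A1' : agree r1 rl by move=> y Hy; rewrite A1 // A.
  rewrite (eval_agree m We Ar); set q := p + size (cexpr p NV e) in Cj C1 Cj' C2 *.
  have w1 : 1 <= w by rewrite /w; lia.
  have Hj : bitlen (eval e (r, m)) <= w.
    by apply: bitZ; apply: leq_trans Be _; rewrite leq_exp2l // leq_mul2r; lia.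
  case: ifP => e0.
    have [||r2 E2 A2] := IH2 Sz _ r1 rl m V W2 SzNV _ C2 A1' BS HV B; [lia|lia|].
    exists r2 => //; rewrite mulnDl size_cat /= size_cat /= addnA -/q.
    apply: exe_le_trans E1 _.
    apply: (@exe_le_weak _ _ (w + csteps c2 S * w)); first by rewrite !mulnDl; lia.
    apply: (exe_le_step Cj) => /=; rewrite V1 // e0.
    by move: E2; congr exe_le; congr State; lia.
  have [||r2 E2 A2] := IH1 Sz _ r1 rl m V W1 SzNV _ C1 A1' BS HV B; [lia|lia|].
  exists r2 => //; rewrite mulnDl size_cat /= size_cat /= addnA -/q.
  apply: exe_le_trans E1 _.
  apply: (@exe_le_weak _ _ (w + (csteps c1 S * w + (w + 0)))); first by rewrite !mulnDl; lia.
  apply: (exe_le_step Cj) => /=; rewrite V1 // e0; apply: exe_le_trans E2 _.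
  apply: (exe_le_step Cj') => //=.
  rewrite [X in State X _ _](_ : _ = q + (size (ccmd q.+1 c1) + (size (ccmd (q.+1 + size (ccmd q.+1 c1)).+1 c2)).+1).+1); last by lia.
  exact: exe_le_refl.
- move=> x y c IH Sz p r rl m V /= /and5P[Hx xS Hy yS Wc] SzNV HZ.
  move=> /code_at_cons[C1 /code_at_cons[C2 /code_at_cons[C3 /code_at_cat[Cb]]]].
  move=> /code_at_cons[C4 /code_at_cons[C5 /code_at_cons[C6 _]]] A BS HV B Vb.
  rewrite -/(for_step c x).
  set q := p.+3 + size (ccmd p.+3 c) in C3 C4 C5 C6 *.
  have w1 : 1 <= w by rewrite /w; lia.
  have rlyS : rl y <= S by apply: BS.
  pose st k := iter k (for_step c x) (setr (rl, m) x 0).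
  have bst k : k <= rl y -> bounded (st k).1 (st k).2 (V + k * grow c S).
    elim: k => [|k IHk] kS /=; first by apply: bounded_upd; [apply: bounded_weak B; lia|].
    apply: bounded_upd.
      rewrite mulSn [grow c S + _]addnC addnA; apply: (run_bounded Wc) => //.
      + move=> z; rewrite inE => /orP[/eqP ->|Hz].
          rewrite (for_index _ _ Wc); apply: leq_trans (ltnW kS) _; exact: BS.
        by rewrite (for_frame _ _ Wc) ?BS.
      + by apply: leq_trans HV _; rewrite leq_addr.
      + by apply: IHk; apply: ltnW.
    rewrite run_frame ?(wfc_writes Wc) ?inE ?eqxx // (for_index _ _ Wc).
    by apply: leq_trans kS _; apply: leq_trans (_ : V <= _); [apply B|lia].
  (* The induction is on the number [j] of rounds still to run, which is the difference computed at
     the loop head. *)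
  have loop j : j <= rl y -> forall r0, agree r0 (st (rl y - j)).1 ->
      exists2 r', exe_le P (State p.+1 r0 (st (rl y - j)).2) ((2 + j * (csteps c S + 5)) * w)
        (State (q + 3) r' (st (rl y)).2) & agree r' (st (rl y)).1.
    elim: j => [|j IHj] Hj r0.
      rewrite subn0 => A0; exists (upd r0 NV 0); last first.
        by move=> z Hz; rewrite upd_neq ?A0 //; lia.
      rewrite mul0n addn0 (_ : 2 * w = w + (w + 0)); last by lia.
      have r0x : r0 x = rl y by rewrite A0 // (for_index _ _ Wc).
      have r0y : r0 y = rl y by rewrite A0 // (for_frame _ _ Wc).
      have yb : rl y <= 2 ^ (Z * b) by apply: leZ; apply: leq_trans Sb.
      apply: (exe_le_step C2) => /=; rewrite r0x r0y; first exact: bitZ2.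
      apply: (exe_le_step C3) => /=; rewrite upd_eq subnn; first exact: bitZ.
      by rewrite /= ; apply: exe_le_refl.
    set k := rl y - j.+1 => A0.
    have kE : rl y - j = k.+1 by rewrite /k; lia.
    have kl : k < rl y by rewrite /k; lia.
    have r0x : r0 x = k by rewrite A0 // (for_index _ _ Wc).
    have r0y : r0 y = rl y by rewrite A0 // (for_frame _ _ Wc).
    pose r1 := upd r0 NV j.+1.
    have A1 : agree r1 (st k).1 by move=> z Hz; rewrite /r1 upd_neq ?A0 //; lia.
    have Bk := bst _ (ltnW kl).
    have kgS : k * grow c S + grow c S <= S * grow c S.
      by rewrite addnC -mulSn leq_mul2r (leq_trans kl) // orbT.
    have BSk z : z \in x :: Sz -> (st k).1 z <= S.
      rewrite inE => /orP[/eqP ->|Hz]; first by rewrite (for_index _ _ Wc); lia.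
      by rewrite (for_frame _ _ Wc) ?BS.
    have SzNV' z : z \in x :: Sz -> z < NV.
      by rewrite inE => /orP[/eqP ->|/SzNV].
    case E : (st k) A0 A1 Bk BSk => [rk mk] A0 A1 Bk BSk.
    have [|||r2 E2 A2] := IH (x :: Sz) p.+3 r1 rk mk _ Wc SzNV' _ Cb A1 BSk _ Bk; [lia|lia|lia|].
    have stS : st k.+1 = for_step c x (rk, mk) by rewrite -E.
    have ixk : (run c (rk, mk)).1 x = k.
      rewrite run_frame ?(wfc_writes Wc) ?inE ?eqxx // -E.
      exact: for_index Wc.
    pose r3 := upd (upd r2 NV 1) x k.+1.
    have xNV : x != NV by lia.
    have A3 : agree r3 (st k.+1).1.
      move=> z Hz; rewrite stS /for_step /= ixk /r3 /upd; case: (z =P x) => // _.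
      by rewrite ifF ?A2 //; lia.
    rewrite -kE in A3; have [r' E' A'] := IHj (ltnW Hj) r3 A3.
    exists r' => //; rewrite kE stS /= in E'.
    apply: (@exe_le_weak _ _ (w + (w + (csteps c S * w + (w + (w + (w + (2 + j * (csteps c S + 5)) * w))))))).
      by rewrite mulSn !mulnDl; lia.
    have lyb : rl y <= 2 ^ (Z * b) by apply: leZ; apply: leq_trans Sb.
    apply: (exe_le_step C2) => /=; rewrite r0x r0y.
      by apply: bitZ2 => //; apply: leq_trans (ltnW kl) _.
    have -> : rl y - k = j.+1 by rewrite /k; lia.
    apply: (exe_le_step C3) => /=; rewrite ?upd_eq /=.
      by apply: bitZ; apply: leq_trans Hj _.
    apply: exe_le_trans E2 _.
    have r2x : r2 x = k by rewrite A2.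
    apply: (exe_le_step C4) => /=; first exact: bitZ.
    apply: (exe_le_step C5) => /=; rewrite upd_eq upd_neq // r2x.
      by apply: bitZ2 => //; apply: leq_trans (ltnW kl) _.
    apply: (exe_le_step C6) => //=.
    by rewrite addn1.
  have [|r' E' A'] := loop (rl y) (leqnn _) (upd r x 0).
    by rewrite subnn => z Hz /=; rewrite /upd; case: ifP => // _; apply: A.
  exists r' => //.
  apply: (@exe_le_weak _ _ (w + (2 + rl y * (csteps c S + 5)) * w)).
    rewrite -[X in X + _]mul1n -mulnDl leq_mul2r addnA leq_add2l leq_mul2r.
    by rewrite rlyS !orbT.
  apply: (exe_le_step C1) => /=; first exact: bitZ.
  move: E'; rewrite subnn /=; congr exe_le; congr State.
  by rewrite /q size_cat /=; lia.
Qed.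

End ExecCmd.

(** * The unbounded main loop around the bounded phases *)

Definition rsp := 2.

(** This loop is kept outside the language: its length is exponential and cannot be read off the
    syntax, so the number of rounds is recorded and bounded separately. *)
Inductive loop (body : cmd) : store -> nat -> store -> Prop :=
  | loop0 s : loop body s 0 s
  | loopS s N s' : s.1 rsp != 0 -> loop body (run body s) N s' ->
      loop body s N.+1 s'.

Lemma loop_trans body s1 N1 s2 N2 s3 :
  loop body s1 N1 s2 -> loop body s2 N2 s3 -> loop body s1 (N1 + N2) s3.
Proof. by elim=> // {s1 N1 s2} s N s' Hs _ IH /IH; apply: loopS. Qed.

Record phases := Phases {
  ph_size : cmd;
  ph_double : cmd;
  ph_init : cmd;
  ph_body : cmd;
  ph_fin : cmd }.

Definition assemble (f : phases) : program :=
  let k1 := ccmd 0 (ph_size f) in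
  let k2 := ccmd (size k1) (ph_double f) in
  let k3 := ccmd (size k1 + size k2) (ph_init f) in
  let q := size k1 + size k2 + size k3 in
  let kb := ccmd q.+1 (ph_body f) in
  let e := (q.+1 + size kb).+1 in
  k1 ++ k2 ++ k3 ++ Jumpz rsp e :: kb ++ Jump q :: ccmd e (ph_fin f).

(** The read-only registers come into being one after the other: the first phase sets register 0
    without any loop, the second may loop up to register 0 in order to set register 1, and the
    others may loop up to both. *)
Definition wf_phases (f : phases) :=
  [&& wfc [::] (ph_size f), wfc [:: 0] (ph_double f), wfc [:: 0; 1] (ph_init f),
      wfc [:: 0; 1] (ph_body f) & wfc [:: 0; 1] (ph_fin f)].

Definition phases_sum (F : cmd -> nat) (f : phases) :=
  F (ph_size f) + F (ph_double f) + F (ph_init f) + F (ph_body f) + F (ph_fin f).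

Lemma csize_gt0 c : 0 < csize c.
Proof.
by elim: c => //= *; rewrite ?addn_gt0 ?esize_gt0 //; apply/orP; left.
Qed.

Lemma code_at_self (P : program) : code_at P 0 P.
Proof. by []. Qed.

Lemma leq_all_seq2 (r : nat -> nat) S : r 0 <= S -> r 1 <= S -> forall x, x \in [:: 0; 1] -> r x <= S.
Proof. by move=> H0 H1 x; rewrite !inE => /orP[] /eqP ->. Qed.

Definition sim (P : program) (p : nat) (s : store) k (p' : nat) (s' : store) :=
  forall r, agree r s.1 -> exists2 r', exe_le P (State p r s.2) k (State p' r' s'.2)
    & agree r' s'.1.

Lemma sim_trans P p1 s1 k1 p2 s2 k2 p3 s3 :
  sim P p1 s1 k1 p2 s2 -> sim P p2 s2 k2 p3 s3 -> sim P p1 s1 (k1 + k2) p3 s3.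
Proof.
move=> H1 H2 r /H1[r1 E1 /H2[r2 E2 A2]]; exists r2 => //.
exact: exe_le_trans E1 E2.
Qed.

Lemma sim_cmd P S b Z Sz c p s V : 1 < b -> S <= 2 ^ b -> 0 < Z ->
  wfc Sz c -> (forall x, x \in Sz -> x < NV) -> csize c <= Z ->
  code_at P p (ccmd p c) -> (forall x, x \in Sz -> s.1 x <= S) -> Kmax <= V ->
  bounded s.1 s.2 V -> V + grow c S <= 2 ^ b ->
  sim P p s (csteps c S * (2 * (Z * b + 1))) (p + size (ccmd p c)) (run c s).
Proof.
case: s => rl m b2 Sb Z0 W SzNV HZ C BS HV B Vb r A.
exact: (exe_cmd b2 Sb Z0 W SzNV HZ C A BS HV B Vb).
Qed.

(** Each phase and each round raises the largest value by a fixed amount, so the same [b] serves all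
    [N] rounds and every instruction has the same cost bound. *)
Lemma assemble_runs f (r0 m0 : nat -> nat) S b V N s4 :
  let s2 := run (ph_double f) (run (ph_size f) (r0, m0)) in
  wf_phases f -> bounded r0 m0 V -> Kmax <= V ->
  s2.1 0 <= S -> s2.1 1 <= S ->
  loop (ph_body f) (run (ph_init f) s2) N s4 -> s4.1 rsp = 0 ->
  1 < b -> S <= 2 ^ b ->
  V + N.+1 * phases_sum (fun c => grow c S) f <= 2 ^ b ->
  exists t s, [/\ runs (assemble f) (State 0 r0 m0) t s,
    t <= N.+1 * ((phases_sum (fun c => csteps c S) f + 2) * (2 * (phases_sum csize f * b + 1)))
    & Defs.mem s = (run (ph_fin f) s4).2].
Proof.
move=> s2 /and5P[W1 W2 W3 Wb Wf] B0 HV S0 S1 L sp0 b2 Sb Vb.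
set Z := phases_sum csize f; set w := 2 * (Z * b + 1).
have Z0 : 0 < Z by rewrite /Z /phases_sum !addn_gt0 csize_gt0.
have := @code_at_self (assemble f); rewrite {2}/assemble.
move=> /code_at_cat[C1 /code_at_cat[C2 /code_at_cat[C3 /code_at_cons[Cj /code_at_cat[Cb /code_at_cons[Cj' Cf]]]]]].
set P := assemble f in C1 C2 C3 Cj Cb Cj' Cf *.
rewrite add0n in C2 C3 Cj Cb Cj' Cf.
set p2 := size _ in C2 C3 Cj Cb Cj' Cf; set p3 := p2 + size _ in C3 Cj Cb Cj' Cf.
set q := p3 + size _ in Cj Cb Cj' Cf; set e := (q.+1 + size _) in Cj Cj' Cf.
pose G c := grow c S; rewrite -/G in Vb.
have Gtot : phases_sum G f <= N.+1 * phases_sum G f by rewrite leq_pmull.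
have GZ : phases_sum csize f = Z by [].
rewrite /phases_sum in Gtot Vb GZ; set g1 := G (ph_size f) in Gtot Vb.
set g2 := G (ph_double f) in Gtot Vb; set g3 := G (ph_init f) in Gtot Vb.
set gb := G (ph_body f) in Gtot Vb; set gf := G (ph_fin f) in Gtot Vb.
pose s1 := run (ph_size f) (r0, m0).
have s10 : s1.1 0 <= S by rewrite -(@run_frame (ph_double f)) // (wfc_writes W2).
have BS1 x : x \in [:: 0] -> s1.1 x <= S by rewrite inE => /eqP ->.
have BS2 := leq_all_seq2 S0 S1.
have NV2 x : x \in [:: 0; 1] -> x < NV by rewrite !inE => /orP[] /eqP ->.
have NV1 x : x \in [:: 0] -> x < NV by rewrite inE => /eqP ->.
have B1 : bounded s1.1 s1.2 (V + g1) by apply: (run_bounded W1).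
have B2 : bounded s2.1 s2.2 (V + g1 + g2) by apply: (run_bounded W2) => //; lia.
set s3 := run (ph_init f) s2 in L *.
have B3 : bounded s3.1 s3.2 (V + g1 + g2 + g3) by apply: (run_bounded W3) => //; lia.
have BS3 x : x \in [:: 0; 1] -> s3.1 x <= S.
  by move=> Hx; rewrite run_frame ?BS2 // (wfc_writes W3).
have M1 : sim P 0 (r0, m0) (csteps (ph_size f) S * w) p2 s1.
  by apply: (sim_cmd (V := V) b2 Sb Z0 W1) => //; rewrite -?/(G _) -?/g1; lia.
have M2 : sim P p2 s1 (csteps (ph_double f) S * w) p3 s2.
  by apply: (sim_cmd (V := V + g1) b2 Sb Z0 W2) => //; rewrite -?/(G _) -?/g2; lia.
have M3 : sim P p3 s2 (csteps (ph_init f) S * w) q s3.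
  by apply: (sim_cmd (V := V + g1 + g2) b2 Sb Z0 W3) => //; rewrite -?/(G _) -?/g3; lia.
have w1 : 1 <= w by rewrite /w; lia.
(* [V'] varies in the induction because each round raises the bound by [gb]. *)
have ML : forall V', bounded s3.1 s3.2 V' -> Kmax <= V' -> V' + N * gb + gf <= 2 ^ b ->
    sim P q s3 ((N * (csteps (ph_body f) S + 2) + 1) * w) e.+1 s4
    /\ bounded s4.1 s4.2 (V' + N * gb) /\ (forall x, x \in [:: 0; 1] -> s4.1 x <= S).
  elim: L BS3 sp0 {Vb Gtot B3 M3}.
    move=> s BSs sp0 V' Bs HV' Vb; rewrite mul0n addn0; split; last by [].
    move=> r A; exists r => //; rewrite ?mul0n add0n mul1n -[w]addn0.
    apply: (exe_le_step Cj) => /=; rewrite A // sp0 /=; first exact: leq_trans w1.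
    exact: exe_le_refl.
  move=> s N' s' spn _ IH BSs sp0 V' Bs HV' Vb.
  have Bs' : bounded (run (ph_body f) s).1 (run (ph_body f) s).2 (V' + gb).
    by apply: (run_bounded Wb).
  have BSs' x : x \in [:: 0; 1] -> (run (ph_body f) s).1 x <= S.
    by move=> Hx; rewrite run_frame ?BSs // (wfc_writes Wb).
  have [||IH1 [IH2 IH3]] := IH BSs' sp0 _ Bs'; [lia|lia|].
  split; last by split=> //; rewrite mulSn addnA.
  have Mb : sim P q.+1 s (csteps (ph_body f) S * w) e (run (ph_body f) s).
    by apply: (sim_cmd (V := V') b2 Sb Z0 Wb) => //; rewrite -?/(G _) -?/gb; lia.
  move=> r A; have [r1 E1 A1] := Mb r A; have [r2 E2 A2] := IH1 r1 A1.
  exists r2 => //.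
  apply: (@exe_le_weak _ _ (w + (csteps (ph_body f) S * w + (w + (N' * (csteps (ph_body f) S + 2) + 1) * w)))).
    by lia.
  apply: (exe_le_step Cj) => /=; rewrite A // ?(negbTE spn).
    apply: leq_trans (bitlen_le (b := Z * b) _) _; last by rewrite /w; lia.
    have : s.1 rsp <= V' by apply Bs.
    move=> H; apply: leq_trans H _; apply: leq_trans (_ : 2 ^ b <= _); first by lia.
    by rewrite leq_exp2l // leq_pmull.
  apply: exe_le_trans E1 _.
  by apply: (exe_le_step Cj') => /=.
have [||M4 [B4 BS4]] := ML _ B3; [lia|lia|].
have M5 : sim P e.+1 s4 (csteps (ph_fin f) S * w) (e.+1 + size (ccmd e.+1 (ph_fin f))) (run (ph_fin f) s4).
  by apply: (sim_cmd (V := V + g1 + g2 + g3 + N * gb) b2 Sb Z0 Wf) => //; rewrite -?/(G _) -?/gf; lia.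
have /(_ r0 (fun x _ => erefl)) [r' [t Et Lt] A'] := sim_trans M1 (sim_trans M2 (sim_trans M3 (sim_trans M4 M5))).
exists (t + 0), (State (e.+1 + size (ccmd e.+1 (ph_fin f))) r' (run (ph_fin f) s4).2); split=> //; last first.
  rewrite addn0; apply: leq_trans Lt _; rewrite /phases_sum -!mulnDl mulnA leq_mul2r.
  by apply/orP; right; nia.
apply: exe_runs Et _; apply: runs_halt.
have Ne : onth P (size P) = None by elim: (P).
suff E : e.+1 + size (ccmd e.+1 (ph_fin f)) = size P by move: Ne; rewrite -E.
by rewrite /P /assemble !size_cat /= size_cat /= -/p2 -/p3 -/q -/e; lia.
Qed.

(** * Polynomial bounds and the exponential rate *)

Definition polyb (f : nat -> nat) :=
  exists p : {poly rat}, forall n, ((f n)%:R <= p.[n%:R])%R.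

Lemma polyb_const c : polyb (fun=> c).
Proof. by exists (c%:R%:P)%R => n; rewrite hornerC. Qed.

Lemma polyb_id : polyb id.
Proof. by exists 'X%R => n; rewrite hornerX. Qed.

Lemma polyb_add f g : polyb f -> polyb g -> polyb (fun n => f n + g n).
Proof.
move=> [p Hp] [q Hq]; exists (p + q)%R => n.
by rewrite natrD hornerD lerD.
Qed.

Lemma polyb_mul f g : polyb f -> polyb g -> polyb (fun n => f n * g n).
Proof.
move=> [p Hp] [q Hq]; exists (p * q)%R => n.
by rewrite natrM hornerM ler_pM.
Qed.

Lemma polyb_esteps e s : polyb s -> polyb (fun n => esteps e (s n)).
Proof.
by move=> Hs; elim: e => /= *; do ?[exact: polyb_const|apply: polyb_add|apply: polyb_mul|assumption].
Qed.

Lemma polyb_csteps c s : polyb s -> polyb (fun n => csteps c (s n)).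
Proof.
move=> Hs; elim: c => /= *;
  by do ?[exact: polyb_const|exact: polyb_esteps|apply: polyb_add|apply: polyb_mul|assumption].
Qed.

Lemma polyb_grow c s : polyb s -> polyb (fun n => grow c (s n)).
Proof.
move=> Hs; elim: c => /= *;
  by do ?[exact: polyb_const|apply: polyb_add|apply: polyb_mul|assumption].
Qed.

Lemma polyb_sum (F : cmd -> nat -> nat) f : (forall c, polyb (F c)) ->
  polyb (fun n => phases_sum (fun c => F c n) f).
Proof. by move=> H; rewrite /phases_sum; do 4?[apply: polyb_add => //]. Qed.

(** The integer part of [2 * y ^ (5 * n)]: the measure is at most [5 * n], and a binary tree has
    fewer than twice as many nodes as leaves. *)
Definition iter_bound n := (2 * 49 ^ (5 * n)) %/ 46 ^ (5 * n).

(** Chosen so that two to this power is at least [n + 3 + N.+1 * G], where [n + 3] bounds the input,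
    [N] is at most [2 ^ (5 * n).+1] and [G] is the total growth of the phases. *)
Definition bit_bound f n := 5 * n + (n + 3) + phases_sum (fun c => grow c (n + n)) f + 4.

Definition time_bound f n :=
  (iter_bound n).+1 * ((phases_sum (fun c => csteps c (n + n)) f + 2) *
    (2 * (phases_sum csize f * bit_bound f n + 1))).

(** The left side is about 1.3715, and 6867/5000 is the right side in lowest terms. *)
Lemma rate_bound : ((49%:R / 46%:R) ^+ 5 <= 1.3734%Q :> rat)%R.
Proof.
rewrite -[1.3734%Q]divq_num_den.
have -> : numq 1.3734%Q = Posz 6867 by [].
have -> : denq 1.3734%Q = Posz 5000 by [].
lra.
Qed.

Lemma time_bound_Ostar f : Ostar_exp 1.3734%Q (time_bound f).
Proof.
have := rate_bound; rewrite /Ostar_exp; move: 1.3734%Q => c Ec.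
have [p Hp] : polyb (fun n => (phases_sum (fun c => csteps c (n + n)) f + 2) *
    (2 * (phases_sum csize f * bit_bound f n + 1))).
  have H2 : polyb (fun n => n + n) by apply: polyb_add; apply: polyb_id.
  have Hs := polyb_sum f (fun c => polyb_csteps c H2).
  have Hg := polyb_sum f (fun c => polyb_grow c H2).
  rewrite /bit_bound.
  by do ?[exact: polyb_const|exact: polyb_id|exact: Hs|exact: Hg|apply: polyb_add|apply: polyb_mul].
(* The 3 absorbs the factor 2 in [iter_bound] and the successor in [time_bound], as [1 <= c ^ n]. *)
exists (3%:R%:P * p)%R, 0 => n _.
rewrite /time_bound natrM hornerM hornerC mulrAC.
apply: ler_pM; [exact: ler0n|exact: ler0n| |exact: Hp].
have [y yE] : exists y : rat, y = (49%:R / 46%:R)%R by eexists.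
have y1 : (1 <= y)%R by rewrite yE; lra.
rewrite -yE in Ec.
have c1 : (1 <= c)%R by apply: Order.POrderTheory.le_trans Ec; apply: exprn_ege1.
have ge1 : (1 <= c ^+ n)%R by apply: exprn_ege1.
have : ((iter_bound n)%:R <= 2 * c ^+ n)%R.
  apply: (@Order.POrderTheory.le_trans _ _ (2 * (y ^+ 5) ^+ n)%R).
    rewrite yE -exprM expr_div_n mulrA ler_pdivlMr; last by apply: exprn_gt0; lra.
    by rewrite -!natrX -!natrM ler_nat; apply: leq_trunc_div.
  apply: ler_wpM2l; first by clear; lra.
  have c0 : (0 <= c)%R by move: c1; clear; lra.
  have y0 : (0 <= y ^+ 5)%R by apply: exprn_ge0; move: y1; clear; lra.
  exact: lerXn2r.
rewrite -[((iter_bound n).+1)%:R%R]natr1.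
move: ((iter_bound n)%:R)%R (c ^+ n)%R ge1; clear=> u v; lra.
Qed.

(** The crude [49 <= 2 * 46] suffices, because this bound enters only the bit length of the
    numbers. *)
Lemma iter_bound_le n : iter_bound n <= 2 ^ (5 * n).+1.
Proof.
have H : 49 ^ (5 * n) <= 2 ^ (5 * n) * 46 ^ (5 * n) by rewrite -expnMn; case: (5 * n) => // k; rewrite leq_exp2r.
rewrite /iter_bound; apply: leq_trans (leq_div2r _ (leq_mul (leqnn 2) H)) _.
by rewrite mulnA mulnK ?expnS // expn_gt0.
Qed.

Lemma assemble_time f n (w : seq nat) N s4 :
  let s2 := run (ph_double f) (run (ph_size f) (fun=> 0, nth 0 w)) in
  wf_phases f -> (forall a, nth 0 w a <= n + 3) ->
  s2.1 0 = n -> s2.1 1 = n + n ->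
  loop (ph_body f) (run (ph_init f) s2) N s4 -> s4.1 rsp = 0 -> N <= iter_bound n ->
  exists t s, [/\ runs (assemble f) (init w) t s, t <= time_bound f n
    & Defs.mem s = (run (ph_fin f) s4).2].
Proof.
move=> s2 Wf Bw S0 S1 L sp0 HN.
have p2 k : k < 2 ^ k by apply: ltn_expl.
have [G GE] : exists G, G = phases_sum (fun c => grow c (n + n)) f by eexists.
have bE : bit_bound f n = 5 * n + (n + 3) + G + 4 by rewrite GE.
have bS : n + n <= 2 ^ bit_bound f n.
  by apply: leq_trans (ltnW (p2 _)); rewrite bE; clear; lia.
have b2 : 1 < bit_bound f n by rewrite bE; clear; lia.
have bV : n + 3 + N.+1 * G <= 2 ^ bit_bound f n.
  have H1 := leq_trans HN (iter_bound_le n).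
  have -> : bit_bound f n = (n + 3) + (((5 * n).+2 + G) + 2) by rewrite bE; clear; lia.
  apply: leq_add_exp2; [clear; lia|clear; lia|exact: ltnW|].
  apply: leq_trans (_ : 2 ^ (5 * n).+2 * 2 ^ G <= _).
    apply: leq_mul; last exact: ltnW.
    rewrite expnS mul2n -addnn -addn1; apply: leq_add => //.
    by rewrite expn_gt0.
  by rewrite -expnD leq_exp2l // leq_addr.
have [|||||t [s [Hr Ht Hm]]] := @assemble_runs f (fun=> 0) (nth 0 w) (n + n) (bit_bound f n) (n + 3) N s4 Wf _ _ _ _ L sp0 b2 bS _.
- by split.
- by rewrite leq_addl.
- by rewrite -/s2 S0 leq_addr.
- by rewrite -/s2 S1.
- by rewrite -GE.
exists t, s; split=> //; apply: leq_trans Ht _.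
by rewrite /time_bound leq_mul2r ltnS HN orbT.
Qed.

(** * The 2-SAT instance of a leaf *)

(** An induced path on three vertices whose middle vertex is left open. For symmetric [g], counting
    the edges makes the predicate invariant under all permutations of its arguments. *)
Definition p3 (g : rel nat) (a b c : nat) : bool :=
  [&& a != b, b != c, a != c & g a b + g b c + g a c == 2].

Definition propagated (n : nat) (g : rel nat) (T : pred nat) :=
  forall u v, u < n -> v < n -> g u v -> T (n + u) -> T v.

Definition und (n : nat) (T : pred nat) : pred nat := fun v => ~~ T v && ~~ T (n + v).

Definition deg (n : nat) (g : rel nat) (U : pred nat) (v : nat) : nat :=
  \sum_(u < n) (g v u && U u).

(* [f v] stands for membership of [v] in the cluster part. *)
Definition sol (n : nat) (g : rel nat) (f : pred nat) :=
  (forall u v, u < n -> v < n -> g u v -> f u || f v) /\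
  (forall a b c, a < n -> b < n -> c < n -> p3 g a b c -> ~~ [&& f a, f b & f c]).

Definition respects (n : nat) (T : pred nat) (f : pred nat) :=
  forall v, v < n -> (T v -> f v) /\ (T (n + v) -> ~~ f v).

(* Literals: [v < n] says that [v] is in the cluster part, [n + v] that it is
   in the independent part. *)
Definition impl (n : nat) (g : rel nat) (T : pred nat) (l l' : nat) : bool :=
  [&& l' < n, n <= l < n + n & g (l - n) l' || (l' == l - n) && T l'] ||
  [&& l < n, n <= l' < n + n &
      (l == l' - n) && T l' || has (fun z => T z && p3 g z l (l' - n)) (iota 0 n)].

Inductive reach (E : rel nat) (l : nat) : nat -> Prop :=
  | reach0 : reach E l l
  | reachS l' l'' : reach E l l' -> E l' l'' -> reach E l l''.

Lemma reach_trans E a b c : reach E a b -> reach E b c -> reach E a c.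
Proof. by move=> H; elim=> // x y _ IH; apply: reachS. Qed.

Definition lneg n l := if l < n then n + l else l - n.

Definition lval n (f : pred nat) l := if l < n then f l else ~~ f (l - n).

Section Leaf.
Variables (n : nat) (g : rel nat) (T : pred nat).
Hypotheses (gsym : symmetric g) (girr : irreflexive g).

Let E := impl n g T.

Lemma p3_swap a b c : p3 g a b c = p3 g a c b.
Proof.
rewrite /p3 (gsym b c) [c == b]eq_sym; case: (a != b); case: (b != c); case: (a != c) => //=.
by congr (_ == _); lia.
Qed.

Lemma p3_rot a b c : p3 g a b c = p3 g b c a.
Proof.
rewrite /p3 (gsym a b) (gsym a c) [b == a]eq_sym [c == a]eq_sym.
by case: (a != b); case: (b != c); case: (a != c) => //=; congr (_ == _); lia.
Qed.

Lemma impl_lt l l' : E l l' -> (l < n + n) && (l' < n + n).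
Proof. by rewrite /E /impl => /orP[] /and3P[]; lia. Qed.

(** Each clause contributes both of its implications, so the implication graph is invariant under
    reversing the arrows and negating the literals. *)
Lemma impl_neg l l' : E l l' -> E (lneg n l') (lneg n l).
Proof.
rewrite /E /impl /lneg => /orP[/and3P[H1 H2 H3]|/and3P[H1 H2 H3]].
  rewrite H1; have -> : (l < n) = false by lia.
  apply/orP; left; apply/and3P; split; [lia|lia|].
  rewrite addKn gsym; case/orP: H3 => [->//|/andP[/eqP <- ->]].
  by rewrite eqxx orbT.
rewrite H1; have -> : (l' < n) = false by lia.
apply/orP; right; apply/and3P; split; [lia|lia|].
rewrite addKn; case/orP: H3 => [/andP[/eqP El Tl]|/hasP[z Hz /andP[Tz Hp]]].
  by rewrite El eqxx subnKC ?Tl //; lia.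
apply/orP; right; apply/hasP; exists z => //.
by rewrite Tz p3_swap.
Qed.

Lemma reach_lt l l' : reach E l l' -> l < n + n -> l' < n + n.
Proof. by elim=> // x y _ _ /impl_lt /andP[]. Qed.

Lemma reach_neg l l' : reach E l l' -> reach E (lneg n l') (lneg n l).
Proof.
elim=> [|x y _ IH /impl_neg H]; first exact: reach0.
by apply: reach_trans IH; apply: reachS (reach0 _ _) H.
Qed.

Definition models f := forall l l', E l l' -> lval n f l -> lval n f l'.

Lemma sol_models f : sol n g f -> respects n T f -> models f.
Proof.
move=> [S1 S2] R l l'; rewrite /E /impl /lval => /orP[/and3P[H1 H2 H3]|/and3P[H1 H2 H3]].
  rewrite H1; have -> : (l < n) = false by lia.
  case/orP: H3 => [Hg|/andP[_ Hl]]; last by move=> _; apply R.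
  have /orP[->|//] : f (l - n) || f l' by apply: S1 => //; lia.
  by [].
rewrite H1; have -> : (l' < n) = false by lia.
case/orP: H3 => [/andP[/eqP El Tl]|/hasP[z]].
  by move=> _; apply R; [lia|rewrite subnKC //; lia].
rewrite mem_iota => Hz /andP[Tz Hp] fl; apply/negP => fl'.
have [|||] := negP (S2 z l (l' - n) _ _ _ Hp); try lia.
by rewrite fl fl' !andbT; apply R => //; lia.
Qed.

Lemma models_reach f l l' : models f -> reach E l l' -> lval n f l -> lval n f l'.
Proof. by move=> M; elim=> // x y _ IH /M H /IH /H. Qed.

Definition consistent := forall v, v < n -> ~ (reach E v (n + v) /\ reach E (n + v) v).

Lemma sol_consistent f : sol n g f -> respects n T f -> consistent.
Proof.
move=> S R v Hv [H1 H2]; have M := sol_models S R.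
move: (models_reach M H1) (models_reach M H2); rewrite /lval Hv.
by rewrite ltnNge leq_addr /= addKn; case: (f v) => // [/(_ isT)|_ /(_ isT)].
Qed.

(** The invariant of the greedy assignment. Its second clause expresses the preference for the
    independent part: every cluster vertex has a reason to be there, being forced, unable to be
    independent, or adjacent to an independent vertex. *)
Definition partial_model (A : pred nat) :=
  [/\ forall l l', l < n + n -> A l -> reach E l l' -> A l',
      forall v, v < n -> A v ->
        [\/ T v, reach E (n + v) v | exists2 u, u < n & g u v && A (n + u)]
    & consistent -> forall v, v < n -> ~~ (A v && A (n + v))].

(** Adding all consequences of the chosen literal [c] creates no clash. If [A] contained the
    negation of a literal reached from [c], it would by contraposition contain the negation of [c],
    but [v] is undecided in [A]. If [c] reached two complementary literals, it would reach its own
    negation; for [c = n + v] this contradicts the choice of [b], and for [c = v] it contradicts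
    consistency. *)
Lemma partial_model_add (A A' : pred nat) v (b : bool) : v < n -> partial_model A ->
  ~~ A v -> ~~ A (n + v) -> (b <-> reach E (n + v) v) ->
  (forall l, l < n + n -> A' l <-> A l \/ reach E (if b then v else n + v) l) ->
  partial_model A'.
Proof.
move=> Hv [PC PR PN] nA1 nA2 Hb HA; set c := if b then v else n + v in HA.
have cl : c < n + n by rewrite /c; case: (b); lia.
have ncA : ~~ A c /\ ~~ A (lneg n c).
  rewrite /c /lneg; case: (b); first by rewrite Hv.
  by rewrite ltnNge leq_addr /= addKn.
have HA1 l : l < n + n -> A' l -> A l \/ reach E c l by move=> Hl /HA; apply.
have HA2 l : l < n + n -> A l \/ reach E c l -> A' l by move=> Hl H; apply/HA.
split.
- move=> l l' Hl /(HA1 _ Hl)[H|H] R; apply: HA2 (reach_lt R Hl) _.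
  + by left; apply: PC R.
  + by right; apply: reach_trans R.
- move=> u Hu /HA1[|H|H]; first by lia.
  + case: (PR u Hu H) => [?|?|[x Hx /andP[gx Ax]]]; [by constructor 1|by constructor 2|].
    by constructor 3; exists x => //; rewrite gx; apply: HA2; [lia|left].
  (* The last implication on the path to [u] provides its reason: it comes from an independent
     neighbour or from [u] being forced. The empty path means that [u] is [v], which could not be
     independent. *)
  + case: {2}u / H (erefl u) => [Eu|l l' Hl El Eu].
      move: Eu Hb; rewrite /c; case: (b) => [-> [/(_ isT) H _]|]; last by lia.
      by constructor 2.
    subst l'; have /andP[ll _] := impl_lt El.
    move: (El); rewrite /E /impl => /orP[/and3P[H1 H2 /orP[H3|/andP[_ H3]]]|/and3P[H1 H2 _]].
    * constructor 3; exists (l - n); first by lia.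
      rewrite H3; apply: HA2; first by lia.
      by right; rewrite subnKC //; lia.
    * by constructor 1.
    * by lia.
- move=> C u Hu; apply/negP => /andP[/HA1 H1 /HA1 H2].
  have key l : l < n + n -> reach E c l -> ~~ A (lneg n l) /\ ~ reach E c (lneg n l).
    move=> Hl Rl; split.
      apply/negP => AN; case/negP: ncA.2; apply: PC AN _; last exact: reach_neg.
      by rewrite /lneg; case: ifP; lia.
    move=> RN; have R1 := reach_trans RN (reach_neg Rl).
    move: R1; rewrite /c /lneg; case: (b) Hb => Hb.
      by rewrite Hv => R1; apply: (C v Hv); split=> //; apply/Hb.
    by rewrite ltnNge leq_addr /= addKn => /Hb.
  have nu : lneg n u = n + u by rewrite /lneg Hu.
  have nu' : lneg n (n + u) = u by rewrite /lneg ltnNge leq_addr /= addKn.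
  have {H1}[|A1|R1] := H1; first by lia.
    have {H2}[|A2|R2] := H2; first by lia.
      by move: (PN C u Hu); rewrite A1 A2.
    have [|+ _] := key (n + u) _ R2; first by lia.
    by rewrite nu' A1.
  have [|+ +] := key u _ R1; first by lia.
  rewrite nu => nA nR; have {H2}[|A2|R2] := H2; [lia| |exact: nR].
  by rewrite A2 in nA.
Qed.

Lemma total_model_sol A :
  propagated n g T -> (forall v, v < n -> und n T v -> deg n g (und n T) v <= 2) ->
  partial_model A -> (forall v, v < n -> A v || A (n + v)) ->
  (forall v, v < n -> ~~ (A v && A (n + v))) -> sol n g A /\ respects n T A.
Proof.
move=> Tc Td [PC PR _] At Ac.
have AE l : l < n + n -> lval n A l = A l.
  rewrite /lval => Hl; case: ltnP => // nl; have H : l - n < n by lia.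
  move: (At _ H) (Ac _ H); rewrite subnKC //.
  by case: (A _); case: (A l).
have M : models A.
  move=> l l' El; have /andP[Hl Hl'] := impl_lt El; rewrite !AE // => Al.
  by apply: PC Al _ => //; apply: reachS (reach0 _ _) El.
have nA v : v < n -> A (n + v) = ~~ A v.
  by move=> Hv; move: (At _ Hv) (Ac _ Hv); case: (A v); case: (A _).
have Ru : respects n T A.
  move=> v Hv; split=> Tv.
    have : E (n + v) v.
      by rewrite /E /impl addKn Hv Tv eqxx orbT; apply/orP; left; rewrite andbT; lia.
    by move/M; rewrite /lval Hv ltnNge leq_addr /= addKn; case: (A v) => // /(_ isT).
  have : E v (n + v).
    by rewrite /E /impl addKn Hv Tv eqxx; apply/orP; right => /=; rewrite andbT; lia.
  by move/M; rewrite /lval Hv ltnNge leq_addr /= addKn; case: (A v) => // /(_ isT).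
have S1 u v : u < n -> v < n -> g u v -> A u || A v.
  move=> Hu Hv guv; have : E (n + u) v.
    by rewrite /E /impl addKn Hv guv; apply/orP; left => /=; rewrite andbT; lia.
  by move/M; rewrite /lval Hv ltnNge leq_addr /= addKn; case: (A u) => // /(_ isT).
split=> //; split=> // a0 b0 c0 Ha0 Hb0 Hc0 P0; apply/negP => /and3P[Aa0 Ab0 Ac0].
(* In a path of cluster vertices none is forced: a forced cluster vertex would turn the path into a
   violated clause, and a forced independent vertex is not in the cluster part. *)
have undec a b c : a < n -> b < n -> c < n -> p3 g a b c -> A a -> A b -> A c -> und n T a.
  move=> Ha Hb Hc P Aa Ab Ac'; rewrite /und; apply/andP; split; apply/negP => Ta.
    have : E b (n + c).
      rewrite /E /impl addKn Hb; apply/orP; right; apply/and3P; split=> //; first by lia.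
      by apply/orP; right; apply/hasP; exists a; rewrite ?mem_iota ?Ta.
    move/M; rewrite /lval Hb ltnNge leq_addr /= addKn Ac' => /(_ Ab).
    by [].
  by have := (Ru a Ha).2 Ta; rewrite Aa.
have center a b c : a < n -> b < n -> c < n -> p3 g a b c -> g b a -> g b c ->
    A a -> A b -> A c -> False.
  move=> Ha Hb Hc P gba gbc Aa Ab Ac'.
  have Ua := undec _ _ _ Ha Hb Hc P Aa Ab Ac'.
  have Ub : und n T b by apply: (undec b c a) => //; rewrite -p3_rot.
  have Uc : und n T c by apply: (undec c a b) => //; rewrite p3_rot.
  have [d Hd /andP[gdb nAd]] : exists2 d, d < n & g d b && ~~ A d.
    case: (PR b Hb Ab) => [Tb|Rb|[u Hu /andP[gub Au]]]; last first.
    + by exists u => //; rewrite gub -nA.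
    + case E0 : (has (fun d => g d b && ~~ A d) (iota 0 n)).
        by move/hasP: E0 => [d Hd Pd]; exists d => //; move: Hd; rewrite mem_iota.
      (* If all neighbours of [b] were in the cluster part, moving [b] to the independent part would
         still satisfy every implication, contrary to the path from [n + b] to [b]. *)
      pose A' v := (v != b) && A v.
      have M' : models A'.
        move=> l l'; rewrite /E /impl /lval => /orP[/and3P[H1 H2 H3]|/and3P[H1 H2 H3]].
          rewrite H1; have -> : (l < n) = false by apply/negbTE; rewrite -leqNgt; case/andP: H2.
          case/orP: H3 => [gl|/andP[/eqP H3 Tl]]; last first.
            rewrite /A' -H3 (Ru l' H1).1 // andbT => _; apply/eqP => Elb.
            by move: Ub; rewrite /und -Elb Tl.
          have lnn : l - n < n by case/andP: H2 => nl ln; rewrite ltn_subLR.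
          have [/eqP Eb|nb] := boolP (l' == b).
            move/hasPn: E0 => /(_ (l - n)); rewrite mem_iota lnn => /(_ isT).
            rewrite -Eb gl /= negbK => Al; rewrite /A' Al andbT.
            have [/eqP E1|] := boolP (l - n == b); last by [].
            by move: gl; rewrite E1 Eb girr.
          rewrite /A' nb /=; have [/eqP E1 _|nb'] := boolP (l - n == b); last first.
            by have /orP[->|//] := S1 _ _ lnn H1 gl.
          move/hasPn: E0 => /(_ l'); rewrite mem_iota H1 => /(_ isT).
          by rewrite gsym -E1 gl /= negbK.
        rewrite H1; have -> : (l' < n) = false by apply/negbTE; rewrite -leqNgt; case/andP: H2.
        rewrite /A' => /andP[_ Al]; apply/nandP; right.
        have := M l l'; rewrite /E /impl /lval H1.
        have -> : (l' < n) = false by apply/negbTE; rewrite -leqNgt; case/andP: H2.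
        by apply=> //; apply/orP; right; apply/and3P; split.
      have := models_reach M' Rb; rewrite /lval Hb ltnNge leq_addr /= addKn.
      by rewrite /A' eqxx => /(_ isT).
    + by move: Ub; rewrite /und Tb.
  (* If [d] were forced into the independent part, propagation would have forced [b] as well. *)
  have Ud : und n T d.
    rewrite /und; apply/andP; split; apply/negP => Td'.
      by have := (Ru d Hd).1 Td'; rewrite (negbTE nAd).
    by have := Tc d b Hd Hb gdb Td'; move: Ub; rewrite /und => /andP[/negbTE ->].
  have : 3 <= deg n g (und n T) b.
    have ab : a != c by move: P => /and4P[].
    have da : d != a by apply: contraNneq nAd => ->.
    have dc : d != c by apply: contraNneq nAd => ->.
    rewrite /deg (bigD1 (Ordinal Ha)) //= gba Ua (bigD1 (Ordinal Hc)) /=; last first.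
      by rewrite -val_eqE /= eq_sym.
    rewrite gbc Uc (bigD1 (Ordinal Hd)) /=; last by rewrite -!val_eqE /= da.
    by rewrite gsym gdb Ud /= !addnA; apply: leq_addr.
  by rewrite ltnNge Td.
move: (P0) => /and4P[_ _ _]; case E1 : (g a0 b0); case E2 : (g b0 c0); case E3 : (g a0 c0) => // _.
- by apply: (center a0 b0 c0); rewrite // gsym.
- by apply: (center b0 a0 c0); rewrite // -?(gsym b0 a0) // 1?gsym // p3_rot p3_swap.
- by apply: (center a0 c0 b0); rewrite // 1?gsym // p3_swap.
Qed.

End Leaf.

(** * The measure *)

Definition wt (d : nat) : nat := if d <= 2 then 2 * d else 5.

Definition mu (n : nat) (g : rel nat) (U : pred nat) : nat :=
  \sum_(v < n | U v) wt (deg n g U v).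

Definition yb : rat := (49%:R / 46%:R)%R.

Lemma yb_ge1 : (1 <= yb)%R.
Proof. by rewrite /yb; lra. Qed.

(* Branching that lowers the measure by [a] and by [b] is affordable. *)
Definition affordable (a b : nat) := (yb ^+ (b - a) + 1 <= yb ^+ b)%R.

(** The inequality is [y ^ (-a) + y ^ (-b) <= 1] multiplied by [y ^ b], and its left side decreases
    in both exponents. The premise [a <= b] guards the truncated subtraction. *)
Lemma affordable_mono a b a' b' : a <= b -> a <= a' -> b <= b' -> affordable a b -> affordable a' b'.
Proof.
rewrite /affordable => ab aa bb; move: yb yb_ge1 => y y1 H.
apply: (@Order.POrderTheory.le_trans _ _ (y ^+ (b' - b) * (y ^+ (b - a) + 1))%R).
  rewrite mulrDr mulr1 -exprD; apply: lerD; last by rewrite exprn_ege1.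
  by apply: ler_weXn2l => //; clear -aa bb ab; lia.
have -> : (y ^+ b' = y ^+ (b' - b) * y ^+ b)%R by rewrite -exprD subnK.
by apply: ler_wpM2l => //; apply: exprn_ge0; apply: Order.POrderTheory.le_trans y1.
Qed.

Lemma affordableI c a b : b - a = c -> (yb ^+ c + 1 <= yb ^+ b)%R -> affordable a b.
Proof. by move=> <-. Qed.

(** The guaranteed savings at a vertex with [p] neighbours of degree at least 3 and [q] of degree at
    most 2, for [q] increasing: [5 + p + 2 * q] and [5 + 5 * p + 2 * q] when [p + q = 3], and
    [5 + 2 * q] and [5 + 5 * p + 2 * q] when [p + q = 4]. The tightest entry is the pair 11, 11,
    which says [2 <= y ^ 11]. *)
Lemma affordable_table :
  [/\ affordable 8 20, affordable 9 17, affordable 10 14 & affordable 11 11] /\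
  [/\ affordable 5 25, affordable 7 22, affordable 9 19, affordable 11 16 & affordable 13 13].
Proof.
split; split.
- by apply: (@affordableI 12 8 20 erefl); rewrite /yb; lra.
- by apply: (@affordableI 8 9 17 erefl); rewrite /yb; lra.
- by apply: (@affordableI 4 10 14 erefl); rewrite /yb; lra.
- by apply: (@affordableI 0 11 11 erefl); rewrite /yb; lra.
- by apply: (@affordableI 20 5 25 erefl); rewrite /yb; lra.
- by apply: (@affordableI 15 7 22 erefl); rewrite /yb; lra.
- by apply: (@affordableI 10 9 19 erefl); rewrite /yb; lra.
- by apply: (@affordableI 5 11 16 erefl); rewrite /yb; lra.
- by apply: (@affordableI 0 13 13 erefl); rewrite /yb; lra.
Qed.

Lemma affordable_deg3 p q a b : p + q = 3 -> 5 + p + 2 * q <= a -> 5 + 5 * p + 2 * q <= b ->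
  affordable a b.
Proof.
have [[H1 H2 H3 H4] _] := affordable_table.
case: q => [|[|[|[|q]]]] Hpq Ha Hb;
  [refine (@affordable_mono 8 20 a b _ _ _ H1)|refine (@affordable_mono 9 17 a b _ _ _ H2)|refine (@affordable_mono 10 14 a b _ _ _ H3)
  |refine (@affordable_mono 11 11 a b _ _ _ H4)|exfalso]; clear -Hpq Ha Hb; lia.
Qed.

Lemma affordable_deg4 p q a b : 4 <= p + q -> 5 + 2 * q <= a -> 5 + 5 * p + 2 * q <= b ->
  affordable a b.
Proof.
have [_ [H1 H2 H3 H4 H5]] := affordable_table.
case: q => [|[|[|[|q]]]] Hpq Ha Hb;
  [refine (@affordable_mono 5 25 a b _ _ _ H1)|refine (@affordable_mono 7 22 a b _ _ _ H2)|refine (@affordable_mono 9 19 a b _ _ _ H3)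
  |refine (@affordable_mono 11 16 a b _ _ _ H4)|refine (@affordable_mono 13 13 a b _ _ _ H5)]; clear -Hpq Ha Hb; lia.
Qed.

Lemma wt_mono d d' : d <= d' -> wt d <= wt d'.
Proof. by rewrite /wt; do 2 case: ifP; lia. Qed.

Lemma wt_low d : 0 < d -> 5 * (3 <= d) + 2 * (d <= 2) <= wt d.
Proof. by case: d => [|[|[|[|d]]]]. Qed.

Lemma wt_drop d : 0 < d -> wt d.-1 + 2 * (d <= 2) <= wt d.
Proof. by case: d => [|[|[|[|d]]]]. Qed.

Lemma wt_drop3 d : 0 < d <= 3 -> wt d.-1 + (3 <= d) + 2 * (d <= 2) <= wt d.
Proof. by case: d => [|[|[|[|d]]]]. Qed.

(** [X] and [Y] are the weights of the neighbours of [v] before and after each loses one degree, and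
    [Z] is the weight of the remaining vertices. Out of [5 + X + Z], one branch leaves at most
    [Y + Z] and the other at most [Z], so the savings to compare are [5 + X - Y] and [5 + X]. *)
Lemma mu_branch n g (U U1 U2 : pred nat) v :
  symmetric g -> irreflexive g -> v < n -> U v -> 3 <= deg n g U v ->
  (forall u, u < n -> U u -> deg n g U u <= deg n g U v) ->
  (forall u, u < n -> U1 u = U u && (u != v)) ->
  (forall u, u < n -> U2 u = [&& U u, u != v & ~~ g v u]) ->
  (yb ^+ mu n g U1 + yb ^+ mu n g U2 <= yb ^+ mu n g U)%R.
Proof.
move=> gsym girr Hv Uv D3 Dmax U1E U2E.
set D := deg n g U v in D3 Dmax.
pose d (u : 'I_n) := deg n g U u.
pose N (u : 'I_n) := U u && g v u.
pose X := \sum_(u < n | N u) wt (d u).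
pose Y := \sum_(u < n | N u) wt (d u).-1.
pose Z := \sum_(u < n | U2 u) wt (d u).
pose p := \sum_(u < n | N u) (3 <= d u).
pose q := \sum_(u < n | N u) (d u <= 2).
have gE u : deg n g U u = deg n g U1 u + g u v.
  rewrite /deg (bigD1 (Ordinal Hv)) //= [X in _ = X + _](bigD1 (Ordinal Hv)) //= U1E // eqxx.
  rewrite Uv !andbT !andbF add0n addnC; congr (_ + _); apply: eq_bigr => i Hi.
  by rewrite U1E // -val_eqE /= in Hi *; rewrite Hi andbT.
have muE : mu n g U = 5 + X + Z.
  rewrite /mu (bigD1 (Ordinal Hv)) //= -/D {1}/wt ifF; last by lia.
  rewrite (bigID (fun u : 'I_n => g v u)) /= addnA; congr (5 + _ + _); apply: eq_bigl => u.
    rewrite /N -val_eqE /=; case E : (g v u); rewrite ?andbF // !andbT.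
    by case: (U u) => //=; apply/eqP => Eu; rewrite Eu girr in E.
  by rewrite U2E // -val_eqE /= andbA.
have mu1 : mu n g U1 <= Y + Z.
  rewrite /mu (bigID (fun u : 'I_n => g v u)) /=; apply: leq_add.
    apply: eq_leq; apply: eq_big => u.
      rewrite /N U1E //; case E : (g v u); rewrite ?andbF // !andbT.
      by case: (U u) => //=; apply/eqP => Eu; rewrite Eu girr in E.
    by move=> /andP[_ gu]; rewrite /d gE gsym gu addn1.
  rewrite (eq_bigl (fun u : 'I_n => U2 u)); last by move=> u; rewrite U1E // U2E // andbA.
  by apply: leq_sum => u _; apply: wt_mono; rewrite /d gE leq_addr.
have mu2 : mu n g U2 <= Z.
  apply: leq_sum => u _; apply: wt_mono; apply: leq_sum => w _; rewrite U2E //.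
  by case: (g u w); case: (U w) => //=; case: (_ && _).
have pq : p + q = D.
  rewrite /p /q -big_split /= (eq_bigr (fun=> 1)); last by move=> u _; case: ltnP => H /=; lia.
  rewrite /D /deg (big_mkcond (fun u => N u)) /=; apply: eq_bigr => u _.
  by rewrite /N; case: (U u); case: (g v u).
have d1 u : N u -> 0 < d u by move=> /andP[_ gu]; rewrite /d gE gsym gu addn1.
have dD u : N u -> d u <= D by move=> /andP[Uu gu]; apply: Dmax.
have X1 : 5 * p + 2 * q <= X.
  rewrite /p /q !big_distrr /= -big_split /=; apply: leq_sum => u /d1.
  exact: wt_low.
have Y1 : Y + 2 * q <= X.
  rewrite /q big_distrr /= -big_split /=; apply: leq_sum => u /d1.
  exact: wt_drop.
(* This is where the maximality of the degree of [v] enters: the neighbours counted by [p] have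
   degree exactly 3 and fall from weight 5 to 4. *)
have Y2 : D = 3 -> Y + p + 2 * q <= X.
  move=> D_3; rewrite /p /q big_distrr /= -!big_split /=; apply: leq_sum => u Nu.
  by apply: wt_drop3; rewrite d1 // -D_3 dD.
have : affordable (5 + X - Y) (5 + X).
  have [/eqP E|ne] := boolP (D == 3).
    by apply: (@affordable_deg3 p q); have := Y2 E; lia.
  by apply: (@affordable_deg4 p q); lia.
rewrite /affordable (_ : 5 + X - (5 + X - Y) = Y); last by lia.
move: yb yb_ge1 => y y1 H.
apply: (@Order.POrderTheory.le_trans _ _ (y ^+ (Y + Z) + y ^+ Z)%R).
  by apply: lerD; apply: ler_weXn2l.
rewrite muE !exprD -[X in (_ + X <= _)%R]mul1r -mulrDl; apply: ler_wpM2r.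
  by apply: exprn_ge0; apply: Order.POrderTheory.le_trans y1.
by rewrite -exprD.
Qed.

Lemma mu_le n g U : mu n g U <= 5 * n.
Proof.
apply: leq_trans (_ : \sum_(v < n) 5 <= _); last by rewrite sum_nat_const card_ord mulnC.
rewrite /mu big_mkcond /=; apply: leq_sum => v _; case: ifP => // _.
by rewrite /wt; case: ifP; lia.
Qed.

(** * Monopolar partitions as labellings *)

Definition adjn (n : nat) (G : sgraph 'I_n) : rel nat := fun u v =>
  if (insub u : option 'I_n) is Some a then
    if (insub v : option 'I_n) is Some b then G a b else false
  else false.

Lemma adjnE n (G : sgraph 'I_n) (a b : 'I_n) : adjn G a b = G a b.
Proof. by rewrite /adjn !valK. Qed.

Lemma adjn_sym n (G : sgraph 'I_n) : symmetric (adjn G).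
Proof.
move=> u v; rewrite /adjn; case: (insub u) => [a|]; case: (insub v) => [b|] //.
exact: adj_sym.
Qed.

Lemma adjn_irr n (G : sgraph 'I_n) : irreflexive (adjn G).
Proof. by move=> u; rewrite /adjn; case: (insub u) => // a; apply: adj_irr. Qed.

Definition adj_trans_on n (G : sgraph 'I_n) (C : {set 'I_n}) :=
  forall a b c, a \in C -> b \in C -> c \in C -> G a b -> G b c -> a != c -> G a c.

(** Transitivity shortens a path, vertex by vertex from its start, to a single edge, so every
    component is complete. *)
Lemma cluster_adj_trans n (G : sgraph 'I_n) (C : {set 'I_n}) :
  cluster_graph (induced G C) <-> adj_trans_on G C.
Proof.
split=> [H a b c Ca Cb Cc Gab Gbc ac|H x].
  have cab : connect (induced G C) (Sub a Ca) (Sub b Cb) by apply: connect1.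
  have cbc : connect (induced G C) (Sub b Cb) (Sub c Cc) by apply: connect1.
  apply: (H (Sub a Ca) (Sub a Ca) (Sub c Cc)); rewrite ?inE //.
  exact: connect_trans cab cbc.
have key y : connect (induced G C) x y -> (x == y) || G (val x) (val y).
  move=> /connectP[p + ->]; elim/last_ind: p => [|p z IH]; first by rewrite /= eqxx.
  rewrite rcons_path last_rcons => /andP[/IH IHp Ez].
  have [//|/= xz] := eqVneq x z.
  case/orP: IHp => [/eqP Ex|Gx]; first by rewrite Ex.
  apply: H Gx Ez _; try exact: valP.
  by apply: contraNneq xz => /val_inj ->.
move=> y z; rewrite !inE => /key Hy /key Hz yz.
case/orP: Hy => [/eqP Exy|Gy].
  by case/orP: Hz => [/eqP Exz|]; [rewrite -Exy -Exz eqxx in yz|rewrite -Exy].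
case/orP: Hz => [/eqP Exz|Gz]; first by rewrite -Exz /= /induced_adj adj_sym.
rewrite adj_sym in Gy; apply: H Gy Gz _; try exact: valP.
by apply: contraNneq yz => /val_inj ->.
Qed.

Lemma sol_partition n (G : sgraph 'I_n) (f : pred nat) (C : {set 'I_n}) :
  (forall v : 'I_n, f v = (v \in C)) ->
  sol n (adjn G) f <-> cluster_graph (induced G C) /\ independent G (~: C).
Proof.
move=> fC; rewrite cluster_adj_trans; split=> [[S1 S2]|[H1 H2]].
  split=> [a b c Ca Cb Cc Gab Gbc ac|a b].
    have [//|nG] := boolP (G a c).
    have P : p3 (adjn G) a b c.
      rewrite /p3 !adjnE Gab Gbc (negbTE nG) /= andbT; apply/and3P; split=> //.
        by apply: contraTneq Gab => /val_inj ->; rewrite adj_irr.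
      by apply: contraTneq Gbc => /val_inj ->; rewrite adj_irr.
    by have := S2 a b c (ltn_ord _) (ltn_ord _) (ltn_ord _) P; rewrite !fC Ca Cb Cc.
  rewrite !inE -!fC => na nb; apply/negP => Gab.
  by have := S1 a b (ltn_ord _) (ltn_ord _); rewrite adjnE Gab (negbTE na) (negbTE nb) => /(_ isT).
split=> [u v Hu Hv|u v w Hu Hv Hw].
  rewrite -[u]/(val (Ordinal Hu)) -[v]/(val (Ordinal Hv)) adjnE !fC => Guv.
  apply/negPn/negP; rewrite negb_or => /andP[na nb].
  by have := H2 (Ordinal Hu) (Ordinal Hv); rewrite !inE na nb Guv => /(_ isT isT).
rewrite -[u]/(val (Ordinal Hu)) -[v]/(val (Ordinal Hv)) -[w]/(val (Ordinal Hw)) /p3 !adjnE !fC !val_eqE.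
move: (Ordinal Hu) (Ordinal Hv) (Ordinal Hw) => a b c /and4P[ab bc ac E]; apply/negP => /and3P[Ca Cb Cc].
case Gab : (G a b) E; case Gbc : (G b c); case Gac : (G a c) => // _.
- by rewrite (H1 a b c) in Gac.
- by rewrite (H1 b a c) // adj_sym in Gbc.
- by rewrite (H1 a c b) // adj_sym in Gab.
Qed.

(** * The search program *)

Definition rfound := 3.
Definition rbest := 4.
Definition rbv := 5.
Definition rd := 6.
Definition rok := 7.
Definition ri := 8.
Definition rj := 9.
Definition rk := 10.

(** Register 11, the last one below [NV], is a dummy. *)
Definition skip := Assign 11 (Lit 0).

Definition eadj (u v : expr) := Fetch (Plus (Plus (Lit 1) (Times u 0)) v).
Definition acell (i l : expr) := Plus (Plus (Plus (Lit 1) (Times (Var 0) 0)) (Times i 1)) l.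
Definition cell (i l : expr) := Fetch (acell i l).
Definition rowT := Plus (Var 1) (Var rsp).
Definition rowP := Plus rowT (Lit 1).
Definition rowR (l : expr) := Plus l (Lit 1).
Definition il (v : expr) := Plus (Var 0) v.
Definition vi := Var ri.
Definition vj := Var rj.
Definition vk := Var rk.

Definition addr (n i l : nat) := 1 + n * n + i * (n + n) + l.

(* Behind the adjacency matrix the memory is used as a matrix [D] of width
   [2n]: row 0 holds first the input lists and later the assignment, rows 1 to
   [2n] the implication matrix, and row [2n + k] the [k]-th frame of the
   stack. *)
Definition rep (n : nat) (g : rel nat) (s : store) (D : nat -> nat -> bool) :=
  [/\ s.1 0 = n, s.1 1 = n + n,
      forall u v, u < n -> v < n -> s.2 (1 + u * n + v) = g u v
    & forall i l, l < n + n -> s.2 (addr n i l) = D i l].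

(** * Reading and writing the matrix in memory *)

Definition setcell (D : nat -> nat -> bool) i l b : nat -> nat -> bool :=
  fun i' l' => if (i' == i) && (l' == l) then b else D i' l'.

Lemma mulnD_inj w i l i' l' : l < w -> l' < w -> i * w + l = i' * w + l' -> i = i' /\ l = l'.
Proof.
move=> Hl Hl' E; have w0 : 0 < w by apply: leq_ltn_trans Hl.
have := congr1 (divn^~ w) E; rewrite !divnMDl // !divn_small // !addn0 => Ei.
by split=> //; move: E; rewrite Ei => /addnI.
Qed.

Lemma eq_addr n i l i' l' : l < n + n -> l' < n + n ->
  (addr n i l == addr n i' l') = (i == i') && (l == l').
Proof.
move=> Hl Hl'; apply/eqP/andP => [|[/eqP -> /eqP ->]//].
rewrite /addr -!(addnA (1 + n * n)) => /addnI /(mulnD_inj Hl Hl')[-> ->].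
by rewrite !eqxx.
Qed.

Lemma addr_adj n u v i l : u < n -> v < n -> (1 + u * n + v == addr n i l) = false.
Proof.
move=> Hu Hv; apply/negbTE; rewrite neq_ltn /addr -!addnA ltn_add2l; apply/orP; left.
by apply: (@leq_trans (n * n)); [|rewrite leq_addr]; nia.
Qed.

Section Rep.
Variables (n : nat) (g : rel nat).

Lemma rep_ext s D D' : rep n g s D -> (forall i l, l < n + n -> D i l = D' i l) -> rep n g s D'.
Proof. by move=> [H1 H2 H3 H4] E; split=> // i l Hl; rewrite H4 // E. Qed.

Lemma rep_setr s D x v : 1 < x -> rep n g s D -> rep n g (setr s x v) D.
Proof. by move=> Hx [H1 H2 H3 H4]; split=> //=; rewrite upd_neq //; lia. Qed.

Lemma eadjE s D u v : rep n g s D -> eval u s < n -> eval v s < n ->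
  eval (eadj u v) s = g (eval u s) (eval v s).
Proof. by move=> [H1 _ H3 _] Hu Hv; rewrite /= H1 H3. Qed.

Lemma acellE s D i l : rep n g s D -> eval (acell i l) s = addr n (eval i s) (eval l s).
Proof. by move=> [H1 H2 _ _]; rewrite /= H1 H2. Qed.

Lemma cellE s D i l : rep n g s D -> eval l s < n + n ->
  eval (cell i l) s = D (eval i s) (eval l s).
Proof. 
move=> H Hl; have Ha := acellE i l H; case: H => _ _ _ H4.
have -> : eval (cell i l) s = s.2 (eval (acell i l) s) by [].
by rewrite Ha H4.
 Qed.

Lemma rep_store s D i l e (b : bool) : rep n g s D -> eval l s < n + n -> eval e s = b ->
  rep n g (run (Store (acell i l) e) s) (setcell D (eval i s) (eval l s) b).
Proof.
move=> H Hl He; have Ha := acellE i l H; case: H => H1 H2 H3 H4.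
have -> : run (Store (acell i l) e) s = (s.1, upd s.2 (eval (acell i l) s) (eval e s)) by [].
rewrite Ha He; split=> //.
  by move=> u v Hu Hv; rewrite [_.2]/= upd_neq ?H3 // addr_adj.
move=> i' l' Hl'; rewrite [_.2]/= /upd /setcell eq_addr //.
by case: ifP => // _; apply: H4.
Qed.

End Rep.

(** An invariant rule that also hands to the body proof the value of the counter and the fact that
    registers never written keep their initial values. Invariants can therefore concentrate on the
    memory. *)
Lemma for_rule x y c s k (I : nat -> store -> Prop) :
  s.1 y = k -> x \notin writes c ->
  I 0 (setr s x 0) ->
  (forall i s', i < k -> s'.1 x = i -> (forall z, z \notin x :: writes c -> s'.1 z = s.1 z) ->
     I i s' -> I i.+1 (setr (run c s') x i.+1)) ->
  I k (run (For x y c) s).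
Proof.
move=> Ey xc I0 IS; rewrite [run _ _]/(iter (s.1 y) (for_step c x) (setr s x 0)) Ey.
suff H j : j <= k -> let s' := iter j (for_step c x) (setr s x 0) in
    [/\ s'.1 x = j, forall z, z \notin x :: writes c -> s'.1 z = s.1 z & I j s'].
  by have [] := H k (leqnn _).
elim: j => [|j IH] Hj /=.
  split=> //; first by rewrite upd_eq.
  by move=> z; rewrite inE => /norP[Hz _]; rewrite upd_neq.
have [E1 E2 E3] := IH (ltnW Hj).
have Ex : (run c (iter j (for_step c x) (setr s x 0))).1 x = j by rewrite run_frame.
split.
- by rewrite upd_eq Ex.
- move=> z Hz; move: (Hz); rewrite inE => /norP[zx zc].
  by rewrite upd_neq // run_frame // E2.
- by rewrite /for_step Ex; apply: IS.
Qed.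

Lemma run_seq c1 c2 s : run (Seq c1 c2) s = run c2 (run c1 s).
Proof. by []. Qed.

Lemma run_cond e c1 c2 s : run (Cond e c1 c2) s = if eval e s == 0 then run c2 s else run c1 s.
Proof. by []. Qed.

Lemma run_skip s : run skip s = setr s 11 0.
Proof. by []. Qed.

(** Truncated subtraction as conjunction: many conditions of the program are written in this
    form. *)
Lemma and_bits (a b : bool) : (a + b - 1 == 0) = ~~ (a && b).
Proof. by case: a; case: b. Qed.

Lemma has_iotaS (P : pred nat) j : has P (iota 0 j.+1) = has P (iota 0 j) || P j.
Proof. by rewrite -addn1 iotaD has_cat /= orbF. Qed.

(* A loop that sets entries of one row, where the condition must not depend on
   the entries that are being set. *)
Lemma mark_loop n g s D x y k e r c (R : nat) (C : nat -> nat) (P : pred nat) :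
  1 < x -> x != 11 -> s.1 y = k -> rep n g s D ->
  (forall j s' D', j < k -> s'.1 x = j -> (forall z, z \notin [:: x; 11] -> s'.1 z = s.1 z) ->
     rep n g s' D' ->
     (forall i l, l < n + n -> ~~ ((i == R) && has (fun j' => P j' && (C j' == l)) (iota 0 j)) ->
        D' i l = D i l) ->
     [/\ eval r s' = R, eval c s' = C j, C j < n + n & (eval e s' == 0) = ~~ P j]) ->
  rep n g (run (For x y (Cond e (Store (acell r c) (Lit 1)) skip)) s)
    (fun i l => D i l || (i == R) && has (fun j => P j && (C j == l)) (iota 0 k)).
Proof.
move=> Hx x11 Ey H0 HB.
apply: (for_rule (I := fun j s' => rep n g s'
  (fun i l => D i l || (i == R) && has (fun j => P j && (C j == l)) (iota 0 j)))) => //.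
- by rewrite inE.
- by apply: rep_setr => //; apply: rep_ext H0 _ => i l _; rewrite andbF orbF.
move=> j s' Hj Ej Fr H; apply: rep_setr => //.
have [|E1 E2 E3 E4] := HB j s' _ Hj Ej Fr H.
  by move=> i l _ /negbTE ->; rewrite orbF.
rewrite run_cond E4 if_neg; case: ifP => HP; last first.
  rewrite run_skip; apply: rep_setr => //; apply: rep_ext H _ => i l _.
  by rewrite has_iotaS HP orbF.
have H' := @rep_store n g s' _ r c (Lit 1) true H; rewrite E2 E1 in H'.
apply: rep_ext (H' E3 erefl) _ => i l _; rewrite /setcell has_iotaS HP.
by case: (i =P R) => //= _; rewrite eq_sym; case: (_ == _); rewrite ?orbT ?orbF.
Qed.

Lemma eval_plus a b s : eval (Plus a b) s = eval a s + eval b s. Proof. by []. Qed.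
Lemma eval_minus a b s : eval (Minus a b) s = eval a s - eval b s. Proof. by []. Qed.
Lemma eval_lit k s : eval (Lit k) s = k. Proof. by []. Qed.
Lemma eval_var x s : eval (Var x) s = s.1 x. Proof. by []. Qed.
Definition evalE := (eval_plus, eval_minus, eval_lit, eval_var).

Lemma has_eq_iota (P : pred nat) l k : has (fun j => P j && (j == l)) (iota 0 k) = (l < k) && P l.
Proof.
apply/hasP/andP => [[j]|[Hl Pl]]; first by rewrite mem_iota => Hj /andP[Pj /eqP <-].
by exists l; rewrite ?mem_iota // Pl eqxx.
Qed.

Lemma evil n g s D v : rep n g s D -> eval (il v) s = n + eval v s.
Proof. by case=> H1 _ _ _; rewrite /il !evalE H1. Qed.

Lemma cell_val n g s D i l r0 l0 : rep n g s D -> eval i s = r0 -> eval l s = l0 -> l0 < n + n ->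
  eval (cell i l) s = D r0 l0.
Proof. by move=> H <- <- Hl; apply: cellE H Hl. Qed.

Lemma eadj_val n g s D u v u0 v0 : rep n g s D -> eval u s = u0 -> eval v s = v0 -> u0 < n -> v0 < n ->
  eval (eadj u v) s = g u0 v0.
Proof. by move=> H <- <- Hu Hv; apply: eadjE H Hu Hv. Qed.

Lemma il_val n g s D v v0 : rep n g s D -> eval v s = v0 -> eval (il v) s = n + v0.
Proof. by move=> H <-; apply: evil H. Qed.

Lemma rowT_val n g s D k : rep n g s D -> s.1 rsp = k -> eval rowT s = n + n + k.
Proof. by move=> [_ E _ _] Ek; rewrite /rowT !evalE E Ek. Qed.

Lemma ltn_dbl v n : v < n -> v < n + n.
Proof. by move=> H; apply: leq_trans H _; rewrite leq_addr. Qed.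

Lemma ltn_dbl2 v n : v < n -> n + v < n + n.
Proof. by rewrite ltn_add2l. Qed.

(** * Propagation of forced independent vertices *)

Definition cl (n : nat) (g : rel nat) (T : pred nat) : pred nat :=
  fun l => T l || (l < n) && has (fun u => g u l && T (n + u)) (iota 0 n).

(** One pass is enough: it adds cluster literals only, and only independent literals force
    anything. *)
Definition close_cmd :=
  For ri 0 (For rj 0 (Cond (Minus (Plus (eadj vi vj) (cell rowT (il vi))) (Lit 1))
    (Store (acell rowT vj) (Lit 1)) skip)).

Lemma close_spec n g s D k : rep n g s D -> s.1 rsp = k ->
  let t := n + n + k in
  rep n g (run close_cmd s) (fun r l => if r == t then cl n g (D t) l else D r l).
Proof.
move=> H Hk t.
suff H' : rep n g (run close_cmd s)
    (fun r l => D r l || [&& r == t, l < n & has (fun u => g u l && D t (n + u)) (iota 0 n)]).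
  by apply: rep_ext H' _ => r l _; rewrite /cl; case: eqP => [->|]; rewrite ?orbF.
have H0 : s.1 0 = n by case: H.
apply: (for_rule (I := fun i s' => rep n g s' (fun r l => D r l ||
  [&& r == t, l < n & has (fun u => g u l && D t (n + u)) (iota 0 i)]))) => //.
  by apply: rep_setr => //; apply: rep_ext H _ => r l _; rewrite !andbF orbF.
move=> i s' Hi Ei Fr H1; apply: rep_setr => //.
have Hk1 : s'.1 rsp = k by rewrite Fr.
have n1 : s'.1 0 = n by case: H1.
apply: rep_ext (mark_loop (R := t) (C := id) (P := fun j => g i j && D t (n + i)) _ _ n1 H1 _) _ => //.
  move=> j s2 D2 Hj Ej Fr2 H2 ED; have Ei2 : s2.1 ri = i by rewrite Fr2.
  have [n2 nn2 _ _] := H2.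
  have Erow : eval rowT s2 = t by rewrite /rowT !evalE nn2 Fr2 // Hk1.
  have lt1 : n + i < n + n by rewrite ltn_add2l.
  split=> //; first by apply: leq_trans Hj _; rewrite leq_addr.
  have Eil : eval (il vi) s2 = n + i by rewrite (evil _ H2) /vi evalE Ei2.
  rewrite !evalE (eadjE H2) ?evalE ?Ei2 ?Ej // (cellE _ H2) Eil // Erow and_bits.
  (* The tested entry lies in the independent half of the row while only the cluster half is
     written, so the loop does not disturb its own condition. *)
  rewrite ED // ?has_eq_iota; last first.
    by rewrite eqxx /=; apply/negP => /andP[]; clear -Hj; lia.
  by rewrite eqxx ltnNge leq_addr /= orbF.
move=> r l Hl; rewrite has_eq_iota has_iotaS.
by case: (r == t); rewrite ?orbF //=; case: (l < n); rewrite ?orbF //= orbA.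
Qed.

(** * Choice of the branching vertex *)

Definition degree_cmd :=
  Seq (Assign rbest (Lit 0)) (Seq (Assign rbv (Lit 0))
  (For ri 0 (Cond (Minus (Lit 1) (Plus (cell rowT vi) (cell rowT (il vi))))
    (Seq (Assign rd (Lit 0))
    (Seq (For rj 0 (Cond (Minus (eadj vi vj) (Plus (cell rowT vj) (cell rowT (il vj))))
            (Incr rd) skip))
         (Cond (Minus (Var rd) (Var rbest)) (Seq (Assign rbest (Var rd)) (Assign rbv vi)) skip)))
    skip))).

Lemma inner_degree_spec n g s D k i : rep n g s D -> s.1 rsp = k -> s.1 ri = i -> i < n -> s.1 rd = 0 ->
  let s' := run (For rj 0 (Cond (Minus (eadj vi vj) (Plus (cell rowT vj) (cell rowT (il vj))))
            (Incr rd) skip)) s in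
  rep n g s' D /\ s'.1 rd = deg n g (und n (D (n + n + k))) i.
Proof.
move=> H Hk Hi Hin Hd s'; set t := n + n + k.
have H0 : s.1 0 = n by case: H.
rewrite /deg -(big_mkord xpredT (fun u => (g i u && und n (D t) u : nat))).
apply: (for_rule (I := fun j s' => rep n g s' D /\
   s'.1 rd = \sum_(0 <= u < j) (g i u && und n (D t) u))) => //.
  split; first exact: rep_setr.
  by rewrite big_geq // [LHS]upd_neq.
move=> j s1 Hj Ej Fr [H1 E1].
have [n1 nn1 _ _] := H1.
have Ei1 : eval vi s1 = i by rewrite eval_var Fr.
have {}Ej : eval vj s1 = j by [].
have Erow : eval rowT s1 = t by rewrite /rowT !evalE nn1 Fr // Hk.
have Ec : (eval (Minus (eadj vi vj) (Plus (cell rowT vj) (cell rowT (il vj)))) s1 == 0)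
    = ~~ (g i j && und n (D t) j).
  rewrite eval_minus eval_plus (eadj_val H1 Ei1 Ej Hin Hj) (cell_val H1 Erow Ej (ltn_dbl Hj)).
  rewrite (cell_val H1 Erow (il_val H1 Ej) (ltn_dbl2 Hj)).
  by rewrite /und; case: (g i j); case: (D t j); case: (D t (n + j)).
rewrite run_cond Ec if_neg; case: ifP => HP.
  split; first by apply: rep_setr => //; apply: rep_setr.
  by rewrite [LHS]upd_neq // [LHS]upd_eq E1 big_nat_recr //= HP addn1.
split; first by apply: rep_setr => //; apply: rep_setr.
by rewrite [LHS]upd_neq // [LHS]upd_neq // E1 big_nat_recr //= HP addn0.
Qed.

(** A vertex is recorded only when it strictly improves on [rbest], which starts at 0; hence nothing
    is claimed about [rbv] while [rbest] is 0. *)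
Lemma degree_spec n g s D k : rep n g s D -> s.1 rsp = k ->
  let s' := run degree_cmd s in let U := und n (D (n + n + k)) in
  [/\ rep n g s' D, forall v, v < n -> U v -> deg n g U v <= s'.1 rbest
    & 0 < s'.1 rbest -> [/\ s'.1 rbv < n, U (s'.1 rbv) & deg n g U (s'.1 rbv) = s'.1 rbest]].
Proof.
move=> H Hk s' U; pose t := n + n + k.
have H0 : s.1 0 = n by case: H.
rewrite /s' /degree_cmd !run_seq; set s1 := run _ (run _ s).
have H1 : rep n g s1 D by do ?[apply: rep_setr => //].
have n1 : s1.1 0 = n by case: H1.
have Hk1 : s1.1 rsp = k by [].
apply: (for_rule (I := fun i s' => [/\ rep n g s' D, forall v, v < i -> U v -> deg n g U v <= s'.1 rbest
    & 0 < s'.1 rbest -> [/\ s'.1 rbv < n, U (s'.1 rbv) & deg n g U (s'.1 rbv) = s'.1 rbest]])) => //.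
move=> i s2 Hi Ei Fr [H2 B2 C2].
have [n2 nn2 _ _] := H2.
have Hk2 : s2.1 rsp = k by rewrite Fr.
have Vi : eval vi s2 = i by [].
have Erow : eval rowT s2 = t by rewrite /rowT !evalE nn2 Hk2.
have Ec : (eval (Minus (Lit 1) (Plus (cell rowT vi) (cell rowT (il vi)))) s2 == 0) = ~~ U i.
  rewrite eval_minus eval_plus (cell_val H2 Erow Vi (ltn_dbl Hi)).
  rewrite (cell_val H2 Erow (il_val H2 Vi) (ltn_dbl2 Hi)).
  by rewrite /U /und; case: (D t i); case: (D t (n + i)).
rewrite run_cond Ec if_neg; case: ifP => HU; last first.
  rewrite run_skip; split; first by do ?[apply: rep_setr => //].
  - move=> v; rewrite ltnS leq_eqVlt => /orP[/eqP -> |Hv]; first by rewrite HU.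
    exact: B2.
  - exact: C2.
rewrite !run_seq; set s3 := run (Assign rd _) s2.
have H3 : rep n g s3 D by apply: rep_setr.
have [H4 D4] := @inner_degree_spec n g s3 D k i H3 Hk2 Ei Hi erefl.
set s4 := run _ s3 in H4 D4 *.
have Eb : s4.1 rbest = s2.1 rbest by rewrite run_frame.
have Ev : s4.1 rbv = s2.1 rbv by rewrite run_frame.
have Ei4 : s4.1 ri = i by rewrite run_frame.
rewrite run_cond !evalE D4 Eb subn_eq0; case: (leqP (deg n g (und n (D (n + n + k))) i) (s2.1 rbest)) => Hle.
  rewrite run_skip; split; first by do ?[apply: rep_setr => //].
  - move=> v; rewrite /= !upd_neq // Eb ltnS leq_eqVlt => /orP[/eqP -> //|Hv].
    exact: B2.
  - by rewrite /= !upd_neq // Eb Ev.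
set sF := setr _ _ _.
have E1 : sF.1 rbest = deg n g (und n (D (n + n + k))) i by rewrite -D4.
have E2 : sF.1 rbv = i by rewrite -Ei4.
rewrite E1 E2; split; first by do ?[apply: rep_setr => //].
- move=> v; rewrite ltnS leq_eqVlt => /orP[/eqP -> //|Hv Uv].
  by apply: leq_trans (B2 v Hv Uv) (ltnW Hle).
- by [].
Qed.

Lemma store_val n g s D i l e r0 l0 (b : bool) : rep n g s D -> eval i s = r0 -> eval l s = l0 ->
  l0 < n + n -> eval e s = b -> rep n g (run (Store (acell i l) e) s) (setcell D r0 l0 b).
Proof. by move=> H <- <- Hl He; apply: rep_store. Qed.

(** * Branching on the stack *)

Definition branch_cmd :=
  Seq (For rj 1 (Store (acell rowP vj) (cell rowT vj)))
  (Seq (Store (acell rowT (Var rbv)) (Lit 1))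
  (Seq (Store (acell rowP (il (Var rbv))) (Lit 1)) (Incr rsp))).

Lemma rowP_val n g s D k : rep n g s D -> s.1 rsp = k -> eval rowP s = n + n + k.+1.
Proof. by move=> H Hk; rewrite /rowP eval_plus (rowT_val H Hk) addn1 addnS. Qed.

(** The current frame becomes the cluster branch, and a copy made beforehand becomes the independent
    branch above it. No other row changes, so the frames further down survive. *)
Lemma branch_spec n g s D k v : rep n g s D -> s.1 rsp = k -> s.1 rbv = v -> v < n ->
  let s' := run branch_cmd s in let t := n + n + k in
  s'.1 rsp = k.+1 /\
  rep n g s' (fun r l => if r == t then D t l || (l == v) else
                         if r == t.+1 then D t l || (l == n + v) else D r l).
Proof.
move=> H Hk Hv vn s' t; rewrite /s' /branch_cmd 3!run_seq.
set s1 := run (For _ _ _) s.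
have H1 : rep n g s1 (fun r l => if (r == t.+1) && (l < n + n) then D t l else D r l).
  have E1 : s.1 1 = n + n by case: H.
  apply: (for_rule (I := fun j s' => rep n g s'
    (fun r l => if (r == t.+1) && (l < j) then D t l else D r l))) => //.
    by apply: rep_setr => //; apply: rep_ext H _ => r l _; rewrite andbF.
  move=> j s2 Hj Ej Fr H2; apply: rep_setr => //.
  have Hk2 : s2.1 rsp = k by rewrite Fr.
  have {}Ej : eval vj s2 = j by [].
  have Ec := cell_val H2 (rowT_val H2 Hk2) Ej Hj.
  rewrite -/t (_ : t == t.+1 = false) ?andFb in Ec; last by clear; lia.
  apply: rep_ext (store_val H2 (rowP_val H2 Hk2) Ej Hj Ec) _ => r l _.
  rewrite /setcell addnS -/t ltnS [l <= j]leq_eqVlt.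
  by case: (r == t.+1) => //=; case: (l =P j) => [->|_] //=.
have Hk1 : s1.1 rsp = k by rewrite run_frame.
have Hv1 : eval (Var rbv) s1 = v by rewrite eval_var run_frame.
have H2 := store_val H1 (rowT_val H1 Hk1) Hv1 (ltn_dbl vn) (erefl : eval (Lit 1) s1 = true).
set s2 := run (Store _ _) s1 in H2 *.
have Hk2 : s2.1 rsp = k by [].
have Hv2 : eval (Var rbv) s2 = v by [].
have H3 := store_val H2 (rowP_val H2 Hk2) (il_val H2 Hv2) (ltn_dbl2 vn) (erefl : eval (Lit 1) s2 = true).
set s3 := run (Store _ _) s2 in H3 *.
have Hk3 : s3.1 rsp = k by [].
split; first by rewrite [LHS]upd_eq Hk3.
apply: rep_setr => //; apply: rep_ext H3 _ => r l Hl; rewrite /setcell addnS -/t Hl andbT.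
have [->|rt] := eqVneq r t.
  by rewrite (_ : t == t.+1 = false) /=; [case: eqP; rewrite ?orbT ?orbF|clear; lia].
by case: (r == t.+1) => //=; case: eqP; rewrite ?orbT ?orbF.
Qed.

(** * The implication matrix *)

Definition eeq (a b : expr) := Minus (Lit 1) (Plus (Minus a b) (Minus b a)).
Definition adjr (a b : expr) := Plus (eadj a b) (eeq a b).
Definition esum3 (a b c : expr) := Plus (Plus (adjr a b) (adjr b c)) (adjr a c).
Definition ep3 (a b c : expr) :=
  Minus (Lit 1) (Plus (Minus (esum3 a b c) (Lit 2)) (Minus (Lit 2) (esum3 a b c))).
(** Sends every nonzero value to 1. The outer subtraction from a literal also makes the expression
    [flat], so that it may be stored. *)
Definition ebool (e : expr) := Minus (Lit 1) (Minus (Lit 1) e).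

Lemma eeq_val a b s a0 b0 : eval a s = a0 -> eval b s = b0 -> eval (eeq a b) s = (a0 == b0).
Proof. by move=> Ea Eb; rewrite /eeq !evalE Ea Eb; case: eqP; lia. Qed.

(** The sum uses reflexive adjacency. If two of the vertices coincide, they contribute 1 and agree
    on the third, so the sum is odd; a sum of 2 therefore also certifies that the vertices are
    distinct. *)
Lemma ep3_val n g s D a b c a0 b0 c0 : symmetric g -> irreflexive g -> rep n g s D ->
  eval a s = a0 -> eval b s = b0 -> eval c s = c0 -> a0 < n -> b0 < n -> c0 < n ->
  eval (ep3 a b c) s = p3 g a0 b0 c0.
Proof.
move=> gsym girr H Ea Eb Ec Ha Hb Hc.
have E : eval (esum3 a b c) s = (g a0 b0 + (a0 == b0)) + (g b0 c0 + (b0 == c0)) + (g a0 c0 + (a0 == c0)).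
  rewrite /esum3 /adjr !eval_plus (eadj_val H Ea Eb Ha Hb) (eadj_val H Eb Ec Hb Hc) (eadj_val H Ea Ec Ha Hc).
  by rewrite (eeq_val Ea Eb) (eeq_val Eb Ec) (eeq_val Ea Ec).
rewrite /ep3 !eval_minus eval_plus !eval_minus !eval_lit E /p3.
have [->|ab] := eqVneq a0 b0; first by rewrite girr; case: (g b0 c0); case: eqP.
have [E'|bc] := eqVneq b0 c0.
  by rewrite E' in ab *; rewrite girr (negbTE ab); case: (g a0 c0).
have [->|ac] := eqVneq a0 c0.
  by rewrite girr (gsym c0 b0); case: (g b0 c0).
by case: (g a0 b0); case: (g b0 c0); case: (g a0 c0).
Qed.

Definition fill_cmd :=
  For ri 0 (For rj 0
    (Seq (Store (acell (rowR vi) vj) (eeq vi vj))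
    (Seq (Store (acell (rowR (il vi)) (il vj)) (eeq vi vj))
    (Seq (Store (acell (rowR (il vi)) vj)
            (ebool (Plus (eadj vi vj) (Minus (Plus (eeq vi vj) (cell rowT vj)) (Lit 1)))))
    (Seq (Store (acell (rowR vi) (il vj))
            (ebool (Minus (Plus (eeq vi vj) (cell rowT (il vj))) (Lit 1))))
         (For rk 0 (Cond (Minus (Plus (cell rowT vk) (ep3 vk vi vj)) (Lit 1))
            (Store (acell (rowR vi) (il vj)) (Lit 1)) skip))))))).

Definition vx n l := if l < n then l else l - n.

(** The diagonal is set from the start because [reach] includes the empty path. *)
Definition impl_refl n g T l l' := (l == l') || impl n g T l l'.

Lemma impl_reflE n g T i j : i < n -> j < n ->
  [/\ impl_refl n g T i j = (i == j), impl_refl n g T (n + i) (n + j) = (i == j),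
      impl_refl n g T (n + i) j = g i j || (i == j) && T j
    & impl_refl n g T i (n + j) =
      (i == j) && T (n + j) || has (fun z => T z && p3 g z i j) (iota 0 n)].
Proof.
move=> Hi Hj; rewrite /impl_refl /impl !addKn eqn_add2l Hi Hj !ltn_add2l Hi Hj !leq_addr.
have -> : (n <= i) = false by clear -Hi; lia.
have -> : (n <= j) = false by clear -Hj; lia.
have -> : (n + i < n) = false by clear; lia.
have -> : (n + j < n) = false by clear; lia.
have -> : (n + i == j) = false by clear -Hj; lia.
have -> : (i == n + j) = false by clear -Hi; lia.
by rewrite /= !orbF (eq_sym j i); split.
Qed.

Lemma fill_body_spec n g s D k i j : symmetric g -> irreflexive g -> rep n g s D -> s.1 rsp = k -> 0 < k ->
  s.1 ri = i -> s.1 rj = j -> i < n -> j < n ->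
  let T := D (n + n + k) in let W := impl_refl n g T in
  rep n g (run
    (Seq (Store (acell (rowR vi) vj) (eeq vi vj))
    (Seq (Store (acell (rowR (il vi)) (il vj)) (eeq vi vj))
    (Seq (Store (acell (rowR (il vi)) vj)
            (ebool (Plus (eadj vi vj) (Minus (Plus (eeq vi vj) (cell rowT vj)) (Lit 1)))))
    (Seq (Store (acell (rowR vi) (il vj))
            (ebool (Minus (Plus (eeq vi vj) (cell rowT (il vj))) (Lit 1))))
         (For rk 0 (Cond (Minus (Plus (cell rowT vk) (ep3 vk vi vj)) (Lit 1))
            (Store (acell (rowR vi) (il vj)) (Lit 1)) skip)))))) s)
   (fun r l => if [&& 0 < r <= n + n, vx n r.-1 == i & vx n l == j] then W r.-1 l else D r l).
Proof.
move=> gsym girr H Hk k0 Ei Ej Hi Hj T W; rewrite 4!run_seq.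
(* With [0 < k] the frame lies outside the matrix rows, so the stores leave intact the labelling [T]
   that they read. *)
have big r : r <= n + n -> (n + n + k == r) = false by clear -k0; lia.
have Vi s' : s'.1 ri = i -> eval vi s' = i by [].
have Vj s' : s'.1 rj = j -> eval vj s' = j by [].
have rR e s' e0 : eval e s' = e0 -> eval (rowR e) s' = e0.+1 by move=> E; rewrite /rowR eval_plus E addn1.
have H1 := store_val H (rR _ _ _ (Vi _ Ei)) (Vj _ Ej) (ltn_dbl Hj) (eeq_val (Vi _ Ei) (Vj _ Ej)).
set s1 := run (Store _ _) s in H1 *.
have Ei1 : s1.1 ri = i by []. have Ej1 : s1.1 rj = j by []. have Hk1 : s1.1 rsp = k by [].
have H2 := store_val H1 (rR _ _ _ (il_val H1 (Vi _ Ei1))) (il_val H1 (Vj _ Ej1)) (ltn_dbl2 Hj)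
  (eeq_val (Vi _ Ei1) (Vj _ Ej1)).
set s2 := run (Store _ _) s1 in H2 *.
have Ei2 : s2.1 ri = i by []. have Ej2 : s2.1 rj = j by []. have Hk2 : s2.1 rsp = k by [].
have T2 l : setcell (setcell D i.+1 j (i == j)) (n + i).+1 (n + j) (i == j) (n + n + k) l = T l.
  by rewrite /setcell !big //; clear -Hi; lia.
have E3 : eval (ebool (Plus (eadj vi vj) (Minus (Plus (eeq vi vj) (cell rowT vj)) (Lit 1)))) s2
    = g i j || (i == j) && T j.
  rewrite /ebool !eval_minus !eval_plus (eadj_val H2 (Vi _ Ei2) (Vj _ Ej2) Hi Hj) eval_minus eval_plus.
  rewrite (eeq_val (Vi _ Ei2) (Vj _ Ej2)) (cell_val H2 (rowT_val H2 Hk2) (Vj _ Ej2) (ltn_dbl Hj)) T2 !eval_lit.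
  by case: (g i j); case: (i == j); case: (T j).
have H3 := store_val H2 (rR _ _ _ (il_val H2 (Vi _ Ei2))) (Vj _ Ej2) (ltn_dbl Hj) E3.
set s3 := run (Store _ _) s2 in H3 *; set D3 := setcell _ _ _ _ in H3.
have Ei3 : s3.1 ri = i by []. have Ej3 : s3.1 rj = j by []. have Hk3 : s3.1 rsp = k by [].
have T3 l : D3 (n + n + k) l = T l.
  by rewrite /D3 {1}/setcell big ?T2 //; clear -Hi; lia.
have E4 : eval (ebool (Minus (Plus (eeq vi vj) (cell rowT (il vj))) (Lit 1))) s3 = (i == j) && T (n + j).
  rewrite /ebool !eval_minus !eval_plus.
  rewrite (eeq_val (Vi _ Ei3) (Vj _ Ej3)) (cell_val H3 (rowT_val H3 Hk3) (il_val H3 (Vj _ Ej3)) (ltn_dbl2 Hj)) T3 !eval_lit.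
  by case: (i == j); case: (T _).
have H4 := store_val H3 (rR _ _ _ (Vi _ Ei3)) (il_val H3 (Vj _ Ej3)) (ltn_dbl2 Hj) E4.
set s4 := run (Store _ _) s3 in H4 *; set D4 := setcell _ _ _ _ in H4.
have T4 l : D4 (n + n + k) l = T l.
  by rewrite /D4 {1}/setcell big ?T3 //; clear -Hi; lia.
have n4 : s4.1 0 = n by case: H4.
apply: rep_ext (mark_loop (R := i.+1) (C := fun=> n + j) (P := fun z => T z && p3 g z i j) _ _ n4 H4 _) _ => //.
  move=> z s5 D5 Hz Ez Fr H5 ED.
  have Ei5 : s5.1 ri = i by rewrite Fr.
  have Ej5 : s5.1 rj = j by rewrite Fr.
  have Hk5 : s5.1 rsp = k by rewrite Fr.
  have Vz : eval vk s5 = z by [].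
  split; [exact: rR (Vi _ Ei5)|exact: il_val H5 (Vj _ Ej5)|exact: ltn_dbl2|].
  rewrite eval_minus eval_plus (cell_val H5 (rowT_val H5 Hk5) Vz (ltn_dbl Hz)) eval_lit.
  rewrite (ep3_val gsym girr H5 Vz (Vi _ Ei5) (Vj _ Ej5) Hz Hi Hj) and_bits ED ?T4 //; first exact: ltn_dbl.
  by rewrite big //; clear -Hi; lia.
have [W1 W2 W3 W4] := impl_reflE g T Hi Hj.
move=> r l Hl; have -> : has (fun z => (T z && p3 g z i j) && (n + j == l)) (iota 0 n)
    = (l == n + j) && has (fun z => T z && p3 g z i j) (iota 0 n).
  rewrite eq_sym; case: eqP => _; first by apply: eq_has => z; rewrite andbT.
  by apply/hasP; case=> z _; rewrite andbF.
rewrite /D4 /D3 /setcell /W.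
case: (boolP [&& 0 < r <= n + n, vx n r.-1 == i & vx n l == j]) => [/and3P[Hr /eqP Er /eqP El]|/negbTE Hno].
  have [rr|rr] := ltnP r.-1 n; have [ll|ll] := ltnP l n;
    move: Er El; rewrite /vx ?rr ?ll ?(leq_gtF rr) ?(leq_gtF ll) => Er El.
  - have -> : r = i.+1 by clear -Er Hr; lia.
    rewrite El eqxx (_ : j == n + j = false) /=; last by clear -Hj; lia.
    rewrite (_ : i.+1 == (n + i).+1 = false) /= ?eqxx /= ?orbF ?W1 //; clear -Hi; lia.
  - have -> : r = i.+1 by clear -Er Hr; lia.
    have -> : l = n + j by clear -El ll; lia.
    by rewrite !eqxx /= W4.
  - have -> : r = (n + i).+1 by clear -Er Hr rr; lia.
    rewrite El (_ : (n + i).+1 == i.+1 = false) /=; last by clear -Hi; lia.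
    by rewrite !eqxx /= orbF W3.
  - have -> : r = (n + i).+1 by clear -Er Hr rr; lia.
    have -> : l = n + j by clear -El ll; lia.
    rewrite (_ : (n + i).+1 == i.+1 = false) /=; last by clear -Hi; lia.
    rewrite (_ : n + j == j = false) ?andbF /=; last by clear -Hj; lia.
    by rewrite !eqxx /= orbF W2.
have N a b : 0 < a <= n + n -> vx n a.-1 = i -> vx n b = j -> (r == a) && (l == b) = false.
  move=> Ha E1 E2; apply/negP => /andP[/eqP Er /eqP El].
  by rewrite Er El Ha E1 E2 !eqxx in Hno.
have v1 a : a < n -> vx n a = a by rewrite /vx => ->.
have v2 a : vx n (n + a) = a by rewrite /vx ltnNge leq_addr /= addKn.
have i1 : 0 < i.+1 <= n + n by clear -Hi; lia.
have i2 : 0 < (n + i).+1 <= n + n by clear -Hi; lia.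
rewrite !N ?v2 ?v1 //=.
by rewrite andbA N ?v2 ?v1 //= orbF.
Qed.

Lemma fill_spec n g s D k : symmetric g -> irreflexive g -> rep n g s D -> s.1 rsp = k -> 0 < k ->
  let T := D (n + n + k) in
  rep n g (run fill_cmd s)
   (fun r l => if 0 < r <= n + n then impl_refl n g T r.-1 l else D r l).
Proof.
move=> gsym girr H Hk k0 T; have n0 : s.1 0 = n by case: H.
have vxlt l : l < n + n -> vx n l < n by rewrite /vx; case: (ltnP l n) => //; clear; lia.
suff H' : rep n g (run fill_cmd s)
  (fun r l => if (0 < r <= n + n) && (vx n r.-1 < n) then impl_refl n g T r.-1 l else D r l).
  apply: rep_ext H' _ => r l _; case Hr: (0 < r <= n + n) => //=.
  by rewrite vxlt //; clear -Hr; lia.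
apply: (for_rule (I := fun i s' => rep n g s'
  (fun r l => if (0 < r <= n + n) && (vx n r.-1 < i) then impl_refl n g T r.-1 l else D r l))) => //.
  by apply: rep_setr => //; apply: rep_ext H _ => r l _; rewrite ltn0 andbF.
move=> i s1 Hi Ei Fr H1; apply: rep_setr => //.
have n1 : s1.1 0 = n by case: H1.
have big : (n + n + k <= n + n) = false by clear -k0; lia.
pose DD i j r l := if (0 < r <= n + n) && ((vx n r.-1 < i) || (vx n r.-1 == i) && (vx n l < j))
  then impl_refl n g T r.-1 l else D r l.
apply: (@rep_ext _ _ _ (DD i n)); last first.
  move=> r l Hl; rewrite /DD vxlt // andbT ltnS [vx n r.-1 <= i]leq_eqVlt.
  by rewrite orbC.
apply: (for_rule (I := fun j s' => rep n g s' (DD i j))) => //.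
  by apply: rep_setr => //; apply: rep_ext H1 _ => r l _; rewrite /DD ltn0 andbF orbF.
move=> j s2 Hj Ej Fr2 H2; apply: rep_setr => //.
have Ei2 : s2.1 ri = i by rewrite Fr2.
have Hk2 : s2.1 rsp = k by rewrite Fr2 // Fr.
apply: rep_ext (fill_body_spec gsym girr H2 Hk2 k0 Ei2 Ej Hi Hj) _ => r l Hl.
have -> : DD i j (n + n + k) = T by rewrite /DD big andbF.
rewrite /DD ltnS; case: (0 < r <= n + n) => //=; rewrite [vx n l <= j]leq_eqVlt.
by case: (vx n r.-1 == i) => //=; case: (vx n l == j); rewrite ?orbT.
Qed.

(** * Transitive closure by Warshall's algorithm *)

Fixpoint wars (W : rel nat) (k : nat) : rel nat :=
  if k is k'.+1 then fun i j => wars W k' i j || wars W k' i k' && wars W k' k' j else W.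

Lemma wars_sub (W : rel nat) k i j : W i j -> wars W k i j.
Proof. by move=> H; elim: k => //= k ->. Qed.

(** [wars W k] sees the paths whose inner nodes are all below [k], and two of them joined at a node
    below [k] form another one. *)
Lemma wars_trans (W : rel nat) k a i j : a < k -> wars W k i a -> wars W k a j -> wars W k i j.
Proof.
elim: k a i j => // k IH a i j; rewrite ltnS leq_eqVlt => /orP[/eqP ->|Ha] /=.
  by move=> /orP[->|/andP[-> _]] /orP[->|/andP[_ ->]]; rewrite orbT.
move=> /orP[H1|/andP[H1 H2]] /orP[H3|/andP[H3 H4]].
- by rewrite (IH a) .
- by rewrite (IH a i k) // H4 orbT.
- by rewrite H1 (IH a k j) // orbT.
- by rewrite H1 H4 orbT.
Qed.

Lemma reach_wars n g T i j : i < n + n -> reach (impl n g T) i j ->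
  wars (impl_refl n g T) (n + n) i j.
Proof.
move=> Hi; elim=> [|l l' _ IH E]; first by apply: wars_sub; rewrite /impl_refl eqxx.
have /andP[Hl _] := impl_lt E.
apply: (wars_trans Hl IH); apply: wars_sub.
by rewrite /impl_refl E orbT.
Qed.

Definition warshall_cmd :=
  For rk 1 (For ri 1 (For rj 1
    (Cond (Minus (Plus (cell (rowR vi) vk) (cell (rowR vk) vj)) (Lit 1))
       (Store (acell (rowR vi) vj) (Lit 1)) skip))).

Lemma rowR_val e s e0 : eval e s = e0 -> eval (rowR e) s = e0.+1.
Proof. by move=> E; rewrite /rowR eval_plus E addn1. Qed.

(** The matrix is updated in place, so at an intermediate moment it is no exact stage of [wars]. The
    invariant confines it instead: every entry dominates stage [k], the entries already visited
    dominate stage [k.+1], and all entries are sound for [reach]. *)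
Lemma warshall_spec n g s D T : rep n g s D ->
  (forall l l', l < n + n -> l' < n + n -> D l.+1 l' = impl_refl n g T l l') ->
  exists D', [/\ rep n g (run warshall_cmd s) D',
    forall r l, ~~ (0 < r <= n + n) -> D' r l = D r l
    & forall l l', l < n + n -> l' < n + n -> (D' l.+1 l' <-> reach (impl n g T) l l')].
Proof.
move=> H HD; set W := impl_refl n g T in HD; set E := impl n g T.
pose Inv k i j s' := exists D', [/\ rep n g s' D', forall r l, ~~ (0 < r <= n + n) -> D' r l = D r l,
  forall a b, a < n + n -> b < n + n -> wars W k a b -> D' a.+1 b,
  forall a b, a < n + n -> b < n + n -> (a < i) || (a == i) && (b < j) -> wars W k.+1 a b -> D' a.+1 b
  & forall a b, a < n + n -> b < n + n -> D' a.+1 b -> reach E a b].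
have Inv_setr k i j s' x v : 1 < x -> Inv k i j s' -> Inv k i j (setr s' x v).
  by move=> Hx [D' [H1 H2 H3 H4 H5]]; exists D'; split=> //; apply: rep_setr.
have nn s' k i j : Inv k i j s' -> s'.1 1 = n + n by case=> D' [[]].
suff [D' [H1 H2 H3 _ H5]] : Inv (n + n) 0 0 (run warshall_cmd s).
  exists D'; split=> // l l' Hl Hl'; split; first exact: H5.
  by move=> R; apply: H3 => //; apply: reach_wars.
have I0 : Inv 0 0 0 s.
  exists D; split=> //.
  - by move=> a b Ha Hb; rewrite HD.
  - by move=> a b _ _; rewrite ltn0 andbF.
  - move=> a b Ha Hb; rewrite HD // /W /impl_refl => /orP[/eqP ->|Eab]; first exact: reach0.
    exact: reachS (reach0 _ _) Eab.
apply: (for_rule (I := fun k s' => Inv k 0 0 s')); [exact: nn I0|by []|exact: (Inv_setr)|].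
move=> k s1 Hk Ek _ I1; apply: (Inv_setr) => //.
suff [D' [H1 H2 H3 H4 H5]] : Inv k (n + n) 0 (run (For ri 1 (For rj 1
    (Cond (Minus (Plus (cell (rowR vi) vk) (cell (rowR vk) vj)) (Lit 1))
       (Store (acell (rowR vi) vj) (Lit 1)) skip))) s1).
  exists D'; split=> // a b Ha Hb; first by apply: H4 => //; rewrite Ha.
  by rewrite ltn0 andbF.
apply: (for_rule (I := fun i s' => Inv k i 0 s')); [exact: nn I1|by []|exact: (Inv_setr)|].
move=> i s2 Hi Ei Fr2 I2; apply: (Inv_setr) => //.
have Ek2 : s2.1 rk = k by rewrite Fr2.
suff [D' [H1 H2 H3 H4 H5]] : Inv k i (n + n) (run (For rj 1
    (Cond (Minus (Plus (cell (rowR vi) vk) (cell (rowR vk) vj)) (Lit 1))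
       (Store (acell (rowR vi) vj) (Lit 1)) skip)) s2).
  exists D'; split=> // a b Ha Hb; rewrite ltn0 andbF orbF ltnS leq_eqVlt => Hab.
  by apply: H4 => //; rewrite Hb andbT orbC.
apply: (for_rule (I := fun j s' => Inv k i j s')); [exact: nn I2|by []|exact: (Inv_setr)|].
move=> j s3 Hj Ej Fr3 [D' [H1 H2 H3 H4 H5]]; apply: (Inv_setr) => //.
have Vk : eval vk s3 = k by rewrite eval_var Fr3.
have Vi : eval vi s3 = i by rewrite eval_var Fr3.
have Vj : eval vj s3 = j by [].
rewrite run_cond eval_minus eval_plus eval_lit.
rewrite (cell_val H1 (rowR_val Vi) Vk Hk) (cell_val H1 (rowR_val Vk) Vj Hj) and_bits if_neg.
case: ifP => HP; last first.
  rewrite run_skip; exists D'; split=> //.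
  move=> a b Ha Hb; rewrite ltnS (leq_eqVlt b) andb_orr orbA => /orP[/orP[Hab|]|Hab].
  - by apply: H4 => //; rewrite Hab.
  - move=> /andP[/eqP Ea /eqP Eb]; rewrite Ea Eb /= => /orP[|/andP[W1 W2]]; first exact: H3.
    by rewrite (H3 i k) // (H3 k j) in HP.
  - by apply: H4 => //; rewrite Hab orbT.
have := store_val H1 (rowR_val Vi) Vj Hj (erefl : eval (Lit 1) s3 = true).
set s4 := run _ s3 => H6; exists (setcell D' i.+1 j true); split=> //.
- move=> r l Hr; rewrite /setcell; case: (r =P i.+1) => [Er|_]; last exact: H2.
  by move: Hr; rewrite Er ltnS Hi.
- by move=> a b Ha Hb Hw; rewrite /setcell; case: ifP => // _; apply: H3.
- move=> a b Ha Hb Hab Hw; rewrite /setcell; case: ifP => // N; apply: H4 => //.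
  by move: Hab N; rewrite eqSS ltnS (leq_eqVlt b); case: (a == i); case: (b == j).
- move=> a b Ha Hb; rewrite /setcell eqSS; case: ifP => [/andP[/eqP -> /eqP ->] _|_]; last exact: H5.
  by case/andP: HP => P1 P2; apply: reach_trans (H5 _ _ _ _ P1) (H5 _ _ _ _ P2).
Qed.

(** * Greedy assignment at a leaf and its check *)

Definition setreach_cmd (e : expr) :=
  For rj 1 (Cond (cell (rowR e) vj) (Store (acell (Lit 0) vj) (Lit 1)) skip).

Lemma setreach_spec n g s D e c : rep n g s D -> 
  (forall s' D', rep n g s' D' -> s'.1 ri = s.1 ri -> eval e s' = c) ->
  rep n g (run (setreach_cmd e) s) (fun r l => D r l || [&& r == 0, l < n + n & D c.+1 l]).
Proof.
move=> H He; have nn : s.1 1 = n + n by case: H.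
apply: rep_ext (mark_loop (R := 0) (C := id) (P := fun j => D c.+1 j) _ _ nn H _) _ => //.
  move=> j s' D' Hj Ej Fr H' ED; split=> //.
  have Vj : eval vj s' = j by [].
  have Ve : eval e s' = c by apply: He H' _; rewrite Fr.
  by rewrite (cell_val H' (rowR_val Ve) Vj Hj) ED // eqb0.
by move=> r l Hl; rewrite has_eq_iota Hl.
Qed.

(** Row 0 is free for the assignment, as the initial command has moved the input lists into the
    first frame. A vertex goes to the cluster part only if its independent literal implies its
    cluster literal. *)
Definition greedy_cmd :=
  Seq (For rj 1 (Store (acell (Lit 0) vj) (Lit 0)))
  (For ri 0 (Cond (Minus (Lit 1) (Plus (cell (Lit 0) vi) (cell (Lit 0) (il vi))))
    (Cond (cell (rowR (il vi)) vi) (setreach_cmd vi) (setreach_cmd (il vi))) skip)).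

Lemma greedy_spec n g s D T : symmetric g -> rep n g s D ->
  (forall l l', l < n + n -> l' < n + n -> (D l.+1 l' <-> reach (impl n g T) l l')) ->
  exists A : pred nat, [/\ rep n g (run greedy_cmd s) (fun r => if r == 0 then A else D r),
    partial_model n g T A & forall v, v < n -> A v || A (n + v)].
Proof.
move=> gsym H HR; rewrite /greedy_cmd run_seq; set s1 := run _ s.
have H1 : rep n g s1 (fun r => if r == 0 then (xpred0 : pred nat) else D r).
  have nn : s.1 1 = n + n by case: H.
  suff H' : rep n g s1 (fun r l => if (r == 0) && (l < n + n) then false else D r l).
    by apply: rep_ext H' _ => r l Hl; rewrite Hl andbT; case: (r == 0).
  apply: (for_rule (I := fun j s' => rep n g s'
    (fun r l => if (r == 0) && (l < j) then false else D r l))) => //.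
    by apply: rep_setr => //; apply: rep_ext H _ => r l _; rewrite andbF.
  move=> j s2 Hj Ej Fr H2; apply: rep_setr => //.
  have {}Ej : eval vj s2 = j by [].
  apply: rep_ext (store_val H2 (erefl : eval (Lit 0) s2 = 0) Ej Hj (erefl : eval (Lit 0) s2 = false)) _ => r l _.
  by rewrite /setcell ltnS [l <= j]leq_eqVlt; case: (r == 0) => //=; case: (l == j).
have n1 : s1.1 0 = n by case: H1.
apply: (for_rule (I := fun i s' => exists A : pred nat,
  [/\ rep n g s' (fun r => if r == 0 then A else D r),
    partial_model n g T A & forall v, v < i -> A v || A (n + v)])) => //.
  by exists xpred0; split.
move=> i s2 Hi Ei Fr [A [H2 PA At]].
have Vi : eval vi s2 = i by [].
have V0 : eval (Lit 0) s2 = 0 by [].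
have Vn := il_val H2 Vi.
rewrite run_cond eval_minus eval_plus eval_lit (cell_val H2 V0 Vi (ltn_dbl Hi)).
rewrite (cell_val H2 V0 Vn (ltn_dbl2 Hi)) eqxx.
have -> : (1 - (A i + A (n + i)) == 0) = A i || A (n + i) by case: (A i); case: (A (n + i)).
case: ifP => HA.
  exists A; split=> //.
  by move=> v; rewrite ltnS leq_eqVlt => /orP[/eqP ->|/At].
have [nA1 nA2] : ~~ A i /\ ~~ A (n + i) by apply/andP; rewrite -negb_or HA.
rewrite run_cond (cell_val H2 (rowR_val Vn) Vi (ltn_dbl Hi)) (_ : (n + i).+1 == 0 = false) // eqb0 if_neg.
set b := D (n + i).+1 i; set c := if b then i else n + i.
have cl : c < n + n by rewrite /c; case: (b); [apply: ltn_dbl|apply: ltn_dbl2].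
have Hb : b <-> reach (impl n g T) (n + i) i by apply: HR; [apply: ltn_dbl2|apply: ltn_dbl].
pose A' : pred nat := fun l => A l || (l < n + n) && D c.+1 l.
have HA' l : l < n + n -> A' l <-> A l \/ reach (impl n g T) c l.
  move=> Hl; rewrite /A' Hl; split=> [/orP[->|/HR H']|[->//|/HR H']]; [by left|by right; apply: H'|].
  by rewrite H' ?orbT.
exists A'; split.
- apply: rep_setr => //.
  have He1 s' D' : rep n g s' D' -> s'.1 ri = s2.1 ri -> eval vi s' = i by move=> _ E; rewrite eval_var E.
  have He2 s' D' : rep n g s' D' -> s'.1 ri = s2.1 ri -> eval (il vi) s' = n + i.
    by move=> H' E; apply: (il_val H'); rewrite eval_var E.
  rewrite /A' /c; case: (b).
    by apply: rep_ext (setreach_spec H2 He1) _ => r l Hl; case: (r == 0); rewrite //= orbF.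
  by apply: rep_ext (setreach_spec H2 He2) _ => r l Hl; case: (r == 0); rewrite //= orbF.
- exact: (partial_model_add gsym Hi PA nA1 nA2 Hb HA').
- move=> v; rewrite ltnS leq_eqVlt => /orP[/eqP ->|/At]; last first.
    by rewrite /A' => /orP[] ->; rewrite ?orbT.
  have : A' c by apply/HA' => //; right; apply: reach0.
  by rewrite /c; case: (b) => ->; rewrite ?orbT.
Qed.

Definition check_cmd :=
  Seq (Assign rok (Lit 1))
  (For ri 0 (Cond (Minus (Plus (cell (Lit 0) vi) (cell (Lit 0) (il vi))) (Lit 1))
     (Assign rok (Lit 0)) skip)).

Lemma check_spec n g s D : rep n g s D ->
  let s' := run check_cmd s in
  rep n g s' D /\ s'.1 rok = all (fun v => ~~ (D 0 v && D 0 (n + v))) (iota 0 n).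
Proof.
move=> H s'; rewrite /s' /check_cmd run_seq; set s1 := run (Assign _ _) s.
have H1 : rep n g s1 D by apply: rep_setr.
have n1 : s1.1 0 = n by case: H1.
apply: (for_rule (I := fun i s' => rep n g s' D /\
  s'.1 rok = all (fun v => ~~ (D 0 v && D 0 (n + v))) (iota 0 i))) => //.
move=> i s2 Hi Ei Fr [H2 E2].
have Vi : eval vi s2 = i by [].
have V0 : eval (Lit 0) s2 = 0 by [].
rewrite run_cond eval_minus eval_plus eval_lit (cell_val H2 V0 Vi (ltn_dbl Hi)).
rewrite (cell_val H2 V0 (il_val H2 Vi) (ltn_dbl2 Hi)) and_bits if_neg.
have -> : iota 0 i.+1 = iota 0 i ++ [:: i] by rewrite -addn1 iotaD.
rewrite all_cat; case: ifP => HP; split; try by do ?[apply: rep_setr => //].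
  by rewrite [X in _ = nat_of_bool (_ && X)]/= HP andbF.
have -> : all (fun v => ~~ (D 0 v && D 0 (n + v))) [:: i] = true by rewrite /= HP.
by rewrite andbT -E2.
Qed.

(** Success empties the stack, which ends the main loop; failure pops one frame. *)
Definition leaf_cmd :=
  Seq fill_cmd (Seq warshall_cmd (Seq greedy_cmd (Seq check_cmd
  (Cond (Var rok) (Seq (Assign rfound (Lit 1)) (Assign rsp (Lit 0)))
     (Assign rsp (Minus (Var rsp) (Lit 1))))))).

(** Consistency of the implications is never tested directly. A total assignment without a clash is
    a solution in any case, and in a solvable instance the implications are consistent and the
    greedy assignment has no clash; so a clash refutes the leaf. *)
Lemma leaf_spec n g s D k T : symmetric g -> irreflexive g -> rep n g s D ->
  s.1 rsp = k.+1 -> s.1 rfound = 0 -> D (n + n + k.+1) = T -> propagated n g T ->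
  (forall v, v < n -> und n T v -> deg n g (und n T) v <= 2) ->
  let s' := run leaf_cmd s in
  exists D', [/\ rep n g s' D', forall r l, n + n < r -> D' r l = D r l
    & [/\ s'.1 rfound = 1, s'.1 rsp = 0, sol n g (D' 0), respects n T (D' 0)
         & forall v, v < n -> D' 0 (n + v) = ~~ D' 0 v] \/
      [/\ s'.1 rfound = 0, s'.1 rsp = k & forall f, sol n g f -> ~ respects n T f]].
Proof.
move=> gsym girr H Hk Hf ET Tc Td s'; rewrite /s' /leaf_cmd 4!run_seq.
have H1 := fill_spec gsym girr H Hk isT; rewrite ET in H1.
have Hk1 : (run fill_cmd s).1 rsp = k.+1 by rewrite run_frame.
have Hf1 : (run fill_cmd s).1 rfound = 0 by rewrite run_frame.
move: (run fill_cmd s) H1 Hk1 Hf1 => s1 H1 Hk1 Hf1.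
have [|D2 [H2 O2 R2]] := @warshall_spec n g s1 _ T H1.
  by move=> l l' Hl _ /=; rewrite Hl.
have Hk2 : (run warshall_cmd s1).1 rsp = k.+1 by rewrite run_frame.
have Hf2 : (run warshall_cmd s1).1 rfound = 0 by rewrite run_frame.
move: (run warshall_cmd s1) H2 Hk2 Hf2 => s2 H2 Hk2 Hf2.
have [A [H3 PA At]] := greedy_spec gsym H2 R2.
have Hk3 : (run greedy_cmd s2).1 rsp = k.+1 by rewrite run_frame.
have Hf3 : (run greedy_cmd s2).1 rfound = 0 by rewrite run_frame.
move: (run greedy_cmd s2) H3 Hk3 Hf3 => s3 H3 Hk3 Hf3.
have [H4 E4] := check_spec H3.
have Hk4 : (run check_cmd s3).1 rsp = k.+1 by rewrite run_frame.
have Hf4 : (run check_cmd s3).1 rfound = 0 by rewrite run_frame.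
move: (run check_cmd s3) H4 E4 Hk4 Hf4 => s4 H4 E4 Hk4 Hf4.
exists (fun r => if r == 0 then A else D2 r); split.
- by rewrite run_cond; case: ifP => _; do ?[apply: rep_setr => //].
- move=> r l Hr; have -> : (r == 0) = false by clear -Hr; lia.
  rewrite O2; last by clear -Hr; lia.
  by have -> : (0 < r <= n + n) = false by clear -Hr; lia.
rewrite eqxx in E4 *; rewrite run_cond eval_var E4 eqb0 if_neg; case: ifP => HA.
  have Ac v : v < n -> ~~ (A v && A (n + v)).
    by move=> Hv; move/allP: HA; apply; rewrite mem_iota.
  left; have [S1 R1] := total_model_sol gsym girr Tc Td PA At Ac.
  split=> // v Hv.
  by move: (At v Hv) (Ac v Hv); case: (A v); case: (A (n + v)).
right; split=> //; first by rewrite [LHS]/= Hk4 subn1.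
move=> f Sf Rf; case: PA => _ _ /(_ (sol_consistent Sf Rf)) PN.
by move/negP: HA; apply; apply/allP => v; rewrite mem_iota => Hv; apply: PN.
Qed.

(** * Effect of propagation and branching on partial labellings *)

Section Propagation.
Variables (n : nat) (g : rel nat).

Lemma clI T v : cl n g T (n + v) = T (n + v).
Proof. by rewrite /cl ltnNge leq_addr /= orbF. Qed.

Lemma cl_propagated T : propagated n g (cl n g T).
Proof.
move=> u v Hu Hv guv; rewrite clI => Tu; rewrite /cl Hv; apply/orP; right.
by apply/hasP; exists u; rewrite ?mem_iota ?guv.
Qed.

Lemma respects_cl T f : sol n g f -> (respects n (cl n g T) f <-> respects n T f).
Proof.
move=> [S1 _]; split=> R v Hv; have [R1 R2] := R v Hv; split=> Tv.
- by apply: R1; rewrite /cl Tv.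
- by apply: R2; rewrite clI.
- move: Tv; rewrite /cl Hv => /orP[/R1 //|/hasP[u]]; rewrite mem_iota => Hu /andP[guv Tu].
  have [_ /(_ Tu) nfu] := R u Hu; have := S1 u v Hu Hv guv.
  by rewrite (negbTE nfu).
- by apply: R2; rewrite -clI.
Qed.

Definition addlit (T : pred nat) (l : nat) : pred nat := fun l' => T l' || (l' == l).

Lemma respects_add T f v : v < n -> respects n T f ->
  respects n (addlit T v) f \/ respects n (addlit T (n + v)) f.
Proof.
move=> Hv R; have nv u : (n + u == v) = false by clear -Hv; lia.
have vn u : u < n -> (u == n + v) = false by clear; lia.
case fv : (f v); [left|right] => u Hu; have [R1 R2] := R u Hu.
  by rewrite /addlit nv orbF; split=> // /orP[/R1 //|/eqP ->].
by rewrite /addlit (vn u Hu) orbF eqn_add2l; split=> // /orP[/R2 //|/eqP ->]; rewrite fv.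
Qed.

Lemma respects_addW T f l : respects n (addlit T l) f -> respects n T f.
Proof. by move=> R v Hv; have [R1 R2] := R v Hv; split=> H; [apply: R1|apply: R2]; rewrite /addlit H. Qed.

(** A new cluster literal forces nothing, and the old independent literals have been propagated
    before, so [v] alone becomes decided. *)
Lemma und_addC T v : propagated n g T -> v < n ->
  forall u, u < n -> und n (cl n g (addlit T v)) u = und n T u && (u != v).
Proof.
move=> P Hv u Hu; rewrite /und clI /addlit.
have nv w : (n + w == v) = false by clear -Hv; lia.
rewrite nv orbF /cl Hu /addlit.
rewrite (_ : has _ _ = has (fun w => g w u && T (n + w)) (iota 0 n)); last first.
  by apply: eq_has => w; rewrite nv orbF.
have [Tu|nTu] := boolP (T u); first by [].
rewrite (_ : has _ _ = false); first by case: (u == v); rewrite ?andbF ?andbT.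
apply/hasP => -[w]; rewrite mem_iota => Hw /andP[gw Tw].
by case/negP: nTu; apply: P gw Tw.
Qed.

Lemma und_addI T v : propagated n g T -> v < n ->
  forall u, u < n -> und n (cl n g (addlit T (n + v))) u = [&& und n T u, u != v & ~~ g v u].
Proof.
move=> P Hv u Hu; rewrite /und clI /addlit eqn_add2l.
have vn : (u == n + v) = false by clear -Hu; lia.
rewrite /cl Hu /addlit vn orbF.
have [Tu|nTu] := boolP (T u); first by [].
have -> : has (fun w => g w u && (T (n + w) || (n + w == n + v))) (iota 0 n) = g v u.
  apply/hasP/idP => [[w]|gvu]; last by exists v; rewrite ?mem_iota // gvu eqxx orbT.
  rewrite mem_iota eqn_add2l => Hw /andP[gw /orP[Tw|/eqP <- //]].
  by case/negP: nTu; apply: P gw Tw.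
by rewrite /= negb_or; case: (g v u); case: (T _); case: (u == v).
Qed.

End Propagation.

(** * The search loop and its number of rounds *)

Definition body_cmd :=
  Seq close_cmd (Seq degree_cmd (Cond (Minus (Var rbest) (Lit 2)) branch_cmd leaf_cmd)).

(** The induction for the search runs on this count, which drops strictly in both branches; [mu]
    serves to count the rounds. *)
Definition ucount n (U : pred nat) := \sum_(v < n) U v.

Lemma ucount_lt n (U U' : pred nat) v : v < n -> U v -> ~~ U' v ->
  (forall u, u < n -> U' u -> U u) -> ucount n U' < ucount n U.
Proof.
move=> Hv Uv nU' H; rewrite /ucount (bigD1 (Ordinal Hv)) //= [X in _ < X](bigD1 (Ordinal Hv)) //=.
rewrite Uv (negbTE nU') add0n add1n ltnS; apply: leq_sum => u _.
by case E : (U' u) => //; rewrite H.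
Qed.

Lemma yb_pow_ge1 k : (1 <= yb ^+ k)%R.
Proof. by apply: exprn_ege1; apply: yb_ge1. Qed.

Definition solved n g (s : store) (T : pred nat) (D : nat -> nat -> bool) :=
  [/\ s.1 rfound = 1, s.1 rsp = 0, sol n g (D 0), respects n T (D 0)
    & forall v, v < n -> D 0 (n + v) = ~~ D 0 v].

(** The last clause covers exactly the frames that remain on the stack, so the search can resume
    with them. Row 0 and the implication matrix may have been overwritten. *)
Definition refuted n g (s : store) k (T : pred nat) (D D' : nat -> nat -> bool) :=
  [/\ s.1 rfound = 0, s.1 rsp = k, forall f, sol n g f -> ~ respects n T f
    & forall r l, n + n < r <= n + n + k -> l < n + n -> D' r l = D r l].

(* The branch [v] in the independent part is pushed on top and processed first. *)
Lemma search n g m s D k T : symmetric g -> irreflexive g -> rep n g s D ->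
  s.1 rsp = k.+1 -> s.1 rfound = 0 -> (forall l, l < n + n -> D (n + n + k.+1) l = T l) ->
  ucount n (und n (cl n g T)) < m ->
  exists N s' D', [/\ loop body_cmd s N s',
    ((N.+1)%:R <= 2 * yb ^+ mu n g (und n (cl n g T)))%R,
    rep n g s' D' & solved n g s' T D' \/ refuted n g s' k T D D'].
Proof.
move=> gsym girr; elim: m s D k T => // m IH s D k T H Hk Hf HT Hm.
set t := n + n + k.+1 in HT *; set T' := cl n g T in Hm *; set U := und n T' in Hm *.
have Pr : propagated n g T' := @cl_propagated n g T.
have H0 : rep n g s (fun r => if r == t then T else D r).
  by apply: rep_ext H _ => r l Hl; case: eqP => // ->; rewrite HT.
pose D1 r := if r == t then T' else D r.
have H1 : rep n g (run close_cmd s) D1.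
  by apply: rep_ext (close_spec H0 Hk) _ => r l Hl; rewrite -/t eqxx /D1; case: (r == t).
have Hk1 : (run close_cmd s).1 rsp = k.+1 by rewrite run_frame.
have Hf1 : (run close_cmd s).1 rfound = 0 by rewrite run_frame.
have D1t : D1 t = T' by rewrite /D1 eqxx.
have [H2 B2 C2] := degree_spec H1 Hk1.
rewrite -/t D1t -/U in B2 C2.
have bodyE : run body_cmd s = run (Cond (Minus (Var rbest) (Lit 2)) branch_cmd leaf_cmd)
  (run degree_cmd (run close_cmd s)) by [].
have Hk2 : (run degree_cmd (run close_cmd s)).1 rsp = k.+1 by rewrite run_frame.
have Hf2 : (run degree_cmd (run close_cmd s)).1 rfound = 0 by rewrite run_frame.
move: (run degree_cmd (run close_cmd s)) H2 B2 C2 bodyE Hk2 Hf2 => s2 H2 B2 C2 bodyE Hk2 Hf2.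
have sp0 : s.1 rsp != 0 by rewrite Hk.
rewrite run_cond eval_minus eval_var eval_lit in bodyE.
case: ifP bodyE => Hbest bodyE.
  have Td v : v < n -> und n T' v -> deg n g (und n T') v <= 2.
    by move=> Hv Uv; have := B2 v Hv Uv; rewrite -/U; move: Hbest; rewrite subn_eq0; clear; lia.
  have [D3 [H3 O3 R3]] := leaf_spec gsym girr H2 Hk2 Hf2 D1t Pr Td.
  (* A leaf takes one round, and [2 <= 2 * y ^ mu]. *)
  exists 1, (run body_cmd s), D3; rewrite bodyE; split=> //.
  - by rewrite -bodyE; apply: loopS => //; apply: loop0.
  - by have := yb_pow_ge1 (mu n g U); move: (yb ^+ _)%R; clear=> y; lra.
  - case: R3 => [[F1 F2 F3 F4 F5]|[F1 F2 F3]]; [left|right]; split=> //.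
    + exact: (respects_cl T F3).1 F4.
    + by move=> f Sf Rf; apply: (F3 f Sf); apply: (respects_cl T Sf).2 Rf.
    + move=> r l /andP[Hr1 Hr2] _; rewrite O3 // /D1.
      by have -> : (r == t) = false by rewrite /t; clear -Hr2; lia.
have b0 : 0 < s2.1 rbest by clear -Hbest; lia.
have b3 : 3 <= s2.1 rbest by clear -Hbest; lia.
have [vn Uv dv] := C2 b0; set v := s2.1 rbv in vn Uv dv.
have [Hk3 H3] := branch_spec H2 Hk2 (erefl : s2.1 rbv = v) vn.
rewrite -/t in H3; rewrite -bodyE in H3 Hk3.
pose T1 := addlit T' v; pose T2 := addlit T' (n + v).
pose D3 r := if r == t then T1 else if r == t.+1 then T2 else D r.
have {}H3 : rep n g (run body_cmd s) D3.
  apply: rep_ext H3 _ => r l _; rewrite /D3 D1t /D1.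
  by case: (r == t) => //; case: (r == t.+1).
have Hf3 : (run body_cmd s).1 rfound = 0 by rewrite bodyE run_frame.
pose U1 := und n (cl n g T1); pose U2 := und n (cl n g T2).
have U1E : forall u, u < n -> U1 u = U u && (u != v) := und_addC Pr vn.
have U2E : forall u, u < n -> U2 u = [&& U u, u != v & ~~ g v u] := und_addI Pr vn.
have dm u : u < n -> U u -> deg n g U u <= deg n g U v by move=> Hu Uu; rewrite dv; apply: B2.
have d3 : 3 <= deg n g U v by rewrite dv.
have M := mu_branch gsym girr vn Uv d3 dm U1E U2E.
have c1 : ucount n U1 < m.
  rewrite ltnS in Hm; apply: leq_trans Hm.
  by apply: (ucount_lt vn Uv) => [|u Hu]; rewrite U1E // ?eqxx ?andbF // => /andP[].
have c2 : ucount n U2 < m.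
  rewrite ltnS in Hm; apply: leq_trans Hm.
  by apply: (ucount_lt vn Uv) => [|u Hu]; rewrite U2E // ?eqxx ?andbF // => /and3P[].
have tS : n + n + k.+2 = t.+1 by rewrite /t -addnS.
have D3S l : l < n + n -> D3 (n + n + k.+2) l = T2 l.
  by move=> _; rewrite tS /D3 (_ : t.+1 == t = false) ?eqxx //; clear; lia.
have [N1 [s4 [D4 [L4 M4 H4 R4]]]] := IH _ D3 k.+1 T2 H3 Hk3 Hf3 D3S c2.
have y1 := yb_pow_ge1 (mu n g U1); have y2 := yb_pow_ge1 (mu n g U2).
have back f : sol n g f -> respects n T1 f \/ respects n T2 f -> respects n T f.
  by move=> Sf [] /respects_addW R; apply: (respects_cl T Sf).1 R.
case: R4 => [[F1 F2 F3 F4 F5]|[F1 F2 F3 F4]].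
  exists N1.+1, s4, D4; split=> //; first exact: loopS.
    (* After an early success the round of this node is paid for by the share of the cluster branch,
       which was not entered and is at least 2. *)
    rewrite -natr1; move: M M4 y1 y2; rewrite -/U2.
    move: (yb ^+ mu n g U)%R (yb ^+ mu n g U1)%R (yb ^+ mu n g U2)%R (N1.+1%:R)%R; clear=> a b c d; lra.
  by left; split=> //; apply: back => //; right.
(* The refuted independent branch has left the frame of the cluster branch untouched. *)
have D4t l : l < n + n -> D4 (n + n + k.+1) l = T1 l.
  move=> Hl; rewrite F4 //; first by rewrite -/t /D3 eqxx.
  by clear; lia.
have [N2 [s5 [D5 [L5 M5 H5 R5]]]] := IH s4 D4 k T1 H4 F2 F1 D4t c1.
exists (N1 + N2).+1, s5, D5; split=> //.
- by apply: loopS => //; apply: loop_trans L4 L5.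
(* Bounding [N.+1] instead of [N] makes the bounds of the two subtrees add up, with the round of
   this node included. *)
- have -> : (N1 + N2).+2 = N1.+1 + N2.+1 by rewrite addSn addnS.
  rewrite natrD; move: M M4 M5 y1 y2; rewrite -/U1 -/U2.
  move: (yb ^+ mu n g U)%R (yb ^+ mu n g U1)%R (yb ^+ mu n g U2)%R (N1.+1%:R)%R (N2.+1%:R)%R; clear=> a b c d e; lra.
case: R5 => [[E1 E2 E3 E4 E5]|[E1 E2 E3 E4]]; [left|right].
  by split=> //; apply: back => //; left.
split=> //.
- move=> f Sf Rf; have [R1|R2] := respects_add vn ((respects_cl T Sf).2 Rf).
    exact: E3 Sf R1.
  exact: F3 Sf R2.
- move=> r l Hr Hl; rewrite E4 // F4 //; last by clear -Hr; lia.
  rewrite /D3; have -> : (r == t) = false by rewrite /t; clear -Hr; lia.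
  by have -> : (r == t.+1) = false by rewrite /t; clear -Hr; lia.
Qed.

(** * Input, output and the main theorem *)

Definition size_cmd := Assign 0 (Fetch (Lit 0)).

(** A sum is not [flat] and cannot be assigned, so [n + n] is counted up. *)
Definition double_cmd := For ri 0 (Seq (Incr 1) (Incr 1)).

Definition row1 := Plus (Var 1) (Lit 1).

Definition ext_init_cmd :=
  Seq (For rj 1 (Store (acell row1 vj) (cell (Lit 0) vj))) (Assign rsp (Lit 1)).

(** A vertex is forced into one part when the label of the other part is missing from its list;
    hence the two halves are exchanged and negated. *)
Definition list_init_cmd :=
  Seq (For rj 0 (Seq (Store (acell row1 vj) (Minus (Lit 1) (cell (Lit 0) (il vj))))
                     (Store (acell row1 (il vj)) (Minus (Lit 1) (cell (Lit 0) vj)))))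
      (Assign rsp (Lit 1)).

(** The answer is moved down over the adjacency matrix. Entry [l] is read at address
    [1 + n * n + l], when only addresses up to [l] have been written, so nothing is lost. *)
Definition fin_cmd :=
  Cond (Var rfound)
    (Seq (Store (Lit 0) (Lit 1)) (For rj 1 (Store (Plus (Lit 1) vj) (cell (Lit 0) vj))))
    (Store (Lit 0) (Lit 0)).

Definition search_phases init := Phases size_cmd double_cmd init body_cmd fin_cmd.

Lemma double_spec n m : let s := run double_cmd (upd (fun=> 0) 0 n, m) in
  [/\ s.1 0 = n, s.1 1 = n + n, s.1 rfound = 0 & s.2 = m].
Proof.
move=> s.
suff [E1 E2] : s.1 1 = n + n /\ s.2 = m by split=> //; rewrite run_frame.
rewrite /s; apply: (for_rule (k := n) (I := fun j s' => s'.1 1 = j + j /\ s'.2 = m)) => //.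
move=> j s' Hj Ej Fr [E1 E2]; split=> //=.
by rewrite /upd /= E1 addSn addnS.
Qed.

Lemma ext_init_spec n g s D : rep n g s D ->
  let s' := run ext_init_cmd s in
  s'.1 rsp = 1 /\ exists2 D', rep n g s' D' & forall l, l < n + n -> D' (n + n + 1) l = D 0 l.
Proof.
move=> H s'; split=> //; have nn : s.1 1 = n + n by case: H.
exists (fun r l => if (r == n + n + 1) && (l < n + n) then D 0 l else D r l); last first.
  by move=> l Hl; rewrite eqxx Hl.
rewrite /s' /ext_init_cmd run_seq; apply: (@rep_setr n g _ _ rsp 1) => //.
apply: (for_rule (I := fun j s' => rep n g s'
  (fun r l => if (r == n + n + 1) && (l < j) then D 0 l else D r l))) => //.
  by apply: rep_setr => //; apply: rep_ext H _ => r l _; rewrite andbF.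
move=> j s2 Hj Ej Fr H2; apply: rep_setr => //.
have {}Ej : eval vj s2 = j by [].
have E1 : eval row1 s2 = n + n + 1 by rewrite /row1 !evalE; case: H2 => _ ->.
have Ec := cell_val H2 (erefl : eval (Lit 0) s2 = 0) Ej Hj.
rewrite (_ : 0 == n + n + 1 = false) ?andFb in Ec; last by clear; lia.
apply: rep_ext (store_val H2 E1 Ej Hj Ec) _ => r l _.
rewrite /setcell ltnS [l <= j]leq_eqVlt.
by case: (r == n + n + 1) => //=; case: (l =P j) => [->|_] //=.
Qed.

Lemma list_init_spec n g s D : rep n g s D ->
  let s' := run list_init_cmd s in
  s'.1 rsp = 1 /\ exists2 D', rep n g s' D' &
    forall l, l < n + n -> D' (n + n + 1) l = ~~ D 0 (lneg n l).
Proof.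
move=> H s'; split=> //; have n0 : s.1 0 = n by case: H.
have vxlt l : l < n + n -> vx n l < n by rewrite /vx; case: (ltnP l n) => //; clear; lia.
exists (fun r l => if (r == n + n + 1) && (vx n l < n) then ~~ D 0 (lneg n l) else D r l); last first.
  by move=> l Hl; rewrite eqxx vxlt.
rewrite /s' /list_init_cmd run_seq; apply: (@rep_setr n g _ _ rsp 1) => //.
apply: (for_rule (I := fun j s' => rep n g s'
  (fun r l => if (r == n + n + 1) && (vx n l < j) then ~~ D 0 (lneg n l) else D r l))) => //.
  by apply: rep_setr => //; apply: rep_ext H _ => r l _; rewrite andbF.
move=> j s2 Hj Ej Fr H2; apply: rep_setr => //; rewrite run_seq.
have r1 : (0 == n + n + 1) = false by clear; lia.
have Vj : eval vj s2 = j by [].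
have E1 : eval row1 s2 = n + n + 1 by rewrite /row1 !evalE; case: H2 => _ ->.
have Ec : eval (Minus (Lit 1) (cell (Lit 0) (il vj))) s2 = ~~ D 0 (n + j).
  rewrite eval_minus (cell_val H2 (erefl : eval (Lit 0) s2 = 0) (il_val H2 Vj) (ltn_dbl2 Hj)) r1.
  by case: (D 0 (n + j)).
have H3 := store_val H2 E1 Vj (ltn_dbl Hj) Ec; set s3 := run (Store _ _) s2 in H3 *.
have Vj3 : eval vj s3 = j by [].
have E3 : eval row1 s3 = n + n + 1 by [].
have Ec3 : eval (Minus (Lit 1) (cell (Lit 0) vj)) s3 = ~~ D 0 j.
  rewrite eval_minus (cell_val H3 (erefl : eval (Lit 0) s3 = 0) Vj3 (ltn_dbl Hj)) /setcell r1.
  by case: (D 0 j).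
apply: rep_ext (store_val H3 E3 (il_val H3 Vj3) (ltn_dbl2 Hj) Ec3) _ => r l Hl.
rewrite /setcell; case: (r == n + n + 1) => //=; rewrite ltnS.
have [->|nl1] := eqVneq l (n + j).
  by rewrite /vx /lneg (_ : n + j < n = false) ?addKn ?leqnn //; clear; lia.
have [->|nl2] := eqVneq l j; first by rewrite /vx /lneg Hj leqnn.
rewrite [vx n l <= j]leq_eqVlt (_ : vx n l == j = false) //.
by rewrite /vx; case: (ltnP l n) => Hln; clear -Hln nl1 nl2; lia.
Qed.

Lemma fin_found n g s D : rep n g s D -> s.1 rfound = 1 ->
  let s' := run fin_cmd s in
  s'.2 0 = 1 /\ forall l, l < n + n -> s'.2 l.+1 = D 0 l.
Proof.
move=> [n0 nn Hg HD] Hf s'; rewrite /s' /fin_cmd run_cond eval_var Hf (_ : 1 == 0 = false) // run_seq.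
set s1 := run (Store (Lit 0) (Lit 1)) s; have nn1 : s1.1 1 = n + n by [].
pose I j (t : store) := [/\ t.1 0 = n, t.1 1 = n + n, t.2 0 = 1, forall l, l < j -> l < n + n -> t.2 l.+1 = D 0 l
  & forall l, j <= l < n + n -> t.2 (1 + n * n + l) = D 0 l].
suff [_ _ E1 E2 _] : I (n + n) (run (For rj 1 (Store (Plus (Lit 1) vj) (cell (Lit 0) vj))) s1).
  by split=> // l Hl; apply: E2.
apply: (for_rule (I := I)) => //.
  split=> // l /andP[_ Hl]; rewrite [LHS]upd_neq //.
  by have := HD 0 l Hl; rewrite /addr mul0n addn0.
move=> j s2 Hj Ej Fr [F1 F2 F3 F4 F5].
have Ec : eval (cell (Lit 0) vj) s2 = D 0 j.
  by rewrite /cell /acell /= F1 Ej mul0n addn0; apply: F5; rewrite leqnn.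
set s3 := setr _ _ _; have E3 : s3.2 = upd s2.2 j.+1 (D 0 j) by rewrite -Ec /s3 /= Ej.
split; rewrite ?E3 //.
- by move=> l; rewrite ltnS leq_eqVlt /upd eqSS; case: eqP => [->//|_] /= Hl; apply: F4.
- move=> l Hl; rewrite upd_neq; last by clear -Hl; lia.
  by apply: F5; clear -Hl; lia.
Qed.

Lemma fin_none s : s.1 rfound = 0 -> (run fin_cmd s).2 0 = 0.
Proof. by move=> Hf; rewrite /fin_cmd run_cond eval_var Hf /= upd_eq. Qed.

(** * Layout of the input and the common search theorem *)

Lemma nth_bits n (p : pred 'I_n) (v : 'I_n) : nth 0 (bits p) v = p v.
Proof. by rewrite (nth_map v) ?size_enum_ord // nth_ord_enum. Qed.

Lemma size_bits n (p : pred 'I_n) : size (bits p) = n.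
Proof. by rewrite size_map size_enum_ord. Qed.

Lemma bits_le1 n (p : pred 'I_n) x : x \in bits p -> x <= 1.
Proof. by move=> /mapP[v _ ->]; case: (p v). Qed.

Lemma nth_flatten_rows n (ss : seq (seq nat)) u v : all (fun s => size s == n) ss ->
  u < size ss -> v < n -> nth 0 (flatten ss) (u * n + v) = nth 0 (nth [::] ss u) v.
Proof.
elim: ss u => // s ss IH [|u] /= /andP[/eqP Es Hss] Hu Hv; rewrite nth_cat Es.
  by rewrite mul0n add0n Hv.
by rewrite mulSn -addnA ltnNge leq_addr /= addKn IH.
Qed.

Lemma size_flatten_rows n (ss : seq (seq nat)) : all (fun s => size s == n) ss ->
  size (flatten ss) = size ss * n.
Proof. by elim: ss => //= s ss IH /andP[/eqP Es /IH E]; rewrite size_cat Es E mulSn. Qed.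

Section Input.
Variables (n : nat) (G : sgraph 'I_n) (p q : pred 'I_n).

Let w := graph_code G ++ (bits p ++ bits q).

Let rows := [seq bits (G u) | u <- enum 'I_n].

Let rows_size : all (fun s => size s == n) rows.
Proof. by apply/allP => s /mapP[u _ ->]; rewrite size_bits. Qed.

Let size_rows : size rows = n. Proof. by rewrite size_map size_enum_ord. Qed.

Let size_graph_code : size (graph_code G) = 1 + n * n.
Proof. by rewrite /= (size_flatten_rows rows_size) size_rows. Qed.

Lemma input_adj (u v : nat) : u < n -> v < n -> nth 0 w (1 + u * n + v) = adjn G u v.
Proof.
move=> Hu Hv; have lt : 1 + u * n + v < size (graph_code G).
  by rewrite size_graph_code -addnA ltn_add2l; clear -Hu Hv; nia.
rewrite nth_cat lt /graph_code add1n addSn [nth _ (_ :: _) _]/= nth_flatten_rows ?size_rows //.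
rewrite /rows (nth_map (Ordinal Hu)) ?size_enum_ord // -[u]/(val (Ordinal Hu)) nth_ord_enum.
by rewrite -[v]/(val (Ordinal Hv)) nth_bits adjnE.
Qed.

(** The summand 3 lets the same bound dominate the literals, which are at most [Kmax]. *)
Lemma input_bound a : nth 0 w a <= n + 3.
Proof.
have [Ha|Ha] := ltnP a (size w); last by rewrite nth_default.
have : nth 0 w a \in w by apply: mem_nth.
move: (nth 0 w a) => x; rewrite mem_cat mem_cat inE -orbA.
case/or4P => [/eqP ->|/flattenP[s /mapP[u _ ->]]|/bits_le1|/bits_le1]; first by rewrite leq_addr.
- by move=> /bits_le1; clear; lia.
- by clear; lia.
- by clear; lia.
Qed.

(** Cells behind the input are 0, so all rows consist of bits from the start, including those not
    yet in use, as [rep] requires. *)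
Lemma input_bit i l : nth 0 w (addr n i l) <= 1.
Proof.
rewrite nth_cat size_graph_code ltnNge (_ : 1 + n * n <= _) /=; last by rewrite /addr -addnA leq_addr.
set a := _ - _; have [Ha|Ha] := ltnP a (size (bits p ++ bits q)); last by rewrite nth_default.
by have := mem_nth 0 Ha; rewrite mem_cat => /orP[] /bits_le1.
Qed.

Lemma input_lists (v : 'I_n) :
  nth 0 w (addr n 0 v) = p v /\ nth 0 w (addr n 0 (n + v)) = q v.
Proof.
have E l : nth 0 w (addr n 0 l) = nth 0 (bits p ++ bits q) l.
  by rewrite /w [LHS]nth_cat size_graph_code /addr mul0n addn0 ltnNge leq_addr addKn.
rewrite !E !nth_cat size_bits ltn_ord [_ + v < n]ltnNge leq_addr addKn.
by rewrite !nth_bits.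
Qed.

(** [F] says how the two bit vectors of the input become forced labels. It and the command [init]
    computing it are all that distinguishes the two problems. *)
Lemma search_program init (F : pred nat -> pred nat) :
  wf_phases (search_phases init) -> rfound \notin writes init ->
  (forall s D, rep n (adjn G) s D -> (run init s).1 rsp = 1 /\
     exists2 D', rep n (adjn G) (run init s) D' & forall l, l < n + n -> D' (n + n + 1) l = F (D 0) l) ->
  let T := F (fun l => nth 0 w (addr n 0 l) != 0) in
  exists t s, [/\ runs (assemble (search_phases init)) (Defs.init w) t s,
    t <= time_bound (search_phases init) n
    & (exists A : pred nat, [/\ sol n (adjn G) A, respects n T A, forall v, v < n -> A (n + v) = ~~ A v,
         Defs.mem s 0 = 1 & forall l, l < n + n -> Defs.mem s l.+1 = A l])
      \/ ((forall f, sol n (adjn G) f -> ~ respects n T f) /\ Defs.mem s 0 = 0)].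
Proof.
move=> wf nf Hinit T.
have [E0 E1 Ef Em] := double_spec n (nth 0 w).
set s2 := run double_cmd _ in E0 E1 Ef Em.
pose D r l := nth 0 w (addr n r l) != 0.
have H2 : rep n (adjn G) s2 D.
  split=> //; first by move=> u v Hu Hv; rewrite Em input_adj.
  move=> i l _; rewrite Em /D; move: (input_bit i l).
  by case: (nth 0 w _) => [|[|]].
have [Hk [D3 H3 HT]] := Hinit s2 D H2.
have Hf3 : (run init s2).1 rfound = 0 by rewrite run_frame.
have [N [s4 [D4 [L M H4 R]]]] := search (@adjn_sym n G) (@adjn_irr n G) H3 Hk Hf3 HT (leqnn _).
have HN : N <= iter_bound n.
  rewrite /iter_bound leq_divRL ?expn_gt0 // -(ler_nat rat) !natrM !natrX -ler_pdivlMr; last first.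
    by apply: exprn_gt0; rewrite ltr0n.
  rewrite -mulrA -expr_div_n -/yb; apply: (@Order.POrderTheory.le_trans _ _ (N.+1)%:R%R).
    by rewrite ler_nat.
  apply: Order.POrderTheory.le_trans M _; apply: ler_wpM2l; first exact: ler0n.
  by apply: ler_weXn2l; [apply: yb_ge1|apply: mu_le].
have sp4 : s4.1 rsp = 0 by case: R => [[]|[]].
have [t [s [Hr Ht Hm]]] := @assemble_time (search_phases init) n w N s4 wf input_bound E0 E1 L sp4 HN.
exists t, s; split=> //; rewrite Hm; case: R => [[F1 F2 F3 F4 F5]|[F1 F2 F3 F4]]; [left|right].
  by have [G1 G2] := fin_found H4 F1; exists (D4 0); split.
by split=> //; apply: fin_none.
Qed.

End Input.

Definition indicator n (C : {set 'I_n}) : pred nat :=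
  fun u => if (insub u : option 'I_n) is Some v then v \in C else false.

Lemma indicatorE n (C : {set 'I_n}) (v : 'I_n) : indicator C v = (v \in C).
Proof. by rewrite /indicator valK. Qed.

Theorem theorem2 :
  (exists (P : program) (T : nat -> nat),
     Ostar_exp 1.3734%Q T /\
     forall (n : nat) (G : sgraph 'I_n) (C' I' : {set 'I_n}),
       solves P (T n) (extension_code G C' I')
         (monopolar_extension G C' I') (@partition_code n))
  /\
  (exists (P : program) (T : nat -> nat),
     Ostar_exp 1.3734%Q T /\
     forall (n : nat) (G : sgraph 'I_n) (L : 'I_n -> {set label}),
       (forall v : 'I_n, L v != set0) ->
       solves P (T n) (list_code G L)
         (respecting_partition G L) (@labelling_code n)).
Proof.
split.
- exists (assemble (search_phases ext_init_cmd)), (time_bound (search_phases ext_init_cmd)).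
  split; first exact: time_bound_Ostar.
  move=> n G C' I'; set p := fun v => v \in C'; set q := fun v => v \in I'.
  have [//|//|s D|t [s [Hr Ht R]]] := @search_program n G p q ext_init_cmd id.
    exact: ext_init_spec.
  exists t, s; split=> //.
  have TC (v : 'I_n) : (nth 0 (graph_code G ++ bits p ++ bits q) (addr n 0 v) != 0) = (v \in C').
    by rewrite (input_lists G p q v).1 eqb0 negbK.
  have TI (v : 'I_n) : (nth 0 (graph_code G ++ bits p ++ bits q) (addr n 0 (n + v)) != 0) = (v \in I').
    by rewrite (input_lists G p q v).2 eqb0 negbK.
  case: R => [[A [SA RA nA M0 MA]]|[Hno M0]]; [left|right].
    pose C := [set v : 'I_n | A v].
    have AC v : A (nat_of_ord v) = (v \in C) by rewrite inE.
    have [cl1 ind1] := (sol_partition G AC).1 SA.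
    exists (C, ~: C).
      split; first split=> //=.
      + by rewrite setUCr.
      + by rewrite -setI_eq0 setICr.
      + apply/subsetP => v Hv; rewrite inE; apply: (RA v (ltn_ord v)).1.
        exact: etrans (TC v) Hv.
      + apply/subsetP => v Hv; rewrite !inE; apply: (RA v (ltn_ord v)).2.
        exact: etrans (TI v) Hv.
    (* Row 0 already has the format of the output: the cluster bits, followed by their complements
       in the second half. *)
    move=> [|l] //=; rewrite /partition_code size_cat !size_bits ltnS => Hl.
    rewrite MA // nth_cat size_bits; case: ltnP => Hln.
      by rewrite -[l]/(val (Ordinal Hln)) nth_bits AC.
    have Hl' : l - n < n by clear -Hl Hln; lia.
    rewrite -[l - n]/(val (Ordinal Hl')) nth_bits /= inE -AC /= -nA //.
    by rewrite subnKC.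
  split; last by case=> [|i] //=; rewrite M0.
  move=> [C I] [[/= UCI dCI clC indI] CC II]; apply: (Hno (indicator C)).
    apply/(sol_partition G (C := C)); first exact: indicatorE.
    split=> //; have -> : ~: C = I; last by [].
    apply/setP => v; rewrite !inE; have := in_setT v; rewrite -UCI inE.
    have := disjointFr dCI (x := v); case: (v \in C) => [/(_ isT) -> //|_ /= ->].
    by [].
  move=> u Hu; rewrite -[u]/(val (Ordinal Hu)) indicatorE.
  split=> H; first exact: (subsetP CC) _ (etrans (esym (TC (Ordinal Hu))) H).
  have HI := (subsetP II) _ (etrans (esym (TI (Ordinal Hu))) H).
  by rewrite (disjointFl dCI HI).
- exists (assemble (search_phases list_init_cmd)), (time_bound (search_phases list_init_cmd)).
  split; first exact: time_bound_Ostar.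
  move=> n G L _; set p := fun v => hatC \in L v; set q := fun v => hatI \in L v.
  have [//|//|s D|t [s [Hr Ht R]]] := @search_program n G p q list_init_cmd (fun A l => ~~ A (lneg n l)).
    exact: list_init_spec.
  exists t, s; split=> //.
  have TC (v : 'I_n) :
      ~~ (nth 0 (graph_code G ++ bits p ++ bits q) (addr n 0 (lneg n v)) != 0) = (hatI \notin L v).
    by rewrite /lneg ltn_ord (input_lists G p q v).2 eqb0 negbK.
  have TI (v : 'I_n) :
      ~~ (nth 0 (graph_code G ++ bits p ++ bits q) (addr n 0 (lneg n (n + v))) != 0) = (hatC \notin L v).
    have nv : (n + v < n) = false by rewrite ltnNge leq_addr.
    by rewrite /lneg nv addKn (input_lists G p q v).1 eqb0 negbK.
  case: R => [[A [SA RA nA M0 MA]]|[Hno M0]]; [left|right].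
    pose f (v : 'I_n) := if A v then hatC else hatI.
    have fC v : (f v == hatC) = A v by rewrite /f; case: (A v).
    have fI v : (f v == hatI) = ~~ A v by rewrite /f; case: (A v).
    pose C := [set v : 'I_n | f v == hatC].
    have AC v : A (nat_of_ord v) = (v \in C) by rewrite inE fC.
    have [cl1 ind1] := (sol_partition G AC).1 SA.
    exists f.
      split=> //.
      + move=> v; have [R1 R2] := RA v (ltn_ord v); rewrite /f; case Av : (A v); apply/negPn/negP => HN.
          by have := R2 (etrans (TI v) HN); rewrite Av.
        by have := R1 (etrans (TC v) HN); rewrite Av.
      + have <- : ~: C = [set v | f v == hatI] by apply/setP => v; rewrite !inE fC fI.
        by [].
    move=> [|l] //=; rewrite /labelling_code size_bits ltnS => Hl.
    rewrite MA; last by apply: ltn_dbl.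
    by rewrite -[l]/(val (Ordinal Hl)) nth_bits fC.
  split; last by case=> [|i] //=; rewrite M0.
  move=> f [Lf indI clC]; set C := [set v | f v == hatC] in clC.
  have CI : ~: C = [set v | f v == hatI] by apply/setP => v; rewrite !inE; case: (f v).
  apply: (Hno (indicator C)).
    apply/(sol_partition G (C := C)); first exact: indicatorE.
    by rewrite CI.
  move=> u Hu; rewrite -[u]/(val (Ordinal Hu)) indicatorE inE.
  split=> H.
    have := etrans (esym (TC (Ordinal Hu))) H; move: (Lf (Ordinal Hu)).
    by case: (f _) => // ->.
  have := etrans (esym (TI (Ordinal Hu))) H; move: (Lf (Ordinal Hu)).
  by case: (f _) => // ->.
Qed.
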